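(* For each $n\ge 1$ let $(p_1,\dots,p_n)$ (depending on $n$) be a random vector uniformly distributed on the simplex $\Delta_{n-1}=\{x=(x_1,\dots,x_n)\in\mathbb{R}^n:\ x_i\ge 0,\ \sum_{i=1}^n x_i=1\}$, regarded as the vector of increments over the fixed equi-spaced partition $\{i/n:\ i=0,\dots,n\}$ of $[0,1]$, and let $$Y_n(t)=\sum_{i=1}^{\lfloor nt\rfloor}p_i+(nt-\lfloor nt\rfloor)\,p_{\lfloor nt\rfloor+1},\qquad t\in[0,1].$$ Let $\gamma_{id}:[0,1]\to[0,1]$, $\gamma_{id}(t)=t$. Then, in $C([0,1])$ equipped with the uniform topology, $Y_n$ converges in probability to $\gamma_{id}$ as $n\to\infty$. Moreover, the process $\sqrt{n}\,(Y_n(t)-\gamma_{id}(t))$, $t\in[0,1]$, converges in distribution to a standard Brownian bridge process as $n\to\infty$.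
   Context: $C([0,1])$ is the space of real-valued continuous functions on $[0,1]$, and the uniform topology is that of the norm $\|x\|=\sup_{0\le t\le1}|x(t)|$. At $t=1$ the term $(nt-\lfloor nt\rfloor)p_{\lfloor nt\rfloor+1}$ is interpreted as $0$, so $Y_n(0)=0$ and $Y_n(1)=1$. The uniform distribution on $\Delta_{n-1}$ is the Dirichlet distribution with all $n$ parameters equal to $1$. A standard Brownian bridge is the centred continuous Gaussian process on $[0,1]$ with covariance $\min(s,t)-st$. *)

(* Defs.v *)
From HB Require Import structures.
From mathcomp Require Import all_boot all_order all_algebra.
From mathcomp Require Import all_classical all_reals all_analysis.

Set Implicit Arguments.
Unset Strict Implicit.
Unset Printing Implicit Defensive.

Import Order.TTheory GRing.Theory Num.Theory.
Import numFieldNormedType.Exports.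

Local Open Scope classical_set_scope.
Local Open Scope ring_scope.

Section simplex.
Context {R : realType}.

Definition simplex n : set (n.-tuple R) :=
  [set x | (forall i : 'I_n, 0 <= tnth x i) /\ \sum_(i < n) tnth x i = 1].

(* n-dimensional Lebesgue measure, as the n-fold product of Lebesgue measure on
   the line (each step is the section formula defining a product measure); only
   its values on measurable sets are meaningful. *)
Fixpoint lebesgue_tuple n : set (n.-tuple R) -> \bar R :=
  match n with
  | 0 => fun A => \d_[tuple] A
  | m.+1 => fun A =>
      (\int[@lebesgue_measure R]_x
         @lebesgue_tuple m [set y | A (cons_tuple (x : R) y)])%E
  end.

Definition simplex_chart m (y : m.-tuple R) : m.+1.-tuple R :=
  [tuple of rcons y (1 - \sum_(i < m) tnth y i)].

(* The Dirichlet distribution with n parameters equal to 1: in the first n-1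
   coordinates its density is the constant Gamma(n) / Gamma(1)^n = (n-1)! on the
   simplex. The simplex is empty for n = 0, where the value is irrelevant. *)
Definition uniform_simplex n : set (n.-tuple R) -> \bar R :=
  match n with
  | 0 => fun=> 0%E
  | m.+1 => fun A =>
      ((m`!%:R)%:E * lebesgue_tuple (@simplex_chart m @^-1` (A `&` @simplex m.+1)))%E
  end.

(* Increments are indexed from 0, so the informal p_k is x`_(k-1); at t = 1 the
   index n is out of range and x`_n = 0. For 0 <= t, truncn is the floor. *)
Definition increment_path n (x : n.-tuple R) (t : R) : R :=
  let k := Num.truncn (n%:R * t) in
  \sum_(i < k) x`_i + (n%:R * t - k%:R) * x`_k.

End simplex.

Section continuous_paths.
Context {R : realType}.

(* The ambient function type carries the topology of uniform convergence on
   [0,1], which ignores the values outside [0,1]. *)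
Definition C01 : set {uniform` `[0, 1]%classic -> R} :=
  [set f | {within `[0, 1], continuous (f : R -> R)}].

Definition sup_norm01 (f : R -> R) : R := sup [set `|f t| | t in `[0, 1]].

Definition cvg_in_probability (d : nat -> measure_display)
    (T : forall n, measurableType (d n)) (P : forall n, probability (T n) R)
    (X : forall n, T n -> R -> R) (f : R -> R) : Prop :=
  forall e : R, 0 < e ->
    (fun n => P n [set w | e <= sup_norm01 (fun t => X n w t - f t)]) @ \oo --> 0%E.

(* Convergence of the expectations of all bounded continuous functionals on
   C([0,1]), the paths of X n and Z being understood to lie in C01. *)
Definition cvg_in_distribution (d : nat -> measure_display)
    (T : forall n, measurableType (d n)) (P : forall n, probability (T n) R)
    (X : forall n, T n -> R -> R)
    (d' : measure_display) (T' : measurableType d') (P' : probability T' R)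
    (Z : T' -> R -> R) : Prop :=
  forall F : {uniform` `[0, 1]%classic -> R} -> R,
    {within C01, continuous F} ->
    (exists M : R, forall f, C01 f -> `|F f| <= M) ->
    (fun n => 'E_(P n)[fun w => F (X n w)])%E @ \oo --> ('E_P'[fun w => F (Z w)])%E.

End continuous_paths.

Section brownian_bridge.
Context {R : realType} {d : measure_display} {T : measurableType d}.
Variable P : probability T R.

(* Degenerate Gaussian laws are Dirac masses; they are treated apart because
   normal_prob m 0 is not one. *)
Definition gaussian (X : T -> R) : Prop :=
  exists m s : R, forall A : set R, measurable A ->
    P (X @^-1` A) = if s == 0 then \d_m A else normal_prob m s A.

Definition brownian_bridge (B : T -> R -> R) : Prop :=
  [/\ forall w, C01 (B w),
      forall t, t \in `[0, 1] -> measurable_fun [set: T] (B ^~ t),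
      forall k (a t : 'I_k -> R), (forall i, t i \in `[0, 1]) ->
        gaussian (fun w => \sum_(i < k) a i * B w (t i)),
      forall t, t \in `[0, 1] -> ('E_P[B ^~ t] = 0)%E &
      forall s t, s \in `[0, 1] -> t \in `[0, 1] ->
        covariance P (B ^~ s) (B ^~ t) = (Num.min s t - s * t)%:E].

End brownian_bridge.

(* Main.v *)
Require Import Defs.
From HB Require Import structures.
From mathcomp Require Import all_boot all_order all_algebra.
From mathcomp Require Import all_classical all_reals all_analysis.
From mathcomp Require Import measurable_realfun ring lra.

Set Implicit Arguments.
Unset Strict Implicit.
Unset Printing Implicit Defensive.

Import Order.TTheory GRing.Theory Num.Theory.
Import numFieldNormedType.Exports.

Local Open Scope classical_set_scope.
Local Open Scope ring_scope.

(* For a uniform point p of the simplex with n = m + 1 coordinates, the moments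
   of a linear form are complete homogeneous symmetric polynomials of its
   coefficients: E (sum c_i p_i)^k = k! m! / (m + k)! h_k(c). Newton's identities
   express h_k by power sums. If the coefficients sum to 0, are uniformly small
   and their squares sum to about v, then h_k tends to the k-th moment of
   N(0, v) divided by k!; hence the moments of linear combinations of values of
   the scaled path converge to those of the Brownian bridge. As the Taylor
   remainders of cosine are controlled by even moments, and trigonometric sums
   approximate Lipschitz functions on R^N with an error of quadratic growth, this
   gives convergence of the expectations of Lipschitz functions of finitely many
   values.

   Tightness is obtained from k = 4: increments over dyadic intervals of length
   at least 1/n have fourth moment at most 9 times the squared length, the
   monotonicity of the unscaled path handles shorter intervals, and dyadic
   chaining bounds the expected distance in sup norm to the step path sampled at
   the multiples of 2^-r, uniformly in n. So expectations converge for bounded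
   functionals that are Lipschitz for the sup norm. A bounded continuous
   functional F on C([0,1]) is the increasing limit of such functionals, namely
   of inf_y min(M, F y + k |x - y|), which gives the lower semicontinuity of the
   expectation of F; apply it to F and - F. *)

(** * Complete homogeneous polynomials *)

(** Only the moment formula is special to the uniform law; it takes the place of a representation of
    p by normalized exponential variables. It is proved for non-negative integrands, so that
    Tonelli's theorem applies without integrability conditions, and signed powers are reached by
    adding a constant. The quadratic growth of the approximation error is what makes moments
    sufficient: second moments converge, hence stay bounded, and the test function needs no
    truncation. Paths sampled on a dyadic grid are not continuous, so a functional on C([0,1])
    cannot be evaluated at them; its Lipschitz minorants can, since they are defined on all bounded
    functions. C([0,1]) carries no sigma-algebra here: each functional of a random path is shown
    measurable as a limit of functions of finitely many values. Finally, the law gives membership in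
    the simplex only almost surely, whereas the path estimates are deterministic statements about
    points of the simplex; a modification with values in the simplex links the two. *)

Lemma cvg_sumr (R : realType) (I : Type) (r : seq I) (u : I -> nat -> R)
    (l : I -> R) : (forall i, u i n @[n --> \oo] --> l i) ->
  \sum_(i <- r) u i n @[n --> \oo] --> \sum_(i <- r) l i.
Proof. by move=> ul; apply: cvg_big => //; exact: add_continuous. Qed.

Section complete_homogeneous.
Context {R : realType}.
Implicit Types (s : seq R) (c v : R) (k j : nat).

(** Complete homogeneous symmetric polynomial of degree [k] in the entries of [s]. Splitting
    monomials by the exponent of the first variable mirrors the slicing of the simplex by its first
    coordinate. *)
Fixpoint hsym s k : R :=
  match s with
  | [::] => (k == 0)%:R
  | c :: s' => \sum_(j < k.+1) c ^+ j * hsym s' (k - j)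
  end.

Definition power_sum s j : R := \sum_(c <- s) c ^+ j.

Lemma hsym0 s : hsym s 0 = 1.
Proof. by elim: s => //= c s IH; rewrite big_ord1 expr0 mul1r. Qed.

(** A monomial of degree [k.+1] either avoids [c] or is [c] times a monomial of degree [k]. *)
Lemma hsym_consS c s k :
  hsym (c :: s) k.+1 = hsym s k.+1 + c * hsym (c :: s) k.
Proof.
rewrite /= big_ord_recl expr0 mul1r subn0; congr (_ + _).
rewrite mulr_sumr; apply: eq_bigr => i _.
by rewrite exprS mulrA subSS.
Qed.

Arguments hsym : simpl never.

Lemma newton_hsym s k :
  k.+1%:R * hsym s k.+1 = \sum_(j < k.+1) power_sum s j.+1 * hsym s (k - j).
Proof.
elim: s k => [|c s IHs] k.
  rewrite /hsym mulr0 big1// => i _.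
  by rewrite /power_sum big_nil mul0r.
have pE j : power_sum (c :: s) j = c ^+ j + power_sum s j.
  by rewrite /power_sum big_cons.
elim: k => [|k IHk].
  have := IHs 0%N; rewrite !big_ord1 !hsym0 !mulr1 !mul1r => h1.
  by rewrite hsym_consS hsym0 mulr1 h1 pE expr1 addrC.
(* [hsym_consS] is applied and [k.+2] is split as [k.+1 + 1]: [IHk] then serves the first term and
   [IHs] the second. *)
transitivity (c * (k.+1%:R * hsym (c :: s) k.+1) + k.+2%:R * hsym s k.+2
              + c * hsym (c :: s) k.+1).
  by rewrite hsym_consS -[k.+2%:R]natr1; ring.
rewrite IHk IHs.
have -> : \sum_(j < k.+2) power_sum (c :: s) j.+1 * hsym (c :: s) (k.+1 - j) =
    \sum_(j < k.+2) c ^+ j.+1 * hsym (c :: s) (k.+1 - j) +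
    \sum_(j < k.+2) power_sum s j.+1 * hsym (c :: s) (k.+1 - j).
  by rewrite -big_split/=; apply: eq_bigr => i _; rewrite pE mulrDl.
have -> : \sum_(j < k.+2) c ^+ j.+1 * hsym (c :: s) (k.+1 - j) =
    c * hsym (c :: s) k.+1 +
    c * \sum_(j < k.+1) c ^+ j.+1 * hsym (c :: s) (k - j).
  rewrite big_ord_recl subn0 expr1; congr (_ + _).
  rewrite mulr_sumr; apply: eq_bigr => i _.
  by rewrite exprS mulrA.
have -> : \sum_(j < k.+2) power_sum s j.+1 * hsym (c :: s) (k.+1 - j) =
    \sum_(j < k.+2) power_sum s j.+1 * hsym s (k.+1 - j) +
    c * \sum_(j < k.+1) power_sum s j.+1 * hsym (c :: s) (k - j).
  rewrite big_ord_recr [in RHS]big_ord_recr/= subnn !hsym0 addrAC; congr (_ + _).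
  rewrite mulr_sumr -big_split/=; apply: eq_bigr => i _.
  rewrite subSn; last by rewrite -ltnS.
  by rewrite hsym_consS mulrDr mulrCA.
have -> : \sum_(j < k.+1) power_sum (c :: s) j.+1 * hsym (c :: s) (k - j) =
    \sum_(j < k.+1) c ^+ j.+1 * hsym (c :: s) (k - j) +
    \sum_(j < k.+1) power_sum s j.+1 * hsym (c :: s) (k - j).
  by rewrite -big_split/=; apply: eq_bigr => i _; rewrite pE mulrDl.
by ring.
Qed.

Lemma hsym4 s : power_sum s 1 = 0 ->
  hsym s 4 = ((power_sum s 2) ^+ 2 / 2 + power_sum s 4) / 4.
Proof.
move=> p1.
have := newton_hsym s 3; have := newton_hsym s 1; have := newton_hsym s 0.
rewrite !big_ord_recr !big_ord0/= p1 !subnn hsym0 => h1 h2 h4.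
have {h1} h1 : hsym s 1 = 0 by lra.
move: h4 h2; rewrite h1 /subn/= => h4 h2.
have {}h2 : hsym s 2 = power_sum s 2 / 2 by lra.
by move: h4; rewrite h2; lra.
Qed.

(* The moments of N(0, v), divided by factorials. *)
Fixpoint gauss_coef v k : R :=
  match k with
  | 0 => 1
  | 1 => 0
  | k'.+2 => v / k'.+2%:R * gauss_coef v k'
  end.

Lemma gauss_coef_even v k :
  gauss_coef v k.*2 = (v / 2) ^+ k / k`!%:R.
Proof.
elim: k => [|k IH]; first by rewrite fact0 expr0 divr1.
rewrite doubleS/= IH exprS factS natrM invfM.
have -> : k.*2.+2%:R = 2 * k.+1%:R :> R by rewrite -doubleS -mul2n natrM.
by rewrite invfM; ring.
Qed.

Lemma power_sum_le s (e : R) j : (forall c, c \in s -> `|c| <= e) ->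
  `|power_sum s (j + 2)| <= e ^+ j * power_sum s 2.
Proof.
move=> H; rewrite /power_sum mulr_sumr.
apply: le_trans (ler_norm_sum _ _ _) _.
rewrite big_seq [leRHS]big_seq; apply: ler_sum => c cs.
rewrite exprD normrM normrX (ger0_norm (sqr_ge0 c)).
have ce := H _ cs; rewrite ler_wpM2r ?sqr_ge0// lerXn2r ?nnegrE//.
exact: le_trans ce.
Qed.

(** Power sums of order at least 3 are at most a positive power of [e n] times a convergent
    sequence, so only the second one survives in Newton's identities, which become the recursion of
    [gauss_coef] in the limit. *)
Lemma cvg_hsym (d : nat -> seq R) (e : nat -> R) v k :
  (forall n, power_sum (d n) 1 = 0) ->
  power_sum (d n) 2 @[n --> \oo] --> v ->
  (forall n c, c \in d n -> `|c| <= e n) ->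
  e @ \oo --> (0 : R) ->
  hsym (d n) k @[n --> \oo] --> gauss_coef v k.
Proof.
move=> p1 p2 de ecvg.
have pj j : power_sum (d n) (j + 3) @[n --> \oo] --> (0 : R).
  apply/norm_cvg0P.
  apply: (@squeeze_cvgr _ _ _ _ (cst 0)
     (fun n => (e n) ^+ j.+1 * power_sum (d n) 2)).
  - near=> n; rewrite normr_ge0/=.
    have := @power_sum_le (d n) (e n) j.+1 (de n).
    by rewrite addSnnS.
  - exact: cvg_cst.
  - rewrite -[X in _ --> X](mul0r v); apply: cvgM => //.
    rewrite -[X in _ --> X](expr0n R j.+1).
    exact: (cvg_comp _ _ ecvg (@exprn_continuous _ _ _)).
elim/ltn_ind: k => k IH; case: k IH => [|[|k]] IH.
- under eq_cvg do rewrite hsym0.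
  exact: cvg_cst.
- rewrite (_ : (fun n => _) = cst 0); first exact: cvg_cst.
  apply/funext => n; have := newton_hsym (d n) 0.
  by rewrite mul1r big_ord1 p1 mul0r.
(* The identity of order [k.+2] without its vanishing first term; the second power sum is set apart
   from the negligible ones. *)
- have hE n : hsym (d n) k.+2 =
      k.+2%:R^-1 * (power_sum (d n) 2 * hsym (d n) k +
       \sum_(j < k) power_sum (d n) (j + 3) * hsym (d n) (k.+1 - j.+2)).
    have := newton_hsym (d n) k.+1.
    rewrite big_ord_recl p1 mul0r add0r big_ord_recl/= => E.
    apply: (mulfI (_ : k.+2%:R != 0)); first by rewrite pnatr_eq0.
    rewrite E mulVKf ?pnatr_eq0//.
    congr (_ * hsym _ _ + _); first by rewrite subSS subn0.
    by apply: eq_bigr => i _; rewrite addn3.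
  under eq_cvg do rewrite hE.
  rewrite /= mulrAC mulrC -[v * _]addr0.
  apply: cvgM; first exact: cvg_cst.
  apply: cvgD; first by apply: cvgM => //; exact: IH.
  rewrite -[X in _ --> X](_ : \sum_(j < k) 0 * gauss_coef v (k.+1 - j.+2) = 0); last first.
    by rewrite big1// => i _; rewrite mul0r.
  apply: cvg_sumr => i; apply: cvgM; first exact: pj.
  by apply: IH; rewrite ltnS leq_subr.
Unshelve. all: by end_near. Qed.

End complete_homogeneous.

Arguments hsym : simpl never.

(** * Moments of linear forms on the simplex *)

Section pointwise_derivatives.
Context {R : realType}.
Implicit Types (f g : R -> R) (x : R).

Lemma is_deriveD_fun f g x df dg : is_derive x 1 f df -> is_derive x 1 g dg ->
  is_derive x 1 (fun y => f y + g y) (df + dg).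
Proof. by move=> hf hg; exact: is_deriveD. Qed.

Lemma is_deriveN_fun f x df : is_derive x 1 f df ->
  is_derive x 1 (fun y => - f y) (- df).
Proof. by move=> hf; exact: is_deriveN. Qed.

Lemma is_deriveM_fun f g x df dg : is_derive x 1 f df -> is_derive x 1 g dg ->
  is_derive x 1 (fun y => f y * g y) (df * g x + f x * dg).
Proof.
move=> hf hg; have := is_deriveM hf hg => h.
by apply: (is_derive_eq h); rewrite addrC mulrC.
Qed.

Lemma is_derive_sum_fun (I : Type) (r : seq I) (h dh : I -> R -> R) x :
  (forall i, is_derive x 1 (h i) (dh i x)) ->
  is_derive x 1 (fun y => \sum_(i <- r) h i y) (\sum_(i <- r) dh i x).
Proof.
move=> H; elim: r => [|i r IH].
  under eq_fun do rewrite big_nil; rewrite big_nil.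
  exact: is_derive_cst.
under eq_fun do rewrite big_cons; rewrite big_cons.
exact: is_deriveD_fun.
Qed.

Lemma is_derive_comp_fun f g x df dg : is_derive (g x) 1 f df ->
  is_derive x 1 g dg -> is_derive x 1 (fun y => f (g y)) (df * dg).
Proof. by move=> hf hg; exact: is_derive1_comp. Qed.

Lemma is_derive_continuous f x df : is_derive x 1 f df -> {for x, continuous f}.
Proof. by move=> [d _]; exact/differentiable_continuous/derivable1_diffP. Qed.

Lemma is_derive_exprn n x : is_derive x 1 (fun y : R => y ^+ n.+1) (n.+1%:R * x ^+ n).
Proof.
elim: n => [|n IH]; first by rewrite mulr1; exact: is_derive_id.
have := is_deriveM_fun (is_derive_id x (1 : R)) IH => {}IH.
under eq_fun do rewrite exprS.
by apply: (is_derive_eq IH); rewrite -[n.+2%:R]natr1 exprS; ring.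
Qed.

Lemma integral_is_derive f g a b : a <= b ->
  (forall x, is_derive x 1 g (f x)) -> continuous f ->
  (\int[lebesgue_measure]_(x in `[a, b]) (f x)%:E = (g b - g a)%:E)%E.
Proof.
rewrite le_eqVlt => /predU1P[<- _ _|ab dg cf].
  by rewrite set_itv1 integral_set1 subrr.
have cg : continuous g by move=> x; exact: is_derive_continuous (dg x).
rewrite (@continuous_FTC2 _ f g)//.
- exact: continuous_subspaceT.
- split; first by move=> x _; have [] := dg x.
  + by apply: cvg_at_right_filter; exact: cg.
  + by apply: cvg_at_left_filter; exact: cg.
- by move=> x _; rewrite derive1E; have [] := dg x.
Qed.

End pointwise_derivatives.

Section divided_power.
Context {R : realType}.
Implicit Types (s x : R).

(** Divided powers: differentiation and the binomial formula lose their numerical coefficients, and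
    so does the beta integral. *)
Definition dpow k x : R := x ^+ k / k`!%:R.

Lemma dpow0 x : dpow 0 x = 1.
Proof. by rewrite /dpow expr0 fact0 divr1. Qed.

Lemma dpowS0 k : dpow k.+1 0 = 0.
Proof. by rewrite /dpow expr0n mul0r. Qed.

Lemma dpowD k x y : dpow k (x + y) = \sum_(j < k.+1) dpow j x * dpow (k - j) y.
Proof.
rewrite /dpow addrC exprDn mulr_suml; apply: eq_bigr => i _.
have ik : (i <= k)%N by rewrite -ltnS.
rewrite -(bin_fact ik) -mulr_natr !natrM.
have b0 : 'C(k, i)%:R != 0 :> R by rewrite pnatr_eq0 -lt0n bin_gt0.
have f0 l : l`!%:R != 0 :> R by rewrite pnatr_eq0 -lt0n fact_gt0.
by field; rewrite b0 !f0.
Qed.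

Lemma is_derive_dpow k x : is_derive x 1 (dpow k.+1) (dpow k x).
Proof.
have := is_deriveM_fun (is_derive_exprn k x) (is_derive_cst (k.+1`!%:R^-1 : R) (x : R) 1).
move=> {}h; apply: (is_derive_eq h).
rewrite /cst /dpow factS natrM mulr0 addr0; field.
by rewrite addrC natr1 !pnatr_eq0 -lt0n fact_gt0.
Qed.

Lemma is_derive_dpowB k s x :
  is_derive x 1 (fun y => dpow k.+1 (s - y)) (- dpow k (s - x)).
Proof.
have h : is_derive x 1 (fun y : R => s - y) (0 - 1).
  by apply: is_deriveD_fun; exact: is_deriveN_fun.
have {}h := @is_derive_comp_fun _ (dpow k.+1) (fun y => s - y) _ _ _ (is_derive_dpow k (s - x)) h.
by apply: (is_derive_eq h); rewrite sub0r mulrN1.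
Qed.

Lemma continuous_dpow k : continuous (dpow k).
Proof.
case: k => [|k] x; last exact: is_derive_continuous (is_derive_dpow k x).
by rewrite (_ : dpow 0 = cst 1); [exact: cvg_cst|exact/funext/dpow0].
Qed.

(* A primitive of [x ^ a / a! * (s - x) ^ b / b!], from repeated integration by
   parts. *)
Fixpoint dpow_prim s a b x : R :=
  match a with
  | 0 => - dpow b.+1 (s - x)
  | a'.+1 => dpow_prim s a' b.+1 x - dpow a'.+1 x * dpow b.+1 (s - x)
  end.

Lemma is_derive_dpow_prim s a b x :
  is_derive x 1 (dpow_prim s a b) (dpow a x * dpow b (s - x)).
Proof.
elim: a b => [|a IH] b /=.
  have := is_deriveN_fun (is_derive_dpowB b s x) => h.
  by apply: (is_derive_eq h); rewrite opprK dpow0 mul1r.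
have h1 := is_deriveM_fun (is_derive_dpow a x) (is_derive_dpowB b s x).
have h := is_deriveD_fun (IH b.+1) (is_deriveN_fun h1).
by apply: (is_derive_eq h); ring.
Qed.

Lemma dpow_prim_end s a b : dpow_prim s a b s = 0.
Proof.
elim: a b => [|a IH] b /=; rewrite subrr dpowS0 ?oppr0//.
by rewrite IH mulr0 subr0.
Qed.

Lemma dpow_prim0 s a b : dpow_prim s a b 0 = - dpow (a + b).+1 s.
Proof.
elim: a b => [|a IH] b /=; rewrite ?subr0//.
by rewrite IH dpowS0 mul0r subr0 addnS addSn.
Qed.

(** Euler's beta integral: the convolution of [dpow a] and [dpow b] is [dpow (a + b).+1]. With
    linear combinations in the statement, one primitive serves the whole sum and the terms raise no
    integrability conditions. *)
Lemma integral_dpow_conv s (I : Type) (r : seq I) (c : I -> R) (a b : I -> nat) :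
  0 <= s ->
  (\int[lebesgue_measure]_(x in `[0%R, s])
     (\sum_(i <- r) c i * (dpow (a i) x * dpow (b i) (s - x)))%:E =
   (\sum_(i <- r) c i * dpow (a i + b i).+1 s)%:E)%E.
Proof.
move=> s0.
have dG x : is_derive x 1 (fun x => \sum_(i <- r) c i * dpow_prim s (a i) (b i) x)
   (\sum_(i <- r) c i * (dpow (a i) x * dpow (b i) (s - x))).
  apply: (@is_derive_sum_fun _ _ _ _ (fun i x =>
    c i * (dpow (a i) x * dpow (b i) (s - x)))) => i.
  have h := is_deriveM_fun (is_derive_cst (c i : R) (x : R) 1) (is_derive_dpow_prim s (a i) (b i) x).
  by apply: (is_derive_eq h); rewrite mul0r add0r.
rewrite (integral_is_derive s0 dG).
  under eq_bigr do rewrite dpow_prim_end mulr0.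
  under [X in _ - X]eq_bigr do rewrite dpow_prim0 mulrN.
  by rewrite sumrN opprK big1_eq add0r.
move=> x; apply: cvg_big => [|i _]; first exact: add_continuous.
apply: cvgM; first exact: cvg_cst.
apply: cvgM; first exact: continuous_dpow.
apply: (cvg_comp _ _ (_ : s - y @[y --> x] --> s - x) (@continuous_dpow _ _)).
by apply: cvgB; [exact: cvg_cst|exact: cvg_id].
Qed.

End divided_power.

(** * Integrals of polynomials of a linear form over the simplex *)

Section lebesgue_tuple_measure.
Context {R : realType}.
Local Notation leb := (@lebesgue_measure R).
Implicit Types (s : R) (c : seq R) (a : nat -> R).

Definition subsimplex m s : set (m.-tuple R) :=
  [set y | (forall i, 0 <= tnth y i) /\ \sum_(i < m) tnth y i <= s].

(** The linear form with coefficients [c] at the point of the simplex of size [s] whose first [m]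
    coordinates are [y]; the last coordinate is what remains. *)
Definition simplex_form c m s (y : m.-tuple R) : R :=
  \sum_(i < m) c`_i * tnth y i + c`_m * (s - \sum_(i < m) tnth y i).

Definition dpow_poly a K (u : R) : R := \sum_(k < K) a k * dpow k u.

(** In short, L ^ k / k! integrates to h_k(c) s ^ (m + k) / (m + k)!. Arbitrary coefficients [a] are
    kept because expanding around the first coordinate produces new ones, and because an odd power
    alone need not be non-negative. *)
Definition subsimplex_formula m (mu : {measure set (m.-tuple R) -> \bar R}) :=
  forall c s a K, size c = m.+1 -> 0 <= s ->
    (forall y : m.-tuple R, subsimplex s y -> 0 <= dpow_poly a K (simplex_form c s y)) ->
    (\int[mu]_(y in @subsimplex m s) (dpow_poly a K (simplex_form c s y))%:E =
     (\sum_(k < K) a k * (hsym c k * dpow (m + k) s))%:E)%E.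

Lemma tnth_consS (T : Type) m (x : T) (y : m.-tuple T) (i : 'I_m) :
  tnth (cons_tuple x y) (lift ord0 i) = tnth y i.
Proof. by rewrite !(tnth_nth x). Qed.

Lemma sum_tnth_consS m x (y : m.-tuple R) :
  \sum_(i < m) tnth (cons_tuple x y) (lift ord0 i) = \sum_(i < m) tnth y i.
Proof. by apply: eq_bigr => i _; rewrite tnth_consS. Qed.

Lemma measurable_cons_tuple m :
  measurable_fun [set: R * m.-tuple R] (fun z => cons_tuple z.1 z.2).
Proof. exact: measurable_cons. Qed.

Lemma measurable_sum_tnth m (b : 'I_m -> R) :
  measurable_fun [set: m.-tuple R] (fun y => \sum_(i < m) b i * tnth y i).
Proof.
apply: measurable_sum => i; apply: measurable_funM => //.
exact: measurable_tnth.
Qed.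

Lemma measurable_subsimplex m s : measurable (@subsimplex m s).
Proof.
rewrite (_ : subsimplex s = \bigcap_(i : 'I_m) ((fun y => tnth y i) @^-1` `[0, +oo[)
   `&` (fun y => \sum_(i < m) 1 * tnth y i) @^-1` `]-oo, s]).
  apply: measurableI.
    apply: fin_bigcap_measurable => // i _.
    by rewrite -[X in measurable X]setTI; apply: measurable_tnth.
  by rewrite -[X in measurable X]setTI; apply: measurable_sum_tnth.
apply/seteqP; split=> y /=.
  move=> [y0 ys]; split; first by move=> i _ /=; rewrite in_itv/= andbT.
  by rewrite in_itv/=; under eq_bigr do rewrite mul1r.
move=> [y0 +]; rewrite in_itv/=; under eq_bigr do rewrite mul1r.
by move=> ys; split=> // i; have := y0 i I; rewrite /= in_itv/= andbT.
Qed.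

Lemma measurable_simplex_form c m s :
  measurable_fun [set: m.-tuple R] (simplex_form c s).
Proof.
apply: measurable_funD; first exact: measurable_sum_tnth.
apply: measurable_funM => //; apply: measurable_funB => //.
have := @measurable_sum_tnth m (fun=> 1 : R).
by apply: eq_measurable_fun => y _; under eq_bigr do rewrite mul1r.
Qed.

Lemma measurable_dpow_poly a K : measurable_fun [set: R] (dpow_poly a K).
Proof.
apply: measurable_sum => k; apply: measurable_funM => //.
by apply: measurable_funM => //; exact: measurable_funX.
Qed.

Lemma subsimplex_cons m s (x : R) (y : m.-tuple R) :
  subsimplex s (cons_tuple x y) <-> 0 <= x <= s /\ subsimplex (s - x) y.
Proof.
rewrite /subsimplex/= big_ord_recl tnth0 sum_tnth_consS.
split=> [[y0 ys]|[/andP[x0 xs] [y0 ys]]].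
  have h i : 0 <= tnth y i by have := y0 (lift ord0 i); rewrite tnth_consS.
  have x0 : 0 <= x by have := y0 ord0; rewrite tnth0.
  split; last by split=> //; lra.
  have : 0 <= \sum_(i < m) tnth y i by exact: sumr_ge0.
  by move: ys; lra.
split; last by lra.
move=> i; case: (unliftP ord0 i) => [j ->|->]; last by rewrite tnth0.
by rewrite tnth_consS.
Qed.

Lemma simplex_form_cons (c0 : R) c m s (x : R) (y : m.-tuple R) :
  simplex_form (c0 :: c) s (cons_tuple x y) = c0 * x + simplex_form c (s - x) y.
Proof.
rewrite /simplex_form/= !big_ord_recl tnth0/=.
under eq_bigr do rewrite tnth_consS.
by rewrite sum_tnth_consS opprD; ring.
Qed.

Lemma dpow_polyD a K x u : dpow_poly a K (x + u) =
  dpow_poly (fun i => \sum_(k < K | (i <= k)%N) a k * dpow (k - i) x) K u.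
Proof.
rewrite /dpow_poly.
under [RHS]eq_bigr do rewrite mulr_suml big_mkcond.
rewrite exchange_big/=; apply: eq_bigr => k _.
rewrite addrC dpowD mulr_sumr.
rewrite (big_ord_widen K (fun i => a k * (dpow i u * dpow (k - i) x)))//.
rewrite big_mkcond/=; apply: eq_bigr => i _; rewrite ltnS.
by case: ifP => // _; ring.
Qed.

Lemma subsimplex_formula0 (mu : {measure set (0.-tuple R) -> \bar R}) :
  (forall A, measurable A -> mu A = \d_([tuple] : 0.-tuple R) A) ->
  subsimplex_formula mu.
Proof.
move=> muE c s a K; case: c => [//|c0 []//] _ s0 H.
rewrite (eq_measure_integral (\d_([tuple] : 0.-tuple R))); last first.
  by move=> A mA _; exact: muE.
rewrite integral_dirac//; last 2 first.
- exact: measurable_subsimplex.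
- apply/measurable_EFinP; apply: measurableT_comp; first exact: measurable_dpow_poly.
  exact: measurable_funTS (measurable_simplex_form _ _).
rewrite diracE mem_set ?mul1e; last first.
  by split; [case|rewrite big_ord0].
congr EFin; apply: eq_bigr => k _; congr (_ * _).
rewrite /simplex_form !big_ord0 add0r subr0/= add0n /hsym big_ord_recr/=.
rewrite subnn mulr1 big1 ?add0r; last first.
  by move=> i _; rewrite subn_eq0 leqNgt ltn_ord mulr0.
by rewrite /dpow exprMn mulrA.
Qed.

Section cons_measure.
Variables (m : nat) (mu : {sigma_finite_measure set (m.-tuple R) -> \bar R}).

(** [lebesgue_tuple] is a bare set function; this is the measure that agrees with it on measurable
    sets when [mu] does so one dimension lower. Sigma-finiteness is carried along for the product
    and for Tonelli's theorem. *)
Definition cons_measure : set (m.+1.-tuple R) -> \bar R :=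
  pushforward (leb \x mu)%E (fun z : R * m.-tuple R => cons_tuple z.1 z.2).

Let mc := @measurable_cons_tuple m.

Let cons_measure0 : cons_measure set0 = 0%E.
Proof. by rewrite /cons_measure /pushforward preimage_set0 measure0. Qed.

Let cons_measure_ge0 A : (0 <= cons_measure A)%E.
Proof. exact: measure_ge0. Qed.

Let cons_measure_sigma_additive : semi_sigma_additive cons_measure.
Proof.
move=> F mF tF mUF; rewrite /cons_measure /pushforward preimage_bigcup.
apply: measure_semi_sigma_additive.
- by move=> n; rewrite -[X in measurable X]setTI; exact: mc.
- by move/trivIsetP : tF => tF; apply/trivIsetP => i j _ _ ij;
    rewrite -preimage_setI tF// preimage_set0.
- by rewrite -preimage_bigcup -[X in measurable X]setTI; exact: mc.
Qed.

HB.instance Definition _ := isMeasure.Build _ _ _ cons_measure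
  cons_measure0 cons_measure_ge0 cons_measure_sigma_additive.

Let cons_measure_sigma_finite : sigma_finite setT cons_measure.
Proof.
have /sigma_finiteP[F [FT ndF Foo]] := sigma_finiteT leb.
have /sigma_finiteP[G [GT ndG Goo]] := sigma_finiteT mu.
pose g (t : m.+1.-tuple R) : R * m.-tuple R := (thead t, [tuple of behead t]).
(* Both exhausting sequences are non-decreasing, so a point with coordinates in [F i] and [G j] lies
   in the product of index [maxn i j]. *)
exists (fun n => g @^-1` (F n `*` G n)).
  rewrite -preimage_bigcup; apply/seteqP; split => // t _ /=.
  have : [set: R] (g t).1 by [].
  rewrite FT => -[i _ Fi].
  have : [set: m.-tuple R] (g t).2 by [].
  rewrite GT => -[j _ Gj].
  exists (maxn i j) => //; split.
    by have /subsetPset := ndF _ _ (leq_maxl i j); exact.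
  by have /subsetPset := ndG _ _ (leq_maxr i j); exact.
move=> n; have [mF Fn] := Foo n; have [mG Gn] := Goo n; split.
  rewrite -[X in measurable X]setTI.
  have mg : measurable_fun setT g.
    apply: measurable_fun_pair; first exact: measurable_tnth.
    exact: measurable_behead.
  by apply: mg => //; exact: measurableX.
rewrite /cons_measure /pushforward -comp_preimage (_ : g \o _ = id).
  by rewrite preimage_id product_measure1E// lte_mul_pinfty// ge0_fin_numE.
apply/funext => -[x y]; rewrite /g/=; congr pair.
by apply: val_inj.
Qed.

HB.instance Definition _ := Measure_isSigmaFinite.Build _ _ _ cons_measure
  cons_measure_sigma_finite.

End cons_measure.

(* The layer [y_0 = x] of the subsimplex of size [s] is the subsimplex of size
   [s - x], and the truncated exponential [dpow_poly] is expanded by the binomial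
   formula, so that the induction hypothesis reduces the integral to a beta
   integral. *)
Lemma subsimplex_formulaS m (mu : {sigma_finite_measure set (m.-tuple R) -> \bar R}) :
  subsimplex_formula mu -> subsimplex_formula (cons_measure mu).
Proof.
move=> IH c s a K; case: c => [//|c0 c] [sc] s0 F0.
set f := fun y : m.+1.-tuple R => (dpow_poly a K (simplex_form (c0 :: c) s y))%:E.
have mf : measurable_fun setT f.
  apply/measurable_EFinP; apply: measurableT_comp; first exact: measurable_dpow_poly.
  exact: measurable_simplex_form.
have mD := @measurable_subsimplex m.+1 s.
have mfD : measurable_fun setT (f \_ (subsimplex s)).
  by apply/(measurable_restrictT _ _).1 => //; exact: measurable_funTS.
have f0 y : (0 <= (f \_ (subsimplex s)) y)%E.
  rewrite patchE; case: ifPn => // /[!inE] yD.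
  by rewrite lee_fin F0.
rewrite integral_mkcond.
have mc := @measurable_cons_tuple m.
rewrite ge0_integral_pushforward//.
rewrite preimage_setT fubini_tonelli1;
  [|exact: measurableT_comp mfD mc|by move=> z; exact: f0].
rewrite /fubini_F/=.
pose b x i := \sum_(k < K | (i <= k)%N) a k * dpow (k - i) (c0 * x).
pose g x := \sum_(i < K) b x i * (hsym c i * dpow (m + i) (s - x)).
transitivity (\int[leb]_x ((fun x => (g x)%:E) \_ `[0%R, s]) x)%E.
  apply: eq_integral => x _; rewrite patchE; case: ifPn => [/[!inE]|/negP xD].
    rewrite /= in_itv/= => /andP[x0 xs].
    have E (y : m.-tuple R) :
        dpow_poly a K (simplex_form (c0 :: c) s (cons_tuple x y)) =
        dpow_poly (b x) K (simplex_form c (s - x) y).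
      by rewrite simplex_form_cons dpow_polyD.
    have DE (y : m.-tuple R) :
        subsimplex s (cons_tuple x y) <-> subsimplex (s - x) y.
      split; first by move=> /subsimplex_cons[].
      by move=> h; apply/subsimplex_cons; rewrite x0 xs.
    rewrite -IH ?subr_ge0//; last first.
      by move=> y yD; rewrite -E; apply: F0; apply/DE.
    rewrite [RHS]integral_mkcond; apply: eq_integral => y _.
    rewrite !patchE E; congr (if _ then _ else _).
    by apply/idP/idP; rewrite !inE => /DE.
  apply: integral0_eq => y _; rewrite patchE ifF//.
  apply/negP; rewrite inE => /subsimplex_cons[xs _].
  by apply: xD; rewrite inE/= in_itv.
rewrite -integral_mkcond.
transitivity (\int[leb]_(x in `[0%R, s]) (\sum_(p : 'I_K * 'I_K) (if (p.2 <= p.1)%N then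
   a p.1 * (c0 ^+ (p.1 - p.2) * hsym c p.2) else 0) *
   (dpow (p.1 - p.2) x * dpow (m + p.2) (s - x)))%:E)%E.
  apply: eq_integral => x _; congr EFin; rewrite /g /b.
  under eq_bigr do rewrite mulr_suml big_mkcond/=.
  rewrite exchange_big pair_bigA/=; apply: eq_bigr => -[k i] _ /=.
  case: ifP => _; last by rewrite mul0r.
  by rewrite /dpow exprMn; ring.
rewrite integral_dpow_conv//; congr EFin.
rewrite -(pair_bigA _ (fun k i : 'I_K => (if (i <= k)%N then
   a k * (c0 ^+ (k - i) * hsym c i) else 0) * dpow ((k - i) + (m + i)).+1 s))/=.
apply: eq_bigr => k _; rewrite {2}/hsym -/hsym mulr_suml mulr_sumr.
rewrite [in RHS](reindex_inj rev_ord_inj)/=.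
rewrite (eq_bigr (fun i : 'I_k.+1 =>
    a k * (c0 ^+ (k - i) * hsym c i * dpow (m.+1 + k) s))); last first.
  by move=> i _; rewrite subSS subKn// -ltnS.
rewrite (big_ord_widen K (fun i => a k * (c0 ^+ (k - i) * hsym c i * dpow (m.+1 + k) s)))//.
  rewrite [in RHS]big_mkcond/=; apply: eq_bigr => i _; rewrite ltnS.
  case: ifP => ik; last by rewrite mul0r.
  by rewrite addnCA subnK// addSn; ring.
Qed.

Lemma lebesgue_tuple_measure m :
  exists mu : {sigma_finite_measure set (m.-tuple R) -> \bar R},
    (forall A, measurable A -> lebesgue_tuple A = mu A) /\ subsimplex_formula mu.
Proof.
elim: m => [|m [mu [muE IH]]].
  exists (\d_([tuple] : 0.-tuple R)); split => //.
  exact: subsimplex_formula0.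
exists (cons_measure mu); split; last exact: subsimplex_formulaS.
move=> A mA; rewrite /cons_measure /pushforward /product_measure1/=.
apply: eq_integral => x _; rewrite muE//.
  by congr (mu _); apply/seteqP; split => y /=; rewrite /xsection/= inE.
rewrite -[X in measurable X]setTI.
have h : measurable_fun [set: m.-tuple R] (fun y : m.-tuple R => cons_tuple x y).
  exact: (measurableT_comp (@measurable_cons_tuple m) (pair1_measurable x)).
exact: h.
Qed.

End lebesgue_tuple_measure.

Lemma bounded_RV_integrable (R : realType) d (T : measurableType d)
    (P : probability T R) (f : T -> R) (C : R) :
  measurable_fun setT f -> (forall w, `|f w| <= C) ->
  P.-integrable setT (fun w => (f w)%:E).
Proof.
move=> mf fC; apply: (@le_integrable _ _ _ P setT measurableT _ (EFin \o cst C)).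
- exact/measurable_EFinP.
- by move=> w _; rewrite /= lee_fin (le_trans (fC w))// ler_norm.
- exact: finite_measure_integrable_cst.
Qed.

Lemma integral_cst_prob (R : realType) d (T : measurableType d)
    (P : probability T R) (r : R) : (\int[P]_w r%:E = r%:E)%E.
Proof.
apply: etrans (integral_cst P measurableT r%:E) _.
by rewrite [X in (_ * X)%E](_ : _ = 1%E) ?mule1//; exact: probability_setT.
Qed.

(** * Moments of the uniform law on the simplex *)

Section uniform_simplex_moments.
Context {R : realType}.

Lemma measurable_simplex_chart m :
  measurable_fun [set: m.-tuple R] (@simplex_chart R m).
Proof.
apply/measurable_fun_tnthP => i.
have [im|im] := ltnP i m.
  rewrite (_ : _ \o _ = (fun y => tnth y (Ordinal im))); first exact: measurable_tnth.
  apply/funext => y /=; rewrite !(tnth_nth 0)/= nth_rcons size_tuple im.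
  by [].
rewrite (_ : _ \o _ = (fun y => 1 - \sum_(i < m) 1 * tnth y i)).
  by apply: measurable_funB => //; exact: measurable_sum_tnth.
apply/funext => y /=; rewrite !(tnth_nth 0)/= nth_rcons size_tuple ltnNge im/=.
under [in RHS]eq_bigr do rewrite mul1r.
by rewrite eqn_leq im -ltnS ltn_ord.
Qed.

Lemma tnth_simplex_chart m (y : m.-tuple R) i :
  tnth (simplex_chart y) (widen_ord (leqnSn m) i) = tnth y i.
Proof. by rewrite !(tnth_nth 0)/= nth_rcons size_tuple ltn_ord. Qed.

Lemma tnth_simplex_chart_max m (y : m.-tuple R) :
  tnth (simplex_chart y) ord_max = 1 - \sum_(i < m) tnth y i.
Proof. by rewrite !(tnth_nth 0)/= nth_rcons size_tuple ltnn eqxx. Qed.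

Lemma simplex_chartP m (y : m.-tuple R) :
  simplex (simplex_chart y) <-> subsimplex 1 y.
Proof.
rewrite /simplex /subsimplex/= big_ord_recr/= tnth_simplex_chart_max.
under eq_bigr do rewrite tnth_simplex_chart.
rewrite subrKC; split=> [[y0 _]|[y0 y1]].
  split; first by move=> i; rewrite -tnth_simplex_chart.
  by have := y0 ord_max; rewrite tnth_simplex_chart_max subr_ge0.
split=> // i.
have [im|im] := ltnP i m.
  rewrite (_ : i = widen_ord (leqnSn m) (Ordinal im)); first by rewrite tnth_simplex_chart.
  exact: val_inj.
rewrite (_ : i = ord_max) ?tnth_simplex_chart_max ?subr_ge0//.
by apply: val_inj => /=; apply/eqP; rewrite eqn_leq im -ltnS ltn_ord.
Qed.

Lemma measurable_simplex m : measurable (@simplex R m).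
Proof.
rewrite (_ : @simplex R m = subsimplex 1 `&`
   (fun y => \sum_(i < m) 1 * tnth y i) @^-1` [set 1]).
  apply: measurableI; first exact: measurable_subsimplex.
  by rewrite -[X in measurable X]setTI; apply: measurable_sum_tnth.
apply/seteqP; split=> y /=; rewrite /simplex/= /subsimplex/=.
  by move=> [y0 y1]; under [X in _ /\ X = _]eq_bigr do rewrite mul1r; rewrite y1.
by under [X in _ /\ X = _ -> _]eq_bigr do rewrite mul1r; move=> [[]].
Qed.

Lemma simplex_chart_linear (c : seq R) m (y : m.-tuple R) :
  \sum_(i < m.+1) c`_i * tnth (simplex_chart y) i = simplex_form c 1 y.
Proof.
rewrite big_ord_recr/= tnth_simplex_chart_max.
by under eq_bigr do rewrite tnth_simplex_chart.
Qed.

Context d (T : measurableType d) (P : probability T R) (m : nat).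
Variable X : {RV P >-> m.+1.-tuple R}.
Hypothesis X_uniform : forall A, measurable A ->
  distribution P X A = uniform_simplex A.

Lemma uniform_simplex_formula (c : seq R) (a : nat -> R) K : size c = m.+1 ->
  (forall x : m.+1.-tuple R, simplex x ->
     0 <= dpow_poly a K (\sum_(i < m.+1) c`_i * tnth x i)) ->
  (\int[distribution P X]_(x in @simplex R m.+1)
     (dpow_poly a K (\sum_(i < m.+1) c`_i * tnth x i))%:E =
   (m`!%:R * \sum_(k < K) a k * (hsym c k / (m + k)`!%:R))%:E)%E.
Proof.
move=> sc F0.
have [mu [muE muF]] := @lebesgue_tuple_measure R m.
have mch := @measurable_simplex_chart m.
have mS := @measurable_simplex m.+1.
have f0 : (0 <= m`!%:R :> R) by [].
set f := fun x : m.+1.-tuple R => (dpow_poly a K (\sum_(i < m.+1) c`_i * tnth x i))%:E.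
have mf : measurable_fun setT f.
  apply/measurable_EFinP; apply: measurableT_comp; first exact: measurable_dpow_poly.
  exact: measurable_sum_tnth.
pose ch : {mfun (m.-tuple R) >-> m.+1.-tuple R} :=
  HB.pack (@simplex_chart R m) (isMeasurableFun.Build _ _ _ _ _ mch).
(* The two measures are compared on subsets of the simplex only: the chart also maps points outside
   [subsimplex 1], so its pushforward may have mass elsewhere. *)
rewrite (eq_measure_integral (mscale (NngNum f0) (pushforward mu ch))); last first.
  move=> A mA AS; apply: etrans (X_uniform mA) _; rewrite /uniform_simplex /mscale/= /pushforward.
  rewrite muE; last first.
    by have := mch measurableT _ (measurableI _ _ mA mS); rewrite setTI.
  by have /setIidPl -> := AS.
have mfS := measurable_funTS (D := @simplex R m.+1) mf.
have fS0 : {in @simplex R m.+1, forall x, (0 <= f x)%E}.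
  by move=> x /set_mem xS; rewrite lee_fin F0.
rewrite ge0_integral_mscale//.
rewrite ge0_integral_pushforward//.
rewrite (_ : _ @^-1` _ = subsimplex 1); last first.
  by apply/seteqP; split => y /simplex_chartP.
rewrite /=.
under eq_integral do rewrite /f/= simplex_chart_linear.
rewrite muF//; last first.
  move=> y y1; rewrite -simplex_chart_linear; apply: F0.
  exact/simplex_chartP.
rewrite -EFinM; congr (_ * _)%:E; apply: eq_bigr => k _.
by rewrite /dpow expr1n mul1r.
Qed.

(** The formula with the constant integrand 1: the mass is m! / m!. *)
Lemma uniform_simplex_as : P (X @^-1` @simplex R m.+1) = 1%E.
Proof.
have := @uniform_simplex_formula (nseq m.+1 0) (fun=> 1) 1.
rewrite size_nseq => /(_ erefl); rewrite big_ord1 hsym0 addn0 mul1r.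
rewrite mulrA mulr1 divff ?pnatr_eq0 -?lt0n ?fact_gt0// => H.
rewrite -(H _); last by move=> x _; rewrite /dpow_poly big_ord1 dpow0 mulr1.
under eq_integral do rewrite /dpow_poly big_ord1 dpow0 mulr1.
by rewrite integral_cst ?mul1e//; exact: measurable_simplex.
Qed.

(** [X'] stands for any version of [X] that never leaves the simplex; the event on which they may
    differ is null by [uniform_simplex_as]. *)
Lemma ge0_integral_on_simplex (X' : T -> m.+1.-tuple R) (f : m.+1.-tuple R -> R) :
  (forall w, simplex (X w) -> X' w = X w) -> (forall w, simplex (X' w)) ->
  measurable_fun setT X' ->
  measurable_fun setT f -> (forall x, simplex x -> 0 <= f x) ->
  (\int[P]_w (f (X' w))%:E = \int[distribution P X]_(x in @simplex R m.+1) (f x)%:E)%E.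
Proof.
move=> XX' SX' mX' mf f0.
have mS := @measurable_simplex m.+1.
have mXS : measurable (X @^-1` @simplex R m.+1).
  by rewrite -[X in measurable X]setTI; apply: measurable_funP.
rewrite (@ge0_negligible_integral _ _ _ P _ (~` (X @^-1` @simplex R m.+1)))//; last 4 first.
- exact: measurableC.
- by apply/measurable_EFinP; exact: measurableT_comp.
- by move=> w _; rewrite lee_fin f0.
- by have := probability_setC P mXS; rewrite uniform_simplex_as subee// => ->.
rewrite setTD setCK ge0_integral_pushforward//; last 2 first.
- exact: measurable_funTS (measurableT_comp _ mf).
- by move=> x /set_mem xS; rewrite lee_fin f0.
by apply: eq_integral => w /set_mem wS; rewrite XX'.
Qed.

Lemma simplex_moment (X' : T -> m.+1.-tuple R) (c : seq R) k : size c = m.+1 ->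
  (forall w, simplex (X w) -> X' w = X w) -> (forall w, simplex (X' w)) ->
  measurable_fun setT X' ->
  P.-integrable setT (fun w => ((\sum_(i < m.+1) c`_i * tnth (X' w) i) ^+ k)%:E) /\
  \int[P]_w ((\sum_(i < m.+1) c`_i * tnth (X' w) i) ^+ k) =
   k`!%:R * m`!%:R / (m + k)`!%:R * hsym c k.
Proof.
move=> sc XX' SX' mX'.
pose L (x : m.+1.-tuple R) := \sum_(i < m.+1) c`_i * tnth x i.
have mL : measurable_fun setT L by exact: measurable_sum_tnth.
pose C := \sum_(i < m.+1) `|c`_i|.
have LC x : simplex x -> `|L x| <= C.
  move=> [x0 x1]; apply: le_trans (ler_norm_sum _ _ _) _.
  apply: ler_sum => i _; rewrite normrM ler_piMr// ger0_norm// -x1.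
  by rewrite (bigD1 i)//= lerDl sumr_ge0.
have LkC x : simplex x -> 0 <= L x ^+ k + C ^+ k.
  move=> /LC xC; have : `|L x ^+ k| <= C ^+ k.
    by rewrite normrX lerXn2r ?nnegrE// (le_trans _ xC).
  by rewrite ler_norml => /andP[+ _]; rewrite lerNl; lra.
(* A power of [L] can be negative, so the formula is applied to L ^ k + C ^ k and the constant is
   subtracted afterwards. The two cases of [a] are added rather than exclusive, which covers
   [k = 0]. *)
pose a j : R := (if j == k then k`!%:R else 0) + (if j == 0 then C ^+ k else 0).
have aE (g : nat -> R) : \sum_(j < k.+1) a j * g j = k`!%:R * g k + C ^+ k * g 0%N.
  rewrite /a; under eq_bigr do rewrite mulrDl.
  rewrite big_split/=; congr (_ + _).
    rewrite big_ord_recr/= eqxx big1 ?add0r// => i _.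
    by rewrite ifF ?mul0r//; apply/negP => /eqP E; have := ltn_ord i; rewrite E ltnn.
  by rewrite big_ord_recl/= big1 ?addr0// => i _; rewrite mul0r.
have aL x : dpow_poly a k.+1 (L x) = L x ^+ k + C ^+ k.
  rewrite /dpow_poly (aE (fun j => dpow j (L x))) dpow0 mulr1 /dpow.
  have k0 : k`!%:R != 0 :> R by rewrite pnatr_eq0 -lt0n fact_gt0.
  by field.
have iL : P.-integrable setT (fun w => (L (X' w) ^+ k)%:E).
  apply: (@bounded_RV_integrable _ _ _ _ (fun w => L (X' w) ^+ k) (C ^+ k)).
    by apply: measurable_funX; exact: measurableT_comp.
  by move=> w; rewrite normrX lerXn2r ?nnegrE ?LC// (le_trans _ (LC _ (SX' w))).
split=> //.
have := @uniform_simplex_formula c a k.+1 sc.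
under eq_integral do rewrite aL.
have LkC' x : simplex x -> 0 <= dpow_poly a k.+1 (L x) by rewrite aL; exact: LkC.
move=> /(_ LkC').
rewrite -(@ge0_integral_on_simplex X' (fun x => L x ^+ k + C ^+ k))//; last first.
  by apply: measurable_funD => //; exact: measurable_funX.
rewrite (aE (fun j => hsym c j / (m + j)`!%:R)).
under eq_integral do rewrite EFinD.
rewrite integralD//=; last first.
  exact: finite_measure_integrable_cst.
rewrite integral_cst_prob.
rewrite hsym0 addn0.
move/(congr1 fine); rewrite fineD//=; last exact: integrable_fin_num iL.
rewrite -/(Rintegral _ _ _) => /(canRL (addrK _)) ->.
have m0 : m`!%:R != 0 :> R by rewrite pnatr_eq0 -lt0n fact_gt0.
by field; rewrite m0 pnatr_eq0 -lt0n fact_gt0.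
Qed.

End uniform_simplex_moments.

(** * Moments of Gaussian variables *)

Section normal_density_moments.
Context {R : realType}.
Import HBNNSimple.
Local Notation leb := (@lebesgue_measure R).
Variables (m s : R).

Local Notation pdf := (normal_pdf m s).

Let mpdf : measurable_fun [set: R] (fun x => (pdf x)%:E).
Proof. by apply/measurable_EFinP; exact: measurable_normal_pdf. Qed.

(** By monotone convergence along simple functions; for an indicator the identity is the definition
    of [normal_prob] by its density. *)
Lemma ge0_integral_normal_prob (f : measurableTypeR R -> \bar R) :
  measurable_fun setT f ->
  (forall x, (0 <= f x)%E) ->
  (\int[normal_prob m s]_x f x = \int[leb]_x (f x * (pdf x)%:E))%E.
Proof.
move=> mf f0.
pose f_ := nnsfun_approx measurableT mf.
have f_cvg x : (EFin \o (fun n => f_ n x)) n @[n --> \oo] --> f x.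
  by apply: cvg_nnsfun_approx.
have f_nd x : {homo (fun n => f_ n x) : k n / (k <= n)%N >-> k <= n}.
  by move=> k n kn; exact/lefP/nd_nnsfun_approx.
apply: etrans (nd_ge0_integral_lim _ f0 f_nd f_cvg) _.
transitivity (limn (fun n => \int[leb]_x ((f_ n x)%:E * (pdf x)%:E))%E); last first.
  rewrite -monotone_convergence//.
  - by apply: eq_integral => x _; apply/cvg_lim => //; exact: cvgeZr (f_cvg x).
  - move=> n; apply: emeasurable_funM => //.
    exact/measurable_EFinP/measurable_funP.
  - by move=> n x _; rewrite -EFinM lee_fin mulr_ge0// normal_pdf_ge0.
  - move=> x _ k n kn; rewrite -!EFinM lee_fin ler_wpM2r ?normal_pdf_ge0//.
    exact: f_nd.
congr (limn _); apply/funext => n; rewrite /= sintegralE.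
transitivity (\int[leb]_x \sum_(r \in range (f_ n))
    (r%:E * (\1_(f_ n @^-1` [set r]) x)%:E * (pdf x)%:E))%E.
  rewrite ge0_integral_fsum//; first last.
  - move=> r x _; rewrite mule_ge0 ?lee_fin ?normal_pdf_ge0//.
    exact: nnfun_muleindic_ge0.
  - move=> r; apply: emeasurable_funM => //; apply: emeasurable_funM => //.
    exact/measurable_EFinP/measurable_indic.
  apply: eq_fsbigr => r /set_mem [x _ fxr].
  have r0 : 0 <= r by rewrite -fxr.
  under eq_integral do rewrite -muleA.
  rewrite ge0_integralZl_EFin//; first last.
  - apply: emeasurable_funM => //.
    exact/measurable_EFinP/measurable_indic.
  - by move=> y _; rewrite mule_ge0 ?lee_fin ?normal_pdf_ge0.
  congr (_ * _)%E.
  transitivity (\int[leb]_y ((fun y => (pdf y)%:E) \_ (f_ n @^-1` [set r])) y)%E.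
    exact: integral_mkcond.
  apply: eq_integral => y _; rewrite patchE indicE.
  by case: ifP => _; rewrite ?mul1e ?mul0e.
apply: eq_integral => x _; rewrite [in RHS]fimfunE -fsumEFin//.
rewrite ge0_mule_fsuml; first by apply: eq_fsbigr => r _; rewrite EFinM.
by move=> r; rewrite EFinM; exact: nnfun_muleindic_ge0.
Qed.

Hypothesis s0 : s != 0.

(** A polynomial factor is absorbed by doubling the standard deviation, which frees a factor exp (-
    c y ^ 2) to beat it. *)
Lemma normal_pdf_tail k : exists C : R,
  forall x, `|x - m| ^+ k * pdf x <= C * normal_pdf m (2 * s) x.
Proof.
have s20 : 2 * s != 0 by rewrite mulf_neq0.
have ss0 : 0 < s ^+ 2 by rewrite exprn_even_gt0.
(* [c] is 1 / (2 s ^ 2) - 1 / (2 (2 s) ^ 2). In [D], the 1 serves |y| <= 1, and k! / c ^ k serves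
   |y| > 1, where |y| ^ k <= y ^ (2 k) and u ^ k / k! <= exp u for u = c y ^ 2. *)
pose c := 3 / (8 * s ^+ 2).
have c0 : 0 < c by rewrite divr_gt0// mulr_gt0.
pose D : R := 1 + k`!%:R / c ^+ k.
have D0 : 0 <= D by rewrite addr_ge0// divr_ge0// exprn_ge0// ltW.
exists (D * normal_peak s / normal_peak (2 * s)) => x.
rewrite !normal_pdfE// -[X in _ <= X]mulrA mulKf ?gt_eqF ?normal_peak_gt0//.
rewrite -mulrA mulrCA [X in _ <= X]mulrCA ler_wpM2l ?normal_peak_ge0//.
set y := x - m.
have -> : normal_fun m s x = expR (- (c * y ^+ 2)) * normal_fun m (2 * s) x.
  rewrite /normal_fun -expRD -/y; congr expR; rewrite /c; field.
  by [].
rewrite mulrA ler_wpM2r ?normal_fun_ge0// expRN ler_pdivrMr ?expR_gt0//.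
have t0 : 0 <= c * y ^+ 2 by rewrite mulr_ge0 ?sqr_ge0// ltW.
have e1 : 1 <= expR (c * y ^+ 2) by rewrite -expR0 ler_expR.
have e2 : (c * y ^+ 2) ^+ k / k`!%:R <= expR (c * y ^+ 2).
  case: (k) => [|j]; first by rewrite expr0 fact0 divr1.
  by have := expR_ge1Dxn j t0; lra.
have e3 : (y ^+ 2) ^+ k <= k`!%:R / c ^+ k * expR (c * y ^+ 2).
  rewrite mulrAC ler_pdivlMr ?exprn_gt0// -exprMn (mulrC _ c) [leRHS]mulrC.
  by move: e2; rewrite ler_pdivrMr ?ltr0n ?fact_gt0.
have [y1|y1] := leP `|y| 1.
  rewrite /D mulrDl mul1r; apply: le_trans (_ : 1 <= _).
    by rewrite exprn_ile1.
  by rewrite -[leLHS]addr0 lerD// (le_trans _ e3)// exprn_ge0// sqr_ge0.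
rewrite /D mulrDl mul1r; apply: le_trans (_ : _ <= (y ^+ 2) ^+ k) _.
  rewrite -(real_normK (num_real y)) lerXn2r ?nnegrE//.
  by rewrite expr2 ler_peMr// ltW.
by rewrite -[leLHS]add0r lerD// (le_trans _ e1).
Qed.

Let ypow k x := (x - m) ^+ k * pdf x.

Let mypow k : measurable_fun [set: R] (ypow k).
Proof.
apply: measurable_funM; last exact: measurable_normal_pdf.
by apply: measurable_funX; exact: measurable_funB.
Qed.

Lemma integrable_normal_moment k :
  leb.-integrable setT (fun x => ((x - m) ^+ k * pdf x)%:E).
Proof.
have [C HC] := normal_pdf_tail k.
have iC := integrableZl measurableT C (integrable_normal_pdf m (2 * s)).
apply: (le_integrable measurableT _ _ iC).
  by apply/measurable_EFinP; exact: mypow.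
move=> x _; rewrite /= lee_fin normrM normrX (ger0_norm (normal_pdf_ge0 _ _ _)).
by apply: le_trans (HC x) _; rewrite ler_norm.
Qed.

Let is_derive_pdf (x : R) :
  is_derive x (1 : R) (pdf : R -> R) (- ((x - m) / s ^+ 2 * pdf x)).
Proof.
rewrite normal_pdfE// /normal_fun.
have hy : is_derive x (1 : R) (fun z : R => z - m) 1.
  have h := is_deriveD_fun (is_derive_id x (1 : R)) (is_derive_cst (- m) x (1 : R)).
  by apply: (is_derive_eq h); rewrite addr0.
have hq : is_derive x (1 : R) (fun z : R => - (z - m) ^+ 2 / (s ^+ 2 *+ 2))
    (- ((x - m) / s ^+ 2)).
  have h := is_deriveM_fun (is_deriveN_fun (is_deriveM_fun hy hy))
    (is_derive_cst (s ^+ 2 *+ 2)^-1 x (1 : R)).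
  by apply: (is_derive_eq h); rewrite /cst; field.
have h := is_deriveM_fun (is_derive_cst (normal_peak s) x (1 : R))
  (is_derive_comp_fun (is_derive_expR _) hq).
by apply: (is_derive_eq h); rewrite /cst; ring.
Qed.

(** The integral of [dg] over the interval of radius [n.+1] around [m] is a difference of two values
    of [g], each at most C / (n + 1) in absolute value; dominated convergence passes to the whole
    line. *)
Let integral_exact (g dg : R -> R) :
  (forall x : R, is_derive x (1 : R) g (dg x)) -> continuous dg ->
  leb.-integrable setT (EFin \o dg) ->
  (exists C, forall x, `|x - m| * `|g x| <= C) ->
  \int[leb]_x dg x = 0.
Proof.
move=> gdg cdg idg [C gC].
pose I n := `[m - n.+1%:R, m + n.+1%:R]%classic : set R.
pose f_ n := (EFin \o dg) \_ (I n).
have mdg := measurable_int _ idg.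
have mf_ n : measurable_fun setT (f_ n).
  apply/(measurable_restrictT _ _).1; first exact: measurable_itv.
  exact: measurable_funTS.
have f_cvg x : f_ n x @[n --> \oo] --> (dg x)%:E.
  apply: cvg_near_cst; near=> n.
  rewrite /f_ patchE ifT// inE /I/= in_itv/= -ler_distlC.
  apply: (@le_trans _ _ n%:R); last by rewrite ler_nat.
  by near: n; exact: nbhs_infty_ger.
have f_dom n x : (`|f_ n x| <= `|(dg x)%:E|)%E.
  by rewrite /f_ patchE; case: ifP => // _; rewrite abse0.
have ae1 : {ae leb, forall x, [set: R] x -> f_ n x @[n --> \oo] --> (dg x)%:E}.
  by apply: aeW => x _; exact: f_cvg.
have ae2 : {ae leb, forall x n, [set: R] x -> (`|f_ n x| <= `|(dg x)%:E|)%E}.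
  by apply: aeW => x n _; exact: f_dom.
have [_ _] := @dominated_convergence _ (measurableTypeR R) R leb setT measurableT f_
  (EFin \o dg) (abse \o (EFin \o dg)) mf_ mdg ae1 (integrable_abse idg) ae2.
have lim0 : (\int[leb]_x f_ n x)%E @[n --> \oo] --> (0 : \bar R)%E.
  have E n : (\int[leb]_x f_ n x = (g (m + n.+1%:R) - g (m - n.+1%:R))%:E)%E.
    by rewrite /f_ -integral_mkcond (integral_is_derive _ gdg)// lerD2l ge0_cp.
  under eq_cvg do rewrite E.
  apply: cvg_EFin; first by near=> n.
  apply/norm_cvg0P; apply: (@squeeze_cvgr _ _ _ _ (cst 0) (fun n => 2 * C * n.+1%:R^-1)).
  - near=> n; rewrite normr_ge0/=; apply: le_trans (ler_normB _ _) _.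
    have h1 := gC (m + n.+1%:R); have h2 := gC (m - n.+1%:R).
    have E1 : m + n.+1%:R - m = n.+1%:R by rewrite addrAC subrr add0r.
    have E2 : m - n.+1%:R - m = - n.+1%:R by rewrite addrAC subrr add0r.
    rewrite ler_pdivlMr//; move: h1 h2.
    rewrite E1 E2 normrN normr_nat mulrDl !(mulrC `|g _|); lra.
  - exact: cvg_cst.
  - rewrite -[X in _ --> X](mulr0 (2 * C)); apply: cvgM; first exact: cvg_cst.
    exact: cvg_harmonic.
move=> H.
have E : (\int[leb]_x (EFin \o dg) x = 0)%E by apply: (cvg_unique _ H lim0).
by rewrite /Rintegral E.
Unshelve. all: by end_near. Qed.

Let continuous_ypow k : continuous (ypow k).
Proof.
move=> x; apply: cvgM; last exact: continuous_normal_pdf.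
have c1 : (y - m) @[y --> x] --> x - m by apply: cvgB; [exact: cvg_id|exact: cvg_cst].
exact: (cvg_comp _ _ c1 (@exprn_continuous _ _ _)).
Qed.

Let ypow_bounded k : exists C, forall x, `|ypow k x| <= C.
Proof.
have [C HC] := normal_pdf_tail k.
exists (`|C| * normal_peak (2 * s)) => x.
rewrite normrM normrX (ger0_norm (normal_pdf_ge0 _ _ _)).
apply: le_trans (HC x) _; apply: le_trans (ler_norm _) _; rewrite normrM.
rewrite ler_wpM2l// ger0_norm ?normal_pdf_ge0// normal_pdf_ub//.
by rewrite mulf_neq0.
Qed.

Lemma normal_moment k :
  \int[leb]_x ((x - m) ^+ k * pdf x) = k`!%:R * gauss_coef (s ^+ 2) k.
Proof.
have dy (x : R) : is_derive x (1 : R) (fun z : R => z - m) 1.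
  have h := is_deriveD_fun (is_derive_id x (1 : R)) (is_derive_cst (- m) x (1 : R)).
  by apply: (is_derive_eq h); rewrite addr0.
have bd j : exists C, forall x, `|x - m| * `|- s ^+ 2 * ypow j x| <= C.
  have [C HC] := ypow_bounded j.+1; exists (s ^+ 2 * C) => x.
  have -> : `|x - m| * `|- s ^+ 2 * ypow j x| = s ^+ 2 * `|ypow j.+1 x|.
    have -> : `|ypow j.+1 x| = `|x - m| * `|ypow j x|.
      by rewrite -normrM /ypow exprS mulrA.
    by rewrite normrM normrN (ger0_norm (sqr_ge0 s)) mulrCA.
  by rewrite ler_wpM2l ?sqr_ge0.
elim/ltn_ind: k => k IH; case: k IH => [|[|k]] IH.
- under eq_Rintegral do rewrite expr0 mul1r.
  by rewrite /Rintegral integral_normal_pdf mulr1.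
- rewrite mulr0.
  apply: (@integral_exact (fun x => - s ^+ 2 * ypow 0 x) (ypow 1)); last exact: bd.
  + move=> x; have h := is_deriveM_fun (is_derive_cst (- s ^+ 2) x (1 : R)) (is_derive_pdf x).
    under eq_fun do rewrite /ypow expr0 mul1r.
    by apply: (is_derive_eq h); rewrite /cst /ypow expr1; field.
  + exact: continuous_ypow.
  + exact: integrable_normal_moment.
(* [dg] is the derivative of - s ^ 2 y ^ (k + 1) pdf with y = x - m, and its integral vanishes: the
   moments satisfy M_(k+2) = s ^ 2 (k + 1) M_k. *)
- pose dg x := ypow k.+2 x - (s ^+ 2 * k.+1%:R) * ypow k x.
  have i2 := integrable_normal_moment k.+2.
  have ik : leb.-integrable setT (fun x => (s ^+ 2 * k.+1%:R * ypow k x)%:E).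
    have := integrableZl measurableT (s ^+ 2 * k.+1%:R) (integrable_normal_moment k).
    by apply: eq_integrable => // x _; rewrite -EFinM.
  have idg : leb.-integrable setT (EFin \o dg).
    have := integrableB measurableT i2 ik.
    by apply: eq_integrable => // x _; rewrite -EFinB.
  have gdg (x : R) : is_derive x (1 : R) (fun x => - s ^+ 2 * ypow k.+1 x) (dg x).
    have h1 := is_deriveM_fun (@is_derive_comp_fun _ (fun z => z ^+ k.+1) (fun z => z - m)
      _ _ _ (is_derive_exprn k (x - m)) (dy x)) (is_derive_pdf x).
    have h := is_deriveM_fun (is_derive_cst (- s ^+ 2) x (1 : R)) h1.
    by apply: (is_derive_eq h); rewrite /cst /dg /ypow !exprS; field.
  have cdg : continuous dg.
    move=> x; apply: cvgB; first exact: continuous_ypow.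
    by apply: cvgM; [exact: cvg_cst|exact: continuous_ypow].
  have := integral_exact gdg cdg idg (bd k.+1).
  rewrite /dg RintegralB// RintegralZl//; last exact: integrable_normal_moment.
  have -> : \int[leb]_x ypow k x = k`!%:R * gauss_coef (s ^+ 2) k by exact: IH.
  move=> /subr0_eq ->.
  rewrite /= factS natrM natrM; field.
  by rewrite -natrD pnatr_eq0.
Qed.

End normal_density_moments.

(** * Gaussian random variables *)

Section gaussian_moments.
Context {R : realType} d (T : measurableType d) (P : probability T R).
Local Notation leb := (@lebesgue_measure R).

Lemma ge0_expectation_normal (X : T -> R) m s (f : measurableTypeR R -> \bar R) :
  measurable_fun setT X ->
  (forall A : set R, measurable A -> P (X @^-1` A) = normal_prob m s A) ->
  measurable_fun setT f -> (forall x, (0 <= f x)%E) ->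
  (\int[P]_w f (X w) = \int[leb]_x (f x * (normal_pdf m s x)%:E))%E.
Proof.
move=> mX PX mf f0.
rewrite -ge0_integral_normal_prob//.
have mX' : measurable_fun setT (X : T -> measurableTypeR R) by exact: mX.
pose X' : {mfun T >-> measurableTypeR R} :=
  HB.pack (X : T -> measurableTypeR R) (isMeasurableFun.Build _ _ _ _ _ mX').
transitivity (\int[pushforward P X']_x f x)%E.
  by rewrite ge0_integral_pushforward// => x _; exact: f0.
by apply: eq_measure_integral => A mA _; exact: PX.
Qed.

Lemma expectation_normal (X : T -> R) m s (f : R -> R) :
  measurable_fun setT X ->
  (forall A : set R, measurable A -> P (X @^-1` A) = normal_prob m s A) ->
  measurable_fun setT f ->
  leb.-integrable setT (fun x => (f x * normal_pdf m s x)%:E) ->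
  P.-integrable setT (fun w => (f (X w))%:E) /\
  \int[P]_w f (X w) = \int[leb]_x (f x * normal_pdf m s x).
Proof.
move=> mX PX mf fpdf.
have mfE : measurable_fun [set: measurableTypeR R] (EFin \o f).
  exact/measurable_EFinP.
have pdf0 x : (0 <= (normal_pdf m s x)%:E)%E by rewrite lee_fin normal_pdf_ge0.
split.
  apply/integrableP; split; first by apply/measurable_EFinP; exact: measurableT_comp.
  rewrite (ge0_expectation_normal (f := abse \o (EFin \o f)) mX PX);
    [|exact: measurableT_comp mfE|by move=> x; exact: abse_ge0].
  have /integrableP[_] := fpdf; apply: le_lt_trans.
  rewrite le_eqVlt; apply/orP; left; apply/eqP; apply: eq_integral => x _.
  by rewrite /= -EFinM normrM (ger0_norm (normal_pdf_ge0 _ _ _)).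
congr fine; rewrite integralE [in RHS]integralE; congr (_ - _)%E.
- transitivity (\int[P]_w (EFin \o f)^\+%E (X w))%E.
    by apply: eq_integral => w _; rewrite !funeposE.
  rewrite (ge0_expectation_normal (f := (EFin \o f)^\+%E) mX PX);
    [|exact: measurable_funepos|exact: funepos_ge0].
  apply: eq_integral => x _; rewrite !funeposE/= -!EFin_max -EFinM.
  by rewrite maxr_pMl ?normal_pdf_ge0// mul0r.
- transitivity (\int[P]_w (EFin \o f)^\-%E (X w))%E.
    by apply: eq_integral => w _; rewrite !funenegE.
  rewrite (ge0_expectation_normal (f := (EFin \o f)^\-%E) mX PX);
    [|exact: measurable_funeneg|exact: funeneg_ge0].
  apply: eq_integral => x _; rewrite !funenegE/= -!EFin_max -EFinM.
  by rewrite maxr_pMl ?normal_pdf_ge0// mul0r mulNr.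
Qed.

Lemma expectation_dirac (X : T -> R) m (f : R -> R) :
  measurable_fun setT X ->
  (forall A : set R, measurable A -> P (X @^-1` A) = \d_m A) ->
  measurable_fun setT f ->
  P.-integrable setT (fun w => (f (X w))%:E) /\ \int[P]_w f (X w) = f m.
Proof.
move=> mX PX mf.
pose N := X @^-1` [set~ m].
have mN : measurable N.
  by have := mX measurableT _ (measurableC (measurable_set1 m)); rewrite setTI.
have N0 : P N = 0%E.
  rewrite (PX _ (measurableC (measurable_set1 m))) diracE memNset//.
  by move=> /(_ erefl).
have mfX : measurable_fun setT (fun w => (f (X w))%:E).
  by apply/measurable_EFinP; exact: measurableT_comp.
have ifm : P.-integrable (setT `\` N) (fun w => (f m)%:E).
  apply: (integrableS measurableT) => //; first exact: measurableD.
  exact: (@bounded_RV_integrable _ _ _ _ (cst (f m)) `|f m|).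
have fE : {in setT `\` N, (fun w => (f m)%:E) =1 (fun w => (f (X w))%:E)}.
  by move=> w /set_mem[_ /contrapT ->].
have ifX : P.-integrable setT (fun w => (f (X w))%:E).
  apply/(negligible_integrable mN) => //.
  by apply: eq_integrable ifm => //; exact: measurableD.
split => //; rewrite /Rintegral (negligible_integral mN)//.
rewrite -(eq_integral _ _ fE) -(negligible_integral mN)//.
  by rewrite integral_cst_prob.
exact: (@bounded_RV_integrable _ _ _ _ (cst (f m)) `|f m|).
Qed.

Lemma gauss_coef0S k : gauss_coef (0 : R) k.+1 = 0.
Proof. by case: k => [|k] //=; rewrite !mul0r. Qed.

Lemma gaussian_moments (X : T -> R) : gaussian P X -> measurable_fun setT X ->
  (\int[P]_w (X w)%:E = 0)%E ->
  exists2 v, 0 <= v & forall k, P.-integrable setT (fun w => (X w ^+ k)%:E) /\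
    \int[P]_w (X w ^+ k) = k`!%:R * gauss_coef v k.
Proof.
move=> [m [s PX]] mX EX.
exists (s ^+ 2); first exact: sqr_ge0.
have mXm k : measurable_fun [set: R] (fun x => (x - m) ^+ k).
  by apply: measurable_funX; exact: measurable_funB.
have H k : P.-integrable setT (fun w => ((X w - m) ^+ k)%:E) /\
    \int[P]_w ((X w - m) ^+ k) = k`!%:R * gauss_coef (s ^+ 2) k.
  have [s0|s0] := eqVneq s 0.
    move: PX; rewrite s0 eqxx => PX.
    have [i1 ->] := expectation_dirac mX PX (mXm k); split => //.
    rewrite subrr !expr0n/=.
    by case: k {i1} => [|k]; rewrite ?gauss_coef0S ?mulr0// fact0 mulr1.
  move: PX; rewrite (negbTE s0) => PX.
  have := expectation_normal mX PX (mXm k) (integrable_normal_moment m s0 k).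
  by rewrite normal_moment.
(* The first central moment vanishes in both the degenerate and the normal case, so [m] is the mean
   of [X]. *)
have m0 : m = 0.
  have [i1] := H 1%N; rewrite /= mulr0.
  rewrite (_ : \int[P]_w _ = - m); first by move=> /eqP; rewrite oppr_eq0 => /eqP.
  have im : P.-integrable setT (fun w => m%:E).
    exact: (@bounded_RV_integrable _ _ _ _ (cst m) `|m|).
  have iX : P.-integrable setT (fun w => (X w)%:E).
    have := integrableD measurableT i1 im.
    by apply: eq_integrable => // w _; rewrite /= -EFinD expr1 subrK.
  under eq_Rintegral do rewrite expr1.
  by rewrite RintegralB// /Rintegral EX integral_cst_prob sub0r.
move=> k; have [ik <-] := H k; split.
  by apply: eq_integrable ik => // w _; rewrite m0 subr0.
by apply: eq_Rintegral => w _; rewrite m0 subr0.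
Qed.

End gaussian_moments.

(** * Trigonometric approximation and convergence of moments *)

Section cos_taylor.
Context {R : realType}.
Implicit Types (b x : R) (j n : nat).

Fixpoint dcos j b : R :=
  match j with
  | 0 => cos b
  | 1 => - sin b
  | j'.+2 => - dcos j' b
  end.

Lemma is_derive_dcos j b x :
  is_derive x (1 : R) (fun y : R => dcos j (y + b)) (dcos j.+1 (x + b)).
Proof.
have dxb : is_derive x (1 : R) (fun y : R => y + b) 1.
  have h := is_deriveD_fun (is_derive_id x (1 : R)) (is_derive_cst b x (1 : R)).
  by apply: (is_derive_eq h); rewrite addr0.
elim/ltn_ind: j => -[|[|j]] IH /=.
- have h := @is_derive_comp_fun _ cos (fun y => y + b) _ _ _ (is_derive_cos (x + b)) dxb.
  by apply: (is_derive_eq h); rewrite mulr1.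
- have h := is_deriveN_fun (@is_derive_comp_fun _ sin (fun y => y + b) _ _ _
    (is_derive_sin (x + b)) dxb).
  by apply: (is_derive_eq h); rewrite mulr1.
- exact/is_deriveN_fun/IH.
Qed.

Lemma dcos_le1 j b : `|dcos j b| <= 1.
Proof.
elim/ltn_ind: j => -[|[|j]] IH /=; rewrite ?normrN.
- by rewrite ler_norml cos_geN1 cos_le1.
- by rewrite ler_norml sin_geN1 sin_le1.
- exact: IH.
Qed.

(** On the positive half-line, [dpow n.+1] plus or minus the function vanishes at 0 and has a
    non-negative derivative, so the mean value theorem applies; the negative half-line follows by
    reflection. *)
Lemma dpow_norm_bound n (f df : R -> R) x :
  (forall y : R, is_derive y (1 : R) f (df y)) -> f 0 = 0 ->
  (forall y, `|df y| <= dpow n `|y|) -> `|f x| <= dpow n.+1 `|x|.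
Proof.
have pos (g dg : R -> R) (y : R) : (forall y : R, is_derive y (1 : R) g (dg y)) -> g 0 = 0 ->
    (forall y, `|dg y| <= dpow n `|y|) -> 0 <= y -> `|g y| <= dpow n.+1 y.
  move=> gdg g0 dgn y0.
  have sgn (e : R) : `|e| = 1 -> e * g y <= dpow n.+1 y.
    move=> e1.
    have dh (z : R) : is_derive z (1 : R) (fun z => dpow n.+1 z + - (e * g z))
        (dpow n z - e * dg z).
      have h := is_deriveD_fun (is_derive_dpow n z)
        (is_deriveN_fun (is_deriveM_fun (is_derive_cst e z (1 : R)) (gdg z))).
      by apply: (is_derive_eq h); rewrite /cst mul0r add0r.
    have [c /andP[c0 cy]] := MVT_segment y0 (fun z _ => dh z)
      (continuous_subspaceT (fun z => is_derive_continuous (dh z))).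
    rewrite dpowS0 g0 mulr0 oppr0 addr0 !subr0 => E.
    have c0' : 0 <= c by move: c0; rewrite bnd_simp.
    rewrite -subr_ge0 E addr0; apply: mulr_ge0 => //.
    rewrite subr_ge0 (le_trans (ler_norm _))// normrM e1 mul1r.
    by rewrite (le_trans (dgn c))// ger0_norm.
  rewrite ler_norml; apply/andP; split.
    by rewrite lerNl -mulN1r sgn// normrN1.
  by rewrite -[leLHS]mul1r sgn// normr1.
move=> fdf f0 dfn; have [x0|x0] := leP 0 x; first by rewrite (ger0_norm x0); exact: (pos f df).
rewrite (ltr0_norm x0) -[x in `|f x|]opprK.
apply: (pos (fun y => f (- y)) (fun y => - df (- y))); rewrite ?oppr0 ?oppr_ge0 ?ltW//.
  move=> y; have h := @is_derive_comp_fun _ f (fun y => - y) _ _ _ (fdf (- y))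
    (is_deriveN_fun (is_derive_id y (1 : R))).
  by apply: (is_derive_eq h); rewrite mulrN1.
by move=> y; rewrite normrN (le_trans (dfn _))// normrN.
Qed.

(** Differentiating the remainder of order [n.+1] for [dcos j] gives the remainder of order [n] for
    [dcos j.+1]; hence an induction over all derivatives at once. *)
Lemma dcos_taylor n j b x :
  `|dcos j (x + b) - \sum_(i < n) dpow i x * dcos (j + i) b| <= dpow n `|x|.
Proof.
elim: n j x => [|n IH] j x; first by rewrite big_ord0 subr0 dpow0 dcos_le1.
apply: (@dpow_norm_bound _
  (fun x => dcos j (x + b) - \sum_(i < n.+1) dpow i x * dcos (j + i) b)
  (fun x => dcos j.+1 (x + b) - \sum_(i < n) dpow i x * dcos (j.+1 + i) b)) => [y||y].
- apply: is_deriveD_fun; first exact: is_derive_dcos.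
  apply: is_deriveN_fun.
  under eq_fun do rewrite big_ord_recl dpow0 mul1r.
  have h := is_deriveD_fun (is_derive_cst (dcos (j + 0) b) y (1 : R))
    (@is_derive_sum_fun _ _ (index_enum 'I_n)
    (fun i y => dpow (lift ord0 i) y * dcos (j + lift ord0 i) b)
    (fun i y => dpow i y * dcos (j.+1 + i) b) y _).
  apply: (is_derive_eq (h _)); last by rewrite add0r.
  move=> i; have h' := is_deriveM_fun (is_derive_dpow i y)
    (is_derive_cst (dcos (j + i.+1) b) y (1 : R)).
  by apply: (is_derive_eq h'); rewrite /cst mulr0 addr0 addSnnS.
- rewrite add0r big_ord_recl dpow0 mul1r addn0 big1 ?addr0 ?subrr// => i _.
  by rewrite dpowS0 mul0r.
- exact: IH.
Qed.

Lemma sin_sub_id x : `|sin x - x| <= x ^+ 2.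
Proof.
(* [dcos 3] is the sine. *)
have := dcos_taylor 2 3 0 x; rewrite !big_ord_recr big_ord0/=.
rewrite !addr0 sin0 cos0 dpow0 !opprK mulr0 !add0r mulr1.
rewrite {1}/dpow expr1 divr1 => /le_trans; apply.
rewrite /dpow real_normK ?num_real// ler_pdivrMr ?ltr0n ?fact_gt0// ler_peMr ?sqr_ge0//.
by rewrite ler1n fact_gt0.
Qed.

End cos_taylor.

(** * Approximation of Lipschitz functions by trigonometric sums *)

Section trigonometric_approximation.
Context {R : realType} (N : nat).
Implicit Types (v : 'I_N -> R) (s : R) (k : 'I_N -> nat).

Definition trigonometric (f : ('I_N -> R) -> R) : Prop :=
  exists r : seq (R * ('I_N -> R) * R), forall v,
    f v = \sum_(t <- r) t.1.1 * cos (\sum_i t.1.2 i * v i + t.2).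

Lemma trigonometric_cst a : trigonometric (fun=> a).
Proof.
exists [:: (a, fun=> 0, 0)] => v; rewrite big_seq1/= big1 ?addr0 ?cos0 ?mulr1//.
by move=> i _; rewrite mul0r.
Qed.

Lemma trigonometricD f g :
  trigonometric f -> trigonometric g -> trigonometric (fun v => f v + g v).
Proof.
by move=> [r fr] [q gq]; exists (r ++ q) => v; rewrite big_cat fr gq.
Qed.

Lemma trigonometricM f g :
  trigonometric f -> trigonometric g -> trigonometric (fun v => f v * g v).
Proof.
move=> [r fr] [q gq].
(* Product to sum: 2 cos A cos B = cos (A + B) + cos (A - B), the sign being [e]. *)
pose pr (e : R) (t u : R * ('I_N -> R) * R) : R * ('I_N -> R) * R :=
  (t.1.1 * u.1.1 / 2, fun i => t.1.2 i + e * u.1.2 i, t.2 + e * u.2).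
exists ([seq pr 1 t u | t <- r, u <- q] ++ [seq pr (-1) t u | t <- r, u <- q]) => v.
rewrite big_cat/= !big_allpairs_dep -big_split/= fr mulr_suml; apply: eq_bigr => t _.
rewrite gq mulr_sumr -big_split/=; apply: eq_bigr => u _.
set A := \sum_i t.1.2 i * v i + t.2; set B := \sum_i u.1.2 i * v i + u.2.
have E e : \sum_i (t.1.2 i + e * u.1.2 i) * v i + (t.2 + e * u.2) = A + e * B.
  rewrite /A /B mulrDr mulr_sumr addrACA -big_split/=; congr (_ + _).
  by apply: eq_bigr => i _; rewrite mulrDl mulrA.
rewrite (E 1) (E (-1)); clearbody A B.
by rewrite mul1r mulN1r cosD cosB; field.
Qed.

(** A trigonometric function with values in [0, 1], hence usable as a probability, and close to (1 +
    v i / s) / 2 when [v i] is small against [s], so that [v i] can be recovered from it. *)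
Definition sin_weight s v i : R := (1 + sin (v i / s)) / 2.

Lemma sin_weight_bounds s v i : 0 <= sin_weight s v i <= 1.
Proof.
have := sin_le1 (v i / s); have := sin_geN1 (v i / s); rewrite /sin_weight.
by move=> h1 h2; apply/andP; split; lra.
Qed.

Lemma trigonometric_sin_weight s i : trigonometric (fun v => sin_weight s v i).
Proof.
exists [:: (2^-1, fun=> 0, 0); (2^-1, fun j => (j == i)%:R / s, - (pi / 2))] => v.
rewrite !big_cons big_nil/= addr0 big1 => [|j _]; last by rewrite mul0r.
rewrite addr0 cos0 (bigD1 i)//= eqxx big1 => [|j /negbTE ->]; last by rewrite !mul0r.
rewrite addr0 cosB cos_pihalf sin_pihalf mulr0 add0r mulr1 /sin_weight.
by rewrite mul1r mulrC [s^-1 * _]mulrC; field.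
Qed.

(* Expectation of [g] at the position reached from [k] when the steps in [l] are
   taken independently, a step along [i] being taken with probability
   [sin_weight s v i]: a multivariate Bernstein operator. *)
Fixpoint bernstein s (g : ('I_N -> nat) -> R) (l : seq 'I_N) k v : R :=
  match l with
  | [::] => g k
  | i :: l' => sin_weight s v i * bernstein s g l' (fun j => (k j + (j == i))%N) v +
               (1 - sin_weight s v i) * bernstein s g l' k v
  end.

Lemma trigonometric_bernstein s g l k : trigonometric (bernstein s g l k).
Proof.
elim: l k => [|i l IH] k /=; first exact: trigonometric_cst.
apply: trigonometricD; apply: trigonometricM => //.
  exact: trigonometric_sin_weight.
apply: trigonometricD; first exact: trigonometric_cst.
have := trigonometricM (trigonometric_cst (-1)) (trigonometric_sin_weight s i).
by under eq_fun do rewrite mulN1r.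
Qed.

(** [bernstein] averages [g] with non-negative weights of sum 1. *)
Lemma bernstein_dist s g (h : ('I_N -> nat) -> R) (a : R) l k v : (forall k, `|g k - a| <= h k) ->
  `|bernstein s g l k v - a| <= bernstein s h l k v.
Proof.
move=> gh; elim: l k => [|i l IH] k //=.
have /andP[z0 z1] := sin_weight_bounds s v i; move: z0 z1.
set z := sin_weight s v i => z0 z1; clearbody z.
set x := bernstein _ _ _ _ _; set y := bernstein _ _ _ _ _.
have -> : z * x + (1 - z) * y - a = z * (x - a) + (1 - z) * (y - a) by ring.
apply: le_trans (ler_normD _ _) _; rewrite (normrM z) (normrM (1 - z)).
rewrite (ger0_norm z0) (@ger0_norm _ (1 - z)) ?subr_ge0//.
by apply: lerD; apply: ler_wpM2l; rewrite ?subr_ge0//; exact: IH.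
Qed.

Lemma bernstein_affine s (a : R) (b : 'I_N -> R) (h : 'I_N -> ('I_N -> nat) -> R) l k v :
  bernstein s (fun k => a + \sum_i b i * h i k) l k v =
  a + \sum_i b i * bernstein s (h i) l k v.
Proof.
elim: l k => [|i l IH] k //=; rewrite !IH.
rewrite !mulrDr addrACA -mulrDl subrKC mul1r; congr (_ + _).
rewrite !mulr_sumr -big_split/=; apply: eq_bigr => j _.
by ring.
Qed.

(** Second moment about [y] of the position after a binomial number of steps along [i]: variance
    plus squared bias. *)
Lemma bernstein_sqr s i (y : R) l k v :
  bernstein s (fun k => ((k i)%:R - y) ^+ 2) l k v =
  (count_mem i l)%:R * (sin_weight s v i * (1 - sin_weight s v i)) +
  ((k i)%:R + (count_mem i l)%:R * sin_weight s v i - y) ^+ 2.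
Proof.
elim: l k => [|j l IH] k /=; first by rewrite !mul0r add0r addr0.
rewrite !IH; have [->|ij] := eqVneq j i.
  change (nat_of_bool true) with 1%N.
  by rewrite !natrD; ring.
change (nat_of_bool false) with 0%N.
by rewrite addn0 add0n; ring.
Qed.

(** [G] is sampled at v = s (2 z - 1), the inverse of the linearization of [sin_weight]. The bias is
    s |sin (v / s) - v / s| <= v ^ 2 / s. This covers even |v| > s, where the periodic weights are
    far from linear, and is why the error grows quadratically. *)
Lemma trigonometric_approximation (G : ('I_N -> R) -> R) (K : R) n : 0 <= K ->
  (forall v u, `|G v - G u| <= K * \sum_i `|v i - u i|) ->
  exists2 f, trigonometric f &
    forall v, `|f v - G v| <= K / n.+1%:R * \sum_i (v i ^+ 2 + 2).
Proof.
move=> K0 GK.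
pose s : R := n.+1%:R.
have s0 : 0 < s by rewrite ltr0n.
(* With [M] steps per direction the sampled point fluctuates by about s / sqrt M; M = s ^ 4 brings
   this down to 1 / s, the order of the bias. *)
pose M := (n.+1 ^ 4)%N.
have ME : M%:R = s ^+ 4 :> R by rewrite /M natrX.
pose l := flatten (nseq M (enum 'I_N)).
have lM i : count_mem i l = M.
  rewrite count_flatten map_nseq sumn_nseq count_uniq_mem ?enum_uniq//.
  by rewrite mem_enum mul1n.
pose g k : R := G (fun i => s * (2 * (k i)%:R / M%:R - 1)).
exists (bernstein s g l (fun=> 0%N)); first exact: trigonometric_bernstein.
move=> v.
pose z := sin_weight s v.
pose h i k : R := ((k i)%:R - M%:R * z i) ^+ 2.
have coord i k :
    `|s * (2 * (k i)%:R / M%:R - 1) - v i| <= v i ^+ 2 / s + 1 / s + h i k / s ^+ 5.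
  have s0' : s != 0 by rewrite gt_eqF.
  have -> : s * (2 * (k i)%:R / M%:R - 1) - v i =
      s * (sin (v i / s) - v i / s) + 2 / s ^+ 3 * ((k i)%:R - M%:R * z i).
    by rewrite ME /z /sin_weight; field.
  rewrite -addrA; apply: le_trans (ler_normD _ _) _; apply: lerD.
    rewrite normrM gtr0_norm//.
    apply: le_trans (ler_wpM2l (ltW s0) (sin_sub_id _)) _.
    by rewrite le_eqVlt; apply/orP; left; apply/eqP; field.
  rewrite /h normrM ger0_norm; last by rewrite divr_ge0// exprn_ge0// ltW.
  set t := (k i)%:R - _; rewrite -[t ^+ 2]real_normK ?num_real//.
  (* The fluctuation is linear in |t|, but [bernstein_sqr] averages its square; completing a square
     gives 2 |t| / s ^ 3 <= 1 / s + t ^ 2 / s ^ 5. *)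
  rewrite -subr_ge0.
  have -> : 1 / s + `|t| ^+ 2 / s ^+ 5 - 2 / s ^+ 3 * `|t| =
      (s ^+ 2 - `|t|) ^+ 2 / s ^+ 5 by field.
  by rewrite divr_ge0 ?sqr_ge0// exprn_ge0// ltW.
have gh k : `|g k - G v| <=
    K * \sum_i (v i ^+ 2 / s + 1 / s) + \sum_i K / s ^+ 5 * h i k.
  apply: le_trans (GK _ _) _.
  rewrite [X in _ <= X](_ : _ = K * \sum_i (v i ^+ 2 / s + 1 / s + h i k / s ^+ 5)).
    rewrite ler_wpM2l//; apply: ler_sum => i _; exact: coord.
  rewrite [in RHS]big_split/= mulrDr; congr (_ + _).
  by rewrite mulr_sumr; apply: eq_bigr => i _; rewrite -mulrA [_^-1 * _]mulrC.
apply: le_trans (@bernstein_dist s _ (fun k => K * \sum_i (v i ^+ 2 / s + 1 / s)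
  + \sum_i K / s ^+ 5 * h i k) _ _ _ _ gh) _.
rewrite bernstein_affine.
(* Of the constant 2 in [v i ^+ 2 + 2], one unit comes from the completed square, and the other
   bounds the average of [h i / s ^+ 5]. *)
have -> : K / n.+1%:R * \sum_i (v i ^+ 2 + 2) =
    K * \sum_i (v i ^+ 2 / s + 1 / s) + K * \sum_(i < N) 1 / s.
  rewrite -mulrDr -big_split/= -mulrA mulr_sumr; congr (_ * _).
  by apply: eq_bigr => i _; rewrite -/s; field; rewrite gt_eqF.
rewrite lerD2l mulr_sumr; apply: ler_sum => i _.
rewrite bernstein_sqr lM -/(z i) add0r subrr expr0n/= addr0 ME.
have -> : K / s ^+ 5 * (s ^+ 4 * (z i * (1 - z i))) =
    K * (1 / s) * (z i * (1 - z i)) by field; rewrite gt_eqF.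
have /andP[z0 z1] := sin_weight_bounds s v i.
rewrite ler_piMr ?mulr_ge0 ?divr_ge0 ?invr_ge0 ?(ltW s0)//.
by move: z0 z1; rewrite -/(z i); nra.
Qed.

End trigonometric_approximation.

Definition linear_form (R : realType) N (a v : 'I_N -> R) : R := \sum_(i < N) a i * v i.

Lemma near_div_le (R : realType) (c e : R) : 0 < e ->
  \forall n \near \oo, c / n.+1%:R <= e.
Proof.
move=> e0.
have h : c * n.+1%:R^-1 @[n --> \oo] --> (0 : R).
  rewrite -[X in _ --> X](mulr0 c); apply: cvgM; first exact: cvg_cst.
  exact: cvg_harmonic.
near=> n; apply: le_trans (ler_norm _) _.
by near: n; exact: cvgr0_norm_le h _ e0.
Unshelve. all: by end_near. Qed.

Lemma integrable_sum_EFin (R : realType) d (S : measurableType d) (Q : probability S R)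
    (I : Type) (r : seq I) (f : I -> S -> R) :
  (forall i, Q.-integrable setT (fun w => (f i w)%:E)) ->
  Q.-integrable setT (fun w => (\sum_(i <- r) f i w)%:E).
Proof.
move=> fi; under eq_fun do rewrite -sumEFin.
by apply: integrable_sum => // i _; exact: fi.
Qed.

Lemma Rintegral_sum (R : realType) d (S : measurableType d) (Q : probability S R)
    (I : Type) (r : seq I) (f : I -> S -> R) :
  (forall i, Q.-integrable setT (fun w => (f i w)%:E)) ->
  \int[Q]_w (\sum_(i <- r) f i w) = \sum_(i <- r) \int[Q]_w f i w.
Proof.
move=> fi; rewrite {1}/Rintegral; under eq_integral do rewrite -sumEFin.
rewrite (integral_sum measurableT fi) -sum_fine// => i _.
exact: integrable_fin_num (fi i).
Qed.

Section expectation_cos.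
Context {R : realType} d (S : measurableType d) (Q : probability S R) (U : S -> R).
Hypothesis UI : forall k, Q.-integrable setT (fun w => (U w ^+ k)%:E).

Lemma integral_moment_sum (c : nat -> R) m :
  Q.-integrable setT (fun w => (\sum_(i < m) c i * U w ^+ i)%:E) /\
  \int[Q]_w (\sum_(i < m) c i * U w ^+ i) = \sum_(i < m) c i * \int[Q]_w (U w ^+ i).
Proof.
elim: m => [|m [IH1 IH2]].
  under eq_fun do rewrite big_ord0; split; first exact: integrable0.
  by under eq_Rintegral do rewrite big_ord0; rewrite big_ord0 Rintegral_cst// mul0r.
have icU : Q.-integrable setT (fun w => (c m * U w ^+ m)%:E).
  by have := integrableZl measurableT (c m) (UI m).
split.
  under eq_fun do rewrite big_ord_recr/= EFinD.
  exact: integrableD.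
under eq_Rintegral do rewrite big_ord_recr/=.
apply: etrans (RintegralD measurableT IH1 icU) _.
rewrite IH2 big_ord_recr/=; congr (_ + _).
exact: RintegralZl measurableT (UI m).
Qed.

(** An even number of terms makes the remainder |U| ^ (2 m) a moment of [U], without absolute
    value. *)
Lemma expectation_cos_taylor b m :
  Q.-integrable setT (fun w => (cos (U w + b))%:E) /\
  `| \int[Q]_w cos (U w + b) -
     \sum_(i < m.*2) dcos i b / i`!%:R * \int[Q]_w (U w ^+ i)| <=
  (m.*2)`!%:R^-1 * \int[Q]_w (U w ^+ m.*2).
Proof.
have mU : measurable_fun setT U.
  by have /measurable_int/measurable_EFinP := UI 1%N; under eq_fun do rewrite expr1.
have ci : Q.-integrable setT (fun w => (cos (U w + b))%:E).
  apply: (@bounded_RV_integrable _ _ _ _ (fun w => cos (U w + b)) 1).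
    apply: measurableT_comp; last exact: measurable_funD.
    by apply: continuous_measurable_fun; exact: continuous_cos.
  by move=> w; rewrite ler_norml cos_geN1 cos_le1.
have [pi pE] := integral_moment_sum (fun i => dcos i b / i`!%:R) m.*2.
split => //; rewrite -pE -RintegralB// -RintegralZl//; last exact: UI.
have di : Q.-integrable setT (EFin \o (fun w => cos (U w + b) -
    \sum_(i < m.*2) dcos i b / i`!%:R * U w ^+ i)).
  by have := integrableB measurableT ci pi.
apply: le_trans (le_normr_Rintegral _ di) _ => //.
apply: le_Rintegral => //.
- exact: integrable_norm.
- by have := integrableZl measurableT ((m.*2)`!%:R^-1) (UI m.*2).
- move=> w _; have := dcos_taylor m.*2 0 b (U w).
  rewrite /= (eq_bigr (fun i : 'I_ m.*2 => dcos i b / i`!%:R * U w ^+ i)); last first.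
    by move=> i _; rewrite /dpow; ring.
  move=> /le_trans; apply; rewrite /dpow mulrC ler_wpM2l ?invr_ge0//.
  by rewrite -normrX ger0_norm// -mul2n exprM exprn_ge0// sqr_ge0.
Qed.

End expectation_cos.

Section trigonometric_random_variable.
Context {R : realType} (N : nat) d (S : measurableType d) (Q : probability S R) (U : S -> 'I_N -> R).
Hypothesis mU : forall a, measurable_fun setT (fun w => linear_form a (U w)).

Lemma integrable_cos_linear_form a b :
  Q.-integrable setT (fun w => (cos (linear_form a (U w) + b))%:E).
Proof.
apply: (@bounded_RV_integrable _ _ _ _ (fun w => cos (linear_form a (U w) + b)) 1).
  apply: measurableT_comp; last exact: measurable_funD.
  by apply: continuous_measurable_fun; exact: continuous_cos.
by move=> w; rewrite ler_norml cos_geN1 cos_le1.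
Qed.

Lemma integral_trigonometric_sum (r : seq (R * ('I_N -> R) * R)) :
  Q.-integrable setT
    (fun w => (\sum_(t <- r) t.1.1 * cos (linear_form t.1.2 (U w) + t.2))%:E) /\
  \int[Q]_w (\sum_(t <- r) t.1.1 * cos (linear_form t.1.2 (U w) + t.2)) =
  \sum_(t <- r) t.1.1 * \int[Q]_w cos (linear_form t.1.2 (U w) + t.2).
Proof.
elim: r => [|t r [IH1 IH2]].
  under eq_fun do rewrite big_nil; split; first exact: integrable0.
  by under eq_Rintegral do rewrite big_nil; rewrite big_nil Rintegral_cst// mul0r.
have it : Q.-integrable setT
    (fun w => (t.1.1 * cos (linear_form t.1.2 (U w) + t.2))%:E).
  by have := integrableZl measurableT t.1.1 (integrable_cos_linear_form t.1.2 t.2).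
split.
  under eq_fun do rewrite big_cons EFinD.
  exact: integrableD.
under eq_Rintegral do rewrite big_cons.
apply: etrans (RintegralD measurableT it IH1) _.
rewrite IH2 big_cons; congr (_ + _).
exact: RintegralZl measurableT (integrable_cos_linear_form t.1.2 t.2).
Qed.

Lemma integrable_trigonometric f : trigonometric f ->
  Q.-integrable setT (fun w => (f (U w))%:E).
Proof.
move=> [r fr]; have [ir _] := integral_trigonometric_sum r.
by under eq_fun do rewrite fr.
Qed.

Variables (G : ('I_N -> R) -> R) (K : R).
Hypothesis K0 : 0 <= K.
Hypothesis GK : forall v u, `|G v - G u| <= K * \sum_i `|v i - u i|.

(** Only linear forms of [U] are known to be measurable; [G] composed with [U] is a pointwise limit
    of trigonometric sums in them. *)
Lemma measurable_lipschitz_comp : measurable_fun setT (fun w => G (U w)).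
Proof.
have /choice[f fP] : forall n : nat, exists f, trigonometric f /\
    forall v, `|f v - G v| <= K / n.+1%:R * \sum_i (v i ^+ 2 + 2).
  by move=> n; have [f ? ?] := trigonometric_approximation n K0 GK; exists f.
apply: (@measurable_fun_cvg _ _ _ _ (fun n w => f n (U w))) => [n|w _].
  exact/measurable_EFinP/(measurable_int Q)/integrable_trigonometric/(fP n).1.
apply/cvgrPdist_le => e e0; near=> n.
rewrite distrC; apply: le_trans ((fP n).2 (U w)) _.
rewrite mulrAC.
by near: n; exact: near_div_le.
Unshelve. all: by end_near. Qed.

Hypothesis U2 : forall i, Q.-integrable setT (fun w => (U w i ^+ 2)%:E).

Let integral_bound c : Q.-integrable setT (fun w => (c * \sum_i (U w i ^+ 2 + 2))%:E) /\
  \int[Q]_w (c * \sum_i (U w i ^+ 2 + 2)) = c * \sum_i (\int[Q]_w (U w i ^+ 2) + 2).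
Proof.
have i2 i : Q.-integrable setT (fun w => (U w i ^+ 2 + 2)%:E).
  under eq_fun do rewrite EFinD.
  apply: integrableD => //.
  by apply: (@bounded_RV_integrable _ _ _ _ (cst 2) 2) => // w; rewrite /= normr_nat.
have iS := integrable_sum_EFin (index_enum 'I_N) i2.
split.
  by have := integrableZl measurableT c iS.
rewrite RintegralZl//; congr (_ * _).
rewrite (Rintegral_sum _ i2).
apply: eq_bigr => i _.
apply: etrans (RintegralD measurableT (U2 i) _) _.
  by apply: (@bounded_RV_integrable _ _ _ _ (cst 2) 2) => // w; rewrite /= normr_nat.
by congr (_ + _); rewrite /Rintegral integral_cst_prob.
Qed.

Lemma expectation_lipschitz_approx f c : trigonometric f ->
  (forall v, `|f v - G v| <= c * \sum_i (v i ^+ 2 + 2)) ->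
  Q.-integrable setT (fun w => (G (U w))%:E) /\
  `|\int[Q]_w f (U w) - \int[Q]_w G (U w)| <= c * \sum_i (\int[Q]_w (U w i ^+ 2) + 2).
Proof.
move=> ft fG; have fi := integrable_trigonometric ft.
have mf : measurable_fun setT (fun w => f (U w)) by exact/measurable_EFinP/(measurable_int Q).
have [bi bE] := integral_bound c.
have fGi : Q.-integrable setT (fun w => (f (U w) - G (U w))%:E).
  apply: (le_integrable measurableT _ _ bi).
    by apply/measurable_EFinP/measurable_funB => //; exact: measurable_lipschitz_comp.
  by move=> w _; rewrite /= lee_fin (le_trans (fG _))// ler_norm.
have Gi : Q.-integrable setT (fun w => (G (U w))%:E).
  have := integrableB measurableT fi fGi.
  by apply: eq_integrable => // w _; rewrite /= -EFinB opprB addrC subrK.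
split => //; rewrite -RintegralB//.
apply: le_trans (le_normr_Rintegral _ fGi) _ => //.
rewrite -bE; apply: le_Rintegral => //.
exact: integrable_norm.
Qed.

End trigonometric_random_variable.

(** * From convergence of moments to Lipschitz test functions *)

Section moment_convergence.
Context {R : realType} (N : nat).
Context (d : nat -> measure_display) (T : forall n, measurableType (d n))
  (P : forall n, probability (T n) R) (V : forall n, T n -> 'I_N -> R).
Context d' (T' : measurableType d') (P' : probability T' R) (W : T' -> 'I_N -> R).

Hypothesis V_int : forall n a k,
  (P n).-integrable setT (fun w => (linear_form a (V w) ^+ k)%:E).
Hypothesis W_int : forall a k,
  P'.-integrable setT (fun w => (linear_form a (W w) ^+ k)%:E).
Hypothesis W_moment : forall a, exists2 v, 0 <= v & forall k,
  \int[P']_w (linear_form a (W w) ^+ k) = k`!%:R * gauss_coef v k.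
Hypothesis VW_moment : forall a k,
  \int[P n]_w (linear_form a (V w) ^+ k) @[n --> \oo] -->
  \int[P']_w (linear_form a (W w) ^+ k).

Let mV n a : measurable_fun setT (fun w : T n => linear_form a (V w)).
Proof.
by have /measurable_int/measurable_EFinP := @V_int n a 1%N; under eq_fun do rewrite expr1.
Qed.

Let mW a : measurable_fun setT (fun w => linear_form a (W w)).
Proof.
by have /measurable_int/measurable_EFinP := W_int a 1%N; under eq_fun do rewrite expr1.
Qed.

(** The order m of the expansion is fixed by the limit law: (v / 2) ^ m / m! is a term of an
    exponential series, and the remainder bounds along the sequence converge to it. Finitely many
    moments are then involved. *)
Lemma cvg_expectation_cos a b :
  \int[P n]_w cos (linear_form a (V w) + b) @[n --> \oo] -->
  \int[P']_w cos (linear_form a (W w) + b).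
Proof.
have [v v0 vE] := W_moment a.
apply/cvgrPdist_le => e e0.
have [m me] : exists m, (v / 2) ^+ m / m`!%:R <= e / 4.
  have e4 : 0 < e / 4 by rewrite divr_gt0.
  have /cvgr0_norm_le/(_ _ e4)[m _ /(_ m (leqnn m))/(le_trans (ler_norm _))] :=
    cvg_series_cvg_0 (is_cvg_series_exp_coeff (v / 2)).
  by exists m.
pose S (U : nat -> R) : R := \sum_(i < m.*2) dcos i b / i`!%:R * U i.
have Vc n := expectation_cos_taylor (@V_int n a) b m.
have [_ Wc] := expectation_cos_taylor (W_int a) b m.
have Sc : S (fun i => \int[P n]_w (linear_form a (V w) ^+ i)) @[n --> \oo] -->
    S (fun i => \int[P']_w (linear_form a (W w) ^+ i)).
  by apply: cvg_sumr => i; apply: cvgM; [exact: cvg_cst|exact: VW_moment].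
have e4 : 0 < e / 4 by rewrite divr_gt0.
have q0 : 0 < (m.*2)`!%:R :> R by rewrite ltr0n fact_gt0.
have WE : (m.*2)`!%:R^-1 * \int[P']_w (linear_form a (W w) ^+ m.*2) =
    (v / 2) ^+ m / m`!%:R.
  by rewrite vE mulKf ?gt_eqF// gauss_coef_even.
have Vm : (m.*2)`!%:R^-1 * \int[P n]_w (linear_form a (V w) ^+ m.*2) @[n --> \oo] -->
    (v / 2) ^+ m / m`!%:R.
  by rewrite -WE; apply: cvgM; [exact: cvg_cst|exact: VW_moment].
near=> n.
have n1 : `|S (fun i => \int[P']_w (linear_form a (W w) ^+ i)) -
    S (fun i => \int[P n]_w (linear_form a (V w) ^+ i))| <= e / 4.
  by near: n; exact: cvgr_dist_le Sc _ e4.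
have n2 : `|(v / 2) ^+ m / m`!%:R -
    (m.*2)`!%:R^-1 * \int[P n]_w (linear_form a (V w) ^+ m.*2)| <= e / 4.
  by near: n; exact: cvgr_dist_le Vm _ e4.
move: Wc; rewrite WE -/(S (fun i => \int[P']_w (linear_form a (W w) ^+ i))) => Wc.
have [_] := Vc n; rewrite -/(S (fun i => \int[P n]_w (linear_form a (V w) ^+ i))).
move: n1 n2 Wc; rewrite !ler_norml => /andP[n1 n1'] /andP[n2 n2'] /andP[w1 w2] /andP[c1 c2].
by apply/andP; split; lra.
Unshelve. all: by end_near. Qed.

Lemma cvg_expectation_trigonometric f : trigonometric f ->
  \int[P n]_w f (V w) @[n --> \oo] --> \int[P']_w f (W w).
Proof.
move=> [r fr].
have [_ rW] := integral_trigonometric_sum P' mW r.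
under [X in _ --> X]eq_Rintegral do rewrite fr.
rewrite rW.
rewrite (_ : (fun n => _) = (fun n => \sum_(t <- r)
    t.1.1 * \int[P n]_w cos (linear_form t.1.2 (V w) + t.2))); last first.
  apply/funext => n; under eq_Rintegral do rewrite fr.
  by have [_ ->] := integral_trigonometric_sum (P n) (@mV n) r.
apply: cvg_sumr => t; apply: cvgM; first exact: cvg_cst.
exact: cvg_expectation_cos.
Qed.

Lemma cvg_expectation_lipschitz (G : ('I_N -> R) -> R) (K : R) : 0 <= K ->
  (forall v u, `|G v - G u| <= K * \sum_i `|v i - u i|) ->
  \int[P n]_w G (V w) @[n --> \oo] --> \int[P']_w G (W w).
Proof.
move=> K0 GK.
pose dl (i : 'I_N) : 'I_N -> R := fun j => (j == i)%:R.
have dlE i u : linear_form (dl i) u = u i.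
  rewrite /linear_form (bigD1 i)//= /dl eqxx mul1r big1 ?addr0// => j /negbTE ->.
  by rewrite mul0r.
have V2 n i : (P n).-integrable setT (fun w => (V w i ^+ 2)%:E).
  by have := @V_int n (dl i) 2; under eq_fun do rewrite dlE.
have W2 i : P'.-integrable setT (fun w => (W w i ^+ 2)%:E).
  by have := W_int (dl i) 2; under eq_fun do rewrite dlE.
have c2 i : \int[P n]_w (V w i ^+ 2) @[n --> \oo] --> \int[P']_w (W w i ^+ 2).
  have := @VW_moment (dl i) 2; under [X in _ --> X]eq_Rintegral do rewrite dlE.
  rewrite (_ : (fun n => _) = (fun n => \int[P n]_w (V w i ^+ 2)))//.
  by apply/funext => n; under eq_Rintegral do rewrite dlE.
(* The sums of second moments converge to C - 1, so they are eventually at most C, and one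
   trigonometric approximation serves all large [n]. *)
pose C := \sum_i (\int[P']_w (W w i ^+ 2) + 2) + 1.
have cC : \sum_i (\int[P n]_w (V w i ^+ 2) + 2) @[n --> \oo] --> C - 1.
  rewrite addrK; apply: cvg_sumr => i; apply: cvgD => //; exact: cvg_cst.
apply/cvgrPdist_le => e e0.
have e3 : 0 < e / 3 by rewrite divr_gt0.
have [l _ /(_ l (leqnn l)) /= le3] := near_div_le (K * C) e3.
have [f ft fG] := trigonometric_approximation l K0 GK.
have [_ hW] := expectation_lipschitz_approx mW K0 GK W2 ft fG.
have hV n := expectation_lipschitz_approx (@mV n) K0 GK (V2 n) ft fG.
have KlE : K / l.+1%:R * C <= e / 3 by rewrite mulrAC.
have Kl0 : 0 <= K / l.+1%:R by rewrite divr_ge0.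
near=> n.
have n1 : `|\int[P']_w f (W w) - \int[P n]_w f (V w)| <= e / 3.
  by near: n; exact: cvgr_dist_le (cvg_expectation_trigonometric ft) _ e3.
have n2 : \sum_i (\int[P n]_w (V w i ^+ 2) + 2) <= C.
  by near: n; apply: cvgr_le cC _ _; rewrite ltrBlDr ltrDl.
have [_ hVn] := hV n.
have {}hVn := le_trans hVn (le_trans (ler_wpM2l Kl0 n2) KlE).
have {}hW : `|\int[P']_w f (W w) - \int[P']_w G (W w)| <= e / 3.
  by apply: le_trans hW (le_trans (ler_wpM2l Kl0 _) KlE); rewrite lerDl.
move: n1 hW hVn; rewrite !ler_norml => /andP[? ?] /andP[? ?] /andP[? ?].
by apply/andP; split; lra.
Unshelve. all: by end_near. Qed.

End moment_convergence.

(** * Increment paths and chaining *)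

Section clamp.
Context {R : realType}.
Implicit Types (u s t x : R) (n i k : nat).

(** [clamp (n%:R * t - i%:R)] is the fraction of the [i]-th cell that lies to the left of [t]; this
    makes [increment_path] linear in the increments ([increment_pathE]). *)
Definition clamp u : R := Num.min (Num.max u 0) 1.

Lemma clamp_ge0 u : 0 <= clamp u.
Proof. by rewrite /clamp le_min le_max lexx orbT ler01. Qed.

Lemma clamp_le1 u : clamp u <= 1.
Proof. by rewrite /clamp ge_min lexx orbT. Qed.

Lemma clamp_small u : u <= 0 -> clamp u = 0.
Proof. by move=> u0; rewrite /clamp max_r// min_l. Qed.

Lemma clamp_id u : 0 <= u <= 1 -> clamp u = u.
Proof. by move=> /andP[u0 u1]; rewrite /clamp max_l// min_l. Qed.

Lemma clamp_large u : 1 <= u -> clamp u = 1.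
Proof. by move=> u1; rewrite /clamp max_l ?(le_trans _ u1)// min_r. Qed.

Lemma clamp_le u t : u <= t -> clamp u <= clamp t.
Proof. by move=> ut; rewrite /clamp le_min2 // ge_max !le_max ut lexx orbT. Qed.

Lemma clamp_continuous : continuous clamp.
Proof.
move=> u.
apply: (@continuous_min _ _ (fun u => Num.max u 0 : R^o) (cst 1)); last exact: cvg_cst.
by apply: (@continuous_max _ _ (fun u => u : R^o) (cst 0)); [exact: cvg_id|exact: cvg_cst].
Qed.

(** The left side is non-zero only for 0 < u < 1, where [clamp (u - 1)] vanishes. The right side
    telescopes over the shifts u - i. *)
Lemma clamp_defect u : clamp u * (1 - clamp u) <= clamp u - clamp (u - 1).
Proof.
have [u0|u0] := leP u 0.
  by rewrite !clamp_small ?mul0r ?subrr// lerBlDr (le_trans u0).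
have [u1|u1] := leP 1 u.
  by rewrite (clamp_large u1) subrr mulr0 subr_ge0 clamp_le1.
rewrite (clamp_small (u := u - 1)) ?subr_le0 ?ltW// subr0 clamp_id ?ltW//.
by rewrite gtr_pMr// ltrBlDr ltrDl.
Qed.

Lemma sum_clamp_truncn (f : nat -> R) u n : 0 <= u -> (Num.truncn u < n)%N ->
  \sum_(i < n) f i * clamp (u - i%:R) =
  \sum_(i < Num.truncn u) f i + (u - (Num.truncn u)%:R) * f (Num.truncn u).
Proof.
move=> u0; set k := Num.truncn u => kn.
have /andP[ku uk] : k%:R <= u < k.+1%:R by exact: truncn_itv.
rewrite -(big_mkord xpredT (fun i => f i * clamp (u - i%:R))).
rewrite (@big_cat_nat _ _ _ k)//= ?(ltnW kn)//.
rewrite [X in _ + X]big_ltn// [X in _ + (_ + X)]big_nat_cond [X in _ + (_ + X)]big1 => [|i].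
  rewrite addr0 big_mkord; congr (_ + _); last first.
    by rewrite mulrC clamp_id// subr_ge0 ku/= lerBlDr addrC natr1 ltW.
  apply: eq_bigr => i _; rewrite clamp_large ?mulr1// lerBrDr addrC natr1.
  by rewrite (le_trans _ ku)// ler_nat.
rewrite andbT => /andP[ki _]; rewrite clamp_small ?mulr0// subr_le0.
by rewrite (le_trans (ltW uk))// ler_nat.
Qed.

Lemma sum_clamp u n : 0 <= u <= n%:R -> \sum_(i < n) clamp (u - i%:R) = u.
Proof.
move=> /andP[u0 un].
have kn : (Num.truncn u <= n)%N by rewrite -(ler_nat R) (le_trans _ un)// truncn_le.
have := @sum_clamp_truncn (fun=> 1) u n.+1 u0 kn.
rewrite big_ord_recr/= clamp_small ?subr_le0// mulr0 addr0.
rewrite sumr_const card_ord mulr1 addrC subrK => uE.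
by rewrite -[RHS]uE; apply: eq_bigr => i _; rewrite mul1r.
Qed.

Lemma increment_pathE n (x : n.-tuple R) t : 0 <= t ->
  increment_path x t = \sum_(i < n) clamp (n%:R * t - i%:R) * tnth x i.
Proof.
move=> t0; have nt0 : 0 <= n%:R * t by rewrite mulr_ge0.
rewrite /increment_path; set u := n%:R * t.
(* The floor of n t can reach [n], as it does at t = 1, so the sum is first taken over [N] indices;
   those from [n] on carry the default entry 0. *)
pose N := maxn n (Num.truncn u).+1.
rewrite -(@sum_clamp_truncn (fun i => x`_i) u N)// ?leq_max ?leqnn ?orbT//.
rewrite -(big_mkord xpredT (fun i => x`_i * clamp (u - i%:R))).
rewrite (@big_cat_nat _ _ _ n)//= ?leq_maxl// [X in _ + X]big_nat_cond [X in _ + X]big1 => [|i].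
  by rewrite addr0 big_mkord; apply: eq_bigr => i _; rewrite (tnth_nth 0) mulrC.
by rewrite andbT => /andP[ni _]; rewrite nth_default ?mul0r// size_tuple.
Qed.

Definition increment_weight n s t i : R := clamp (n%:R * t - i%:R) - clamp (n%:R * s - i%:R).

Lemma increment_weight_itv n s t i : s <= t -> 0 <= increment_weight n s t i <= 1.
Proof.
move=> st; rewrite subr_ge0 clamp_le ?lerB ?ler_wpM2l//= lerBlDr.
by rewrite (le_trans (clamp_le1 _))// lerDl clamp_ge0.
Qed.

Lemma sum_increment_weight n s t : 0 <= s <= 1 -> 0 <= t <= 1 ->
  \sum_(i < n) increment_weight n s t i = n%:R * (t - s).
Proof.
move=> /andP[s0 s1] /andP[t0 t1]; rewrite sumrB !sum_clamp ?mulrBr//.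
  by rewrite mulr_ge0//= ler_piMr.
by rewrite mulr_ge0//= ler_piMr.
Qed.

(** The origin of min (s, t) in the covariance: a cell partly to the left of [s] is entirely to the
    left of [t], save at most one. The error is at most the sum of c (1 - c) over the weights c of
    [s], which telescopes by [clamp_defect]. *)
Lemma sum_clamp_mul n s t : 0 <= s <= t -> t <= 1 ->
  `|\sum_(i < n) clamp (n%:R * s - i%:R) * clamp (n%:R * t - i%:R) - n%:R * s| <= 1.
Proof.
move=> /andP[s0 st] t1.
have ns : 0 <= n%:R * s <= n%:R.
  by rewrite mulr_ge0//= ler_piMr// (le_trans st).
have tel : \sum_(i < n) (clamp (n%:R * s - i%:R) - clamp (n%:R * s - i.+1%:R)) <= 1.
  have := @telescope_sumr R 0 n (fun i => - clamp (n%:R * s - i%:R)) (leq0n n).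
  rewrite big_mkord subr0.
  under eq_bigr do rewrite opprK addrC.
  by move=> ->; rewrite opprK addrC lerBlDr (le_trans (clamp_le1 _))// lerDl clamp_ge0.
rewrite -{2}(sum_clamp ns) distrC -sumrB ger0_norm; last first.
  apply: sumr_ge0 => i _; rewrite -{1}[clamp (_ * s - _)]mulr1 -mulrBr.
  by rewrite mulr_ge0 ?clamp_ge0// subr_ge0 clamp_le1.
apply: le_trans tel; apply: ler_sum => i _.
apply: le_trans (_ : clamp (n%:R * s - i%:R) * (1 - clamp (n%:R * s - i%:R)) <= _).
  rewrite mulrBr mulr1 lerD2l lerN2 ler_wpM2l ?clamp_ge0// clamp_le//.
  by rewrite lerD2r ler_wpM2l.
have := clamp_defect (n%:R * s - i%:R); rewrite -natr1.
by rewrite opprD addrA.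
Qed.

End clamp.

Section scaled_path.
Context {R : realType} (m : nat).
Implicit Types (x : m.+1.-tuple R) (s t : R).

Definition scaled_path x t : R := Num.sqrt m.+1%:R * (increment_path x t - t).

Lemma scaled_path_C01 x : C01 (scaled_path x).
Proof.
rewrite /C01 /=.
apply: (@subspace_eq_continuous _ _ _ (fun t => Num.sqrt m.+1%:R *
   (\sum_(i < m.+1) clamp (m.+1%:R * t - i%:R) * tnth x i - t))).
  move=> t; rewrite inE/= in_itv/= => /andP[t0 _].
  by rewrite /from_subspace /scaled_path increment_pathE.
apply: continuous_subspaceT => t.
apply: cvgM; first exact: cvg_cst.
apply: cvgB; last exact: cvg_id.
apply: cvg_big => [|i _]; first exact: add_continuous.
apply: cvgM; last exact: cvg_cst.
apply: (@continuous_comp _ _ _ (fun t : R => m.+1%:R * t - i%:R) clamp); last exact: clamp_continuous.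
by apply: cvgB; [apply: cvgM; [exact: cvg_cst|exact: cvg_id]|exact: cvg_cst].
Qed.

(** As the coordinates sum to 1, the centring is distributed over the coefficients; for t in [0, 1]
    these then sum to 0. *)
Lemma scaled_pathE x t : simplex x -> 0 <= t ->
  scaled_path x t = \sum_(i < m.+1)
    (Num.sqrt m.+1%:R * (clamp (m.+1%:R * t - i%:R) - t)) * tnth x i.
Proof.
move=> [_ x1] t0; rewrite /scaled_path increment_pathE//.
under [in RHS]eq_bigr do rewrite -mulrA mulrBl.
by rewrite -mulr_sumr sumrB -mulr_sumr x1 mulr1.
Qed.

Lemma increment_path_le x s t : simplex x -> 0 <= s <= t ->
  increment_path x s <= increment_path x t.
Proof.
move=> [x0 _] /andP[s0 st]; rewrite !increment_pathE ?(le_trans s0)//.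
by apply: ler_sum => i _; rewrite ler_wpM2r// clamp_le// lerD2r ler_wpM2l.
Qed.

End scaled_path.

(** * Dyadic chaining *)

Section dyadic_chaining.
Context {R : realType}.
Implicit Types (r q j : nat) (x : R -> R) (t theta : R).

Definition dyadic r j : R := j%:R / (2 ^ r)%:R.

Definition dyadic_floor r t : R := dyadic r (Num.truncn ((2 ^ r)%:R * t)).

Definition dyadic_increment x r j : R := x (dyadic r j.+1) - x (dyadic r j).

Definition chain_bound theta x q : R :=
  theta ^+ q + \sum_(j < 2 ^ q) dyadic_increment x q j ^+ 4 / theta ^+ (3 * q).

Lemma pow2_gt0 r : 0 < (2 ^ r)%:R :> R.
Proof. by rewrite ltr0n expn_gt0. Qed.

Lemma dyadic_double r j : dyadic r.+1 j.*2 = dyadic r j.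
Proof.
rewrite /dyadic expnS -muln2 mulnC !natrM invfM mulrACA divff ?mul1r//.
Qed.

Lemma dyadic_itv r j : (j <= 2 ^ r)%N -> 0 <= dyadic r j <= 1.
Proof.
by move=> jr; rewrite divr_ge0//= ler_pdivrMr ?pow2_gt0// mul1r ler_nat.
Qed.

Lemma chain_bound_ge0 theta x q : 0 <= theta -> 0 <= chain_bound theta x q.
Proof.
move=> t0; rewrite addr_ge0 ?exprn_ge0// sumr_ge0// => j _.
by apply: divr_ge0; [exact: exprn_even_ge0|exact: exprn_ge0].
Qed.

(* [a <= h + a ^ 4 / h ^ 3] trades the maximum over a generation of increments
   for a sum of fourth powers. *)
Lemma dyadic_increment_le theta x q j : 0 < theta -> (j < 2 ^ q)%N ->
  `|dyadic_increment x q j| <= chain_bound theta x q.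
Proof.
move=> t0 jq; set a := dyadic_increment x q j.
have h0 : 0 < theta ^+ q by exact: exprn_gt0.
have a4 b : b ^+ 4 = `|b| ^+ 4 :> R.
  by rewrite -normrX ger0_norm// -[4%N]/(2 * 2)%N exprM sqr_ge0.
apply: le_trans (_ : theta ^+ q + a ^+ 4 / theta ^+ (3 * q) <= _); last first.
  rewrite lerD2l (bigD1 (Ordinal jq))//= lerDl sumr_ge0// => i _.
  by apply: divr_ge0; [exact: exprn_even_ge0|exact/exprn_ge0/ltW].
have [ah|ha] := leP `|a| (theta ^+ q).
  by rewrite (le_trans ah)// lerDl; apply: divr_ge0; [exact: exprn_even_ge0|exact/exprn_ge0/ltW].
apply: le_trans (_ : a ^+ 4 / theta ^+ (3 * q) <= _); last first.
  by rewrite lerDr ltW.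
rewrite a4 mulnC exprM ler_pdivlMr ?exprn_gt0// [leRHS]exprS ler_wpM2l//.
by rewrite lerXn2r ?nnegrE// ltW.
Qed.

Lemma truncn_double (u : R) : 0 <= u ->
  exists b : bool, Num.truncn (2 * u) = (b + (Num.truncn u).*2)%N.
Proof.
move=> u0; have /andP[ku uk] := truncn_itv u0; set k := Num.truncn u in ku uk *.
have u20 : 0 <= 2 * u by rewrite mulr_ge0.
have kd : k.*2%:R = 2 * k%:R :> R by rewrite -muln2 natrM mulrC.
have [h|h] := ltP (2 * u) (k.*2.+1)%:R.
  exists false; apply/eqP; rewrite truncn_eq// add0n h andbT kd.
  by rewrite ler_wpM2l.
exists true; apply/eqP; rewrite truncn_eq// add1n h/=.
by rewrite -doubleS -muln2 natrM mulrC ltr_pM2r.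
Qed.

Lemma truncn_pow2_le r t : 0 <= t <= 1 -> (Num.truncn ((2 ^ r)%:R * t) <= 2 ^ r)%N.
Proof.
move=> /andP[t0 t1]; rewrite -(ler_nat R).
apply: le_trans (_ : (2 ^ r)%:R * t <= _); first by rewrite truncn_le mulr_ge0.
by rewrite ler_piMr.
Qed.

Lemma dyadic_floor_itv r t : 0 <= t <= 1 -> 0 <= dyadic_floor r t <= 1.
Proof. by move=> t01; apply: dyadic_itv; exact: truncn_pow2_le. Qed.

Lemma dyadic_floor_le r t : 0 <= t -> dyadic_floor r t <= t < dyadic_floor r t + (2 ^ r)%:R^-1.
Proof.
move=> t0; have : 0 <= (2 ^ r)%:R * t by rewrite mulr_ge0.
move=> /truncn_itv/andP[h1 h2].
rewrite /dyadic_floor /dyadic ler_pdivrMr ?pow2_gt0// [t * _]mulrC h1/=.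
by rewrite -[X in _ + X]mul1r -mulrDl natr1 ltr_pdivlMr ?pow2_gt0// mulrC.
Qed.

(** Refining the grid adds one binary digit to the index ([truncn_double]): the two floors coincide
    or are neighbours in generation [q.+1]. *)
Lemma dyadic_floorS_dist theta x q t : 0 < theta -> 0 <= t <= 1 ->
  `|x (dyadic_floor q.+1 t) - x (dyadic_floor q t)| <= chain_bound theta x q.+1.
Proof.
move=> th0 t01; have /andP[t0 t1] := t01.
have u0 : 0 <= (2 ^ q)%:R * t by rewrite mulr_ge0.
have := truncn_pow2_le q.+1 t01.
rewrite /dyadic_floor -(dyadic_double q).
rewrite expnS natrM -mulrA; have [[] ->] := truncn_double u0.
  move=> h; apply: (@dyadic_increment_le theta x q.+1 _ th0); rewrite expnS.
  exact: h.
by rewrite add0n subrr normr0 => _; exact/chain_bound_ge0/ltW.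
Qed.

Lemma dyadic_chaining theta x r q t : 0 < theta -> 0 <= t <= 1 -> (r <= q)%N ->
  `|x (dyadic_floor q t) - x (dyadic_floor r t)| <=
    \sum_(r <= i < q) chain_bound theta x i.+1.
Proof.
move=> th0 t01; elim: q => [|q IH].
  by rewrite leqn0 => /eqP ->; rewrite subrr normr0 big_geq.
rewrite leq_eqVlt => /orP[/eqP ->|]; first by rewrite subrr normr0 big_geq.
rewrite ltnS => rq; rewrite big_nat_recr//= addrC.
rewrite -(subrKA (x (dyadic_floor q t))) (le_trans (ler_normD _ _))// lerD ?IH//.
exact: dyadic_floorS_dist.
Qed.

End dyadic_chaining.

Section scaled_path_chaining.
Context {R : realType} (m : nat) (x : m.+1.-tuple R) (theta : R).
Hypotheses (x_simplex : simplex x) (th0 : 0 < theta).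

(** Within a cell the unscaled path is monotone, so it stays between its endpoint values, which
    [chain_bound] compares; the linear drift accounts for sqrt n / 2 ^ q. *)
Lemma scaled_path_cell q t : 0 <= t <= 1 ->
  `|scaled_path x t - scaled_path x (dyadic_floor q t)| <=
  chain_bound theta (scaled_path x) q + Num.sqrt m.+1%:R / (2 ^ q)%:R.
Proof.
move=> t01; have /andP[t0 t1] := t01.
have s0 : 0 <= Num.sqrt m.+1%:R :> R by exact: sqrtr_ge0.
have p0 := @pow2_gt0 R q.
have /andP[ft tf] := dyadic_floor_le q t0.
have /andP[f0 f1] := dyadic_floor_itv q t01.
(* Treated apart because at t = 1 the floor is the last grid point and no cell starts there. *)
have [te|tne] := eqVneq t (dyadic_floor q t).
  by rewrite -te subrr normr0 addr_ge0 ?divr_ge0 ?chain_bound_ge0 ?ltW.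
have {tne}lt : dyadic_floor q t < t by rewrite lt_neqAle eq_sym tne.
have jq : (Num.truncn ((2 ^ q)%:R * t) < 2 ^ q)%N.
  rewrite -(ltr_nat R); move: (lt_le_trans lt t1).
  by rewrite /dyadic_floor/dyadic ltr_pdivrMr// mul1r.
have := dyadic_increment_le (scaled_path x) th0 jq.
rewrite /dyadic_increment -/(dyadic_floor q t).
have bE : dyadic q (Num.truncn ((2 ^ q)%:R * t)).+1 = dyadic_floor q t + (2 ^ q)%:R^-1 :> R.
  by rewrite /dyadic_floor/dyadic -natr1 mulrDl mul1r.
rewrite bE; set b := _ + _^-1 in tf *.
have m1 : increment_path x (dyadic_floor q t) <= increment_path x t.
  by apply: increment_path_le => //; rewrite f0.
have m2 : increment_path x t <= increment_path x b.
  by apply: increment_path_le => //; rewrite t0/= ltW.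
have bb : b = dyadic_floor q t + (2 ^ q)%:R^-1 by [].
rewrite /scaled_path !ler_norml.
set s := Num.sqrt _ in s0 *; set f := dyadic_floor q t in m1 lt bb *.
have {}m1 := ler_wpM2l s0 m1; have {}m2 := ler_wpM2l s0 m2.
have h1 := ler_wpM2l s0 (ltW lt); have h2 := ler_wpM2l s0 (ltW tf).
have bs : s * b = s * f + s / (2 ^ q)%:R by rewrite bb mulrDr.
have c0 := chain_bound_ge0 (scaled_path x) q (ltW th0).
by move=> /andP[k1 k2]; apply/andP; split; lra.
Qed.

Lemma scaled_path_chaining r q t : 0 <= t <= 1 -> (r <= q)%N ->
  `|scaled_path x t - scaled_path x (dyadic_floor r t)| <=
  \sum_(r <= i < q) chain_bound theta (scaled_path x) i.+1 +
  (chain_bound theta (scaled_path x) q + Num.sqrt m.+1%:R / (2 ^ q)%:R).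
Proof.
move=> t01 rq.
rewrite -(subrKA (scaled_path x (dyadic_floor q t))) addrC (le_trans (ler_normD _ _))//.
rewrite lerD//; [exact: dyadic_chaining|exact: scaled_path_cell].
Qed.

End scaled_path_chaining.

Lemma hsymZ (R : realType) (z : R) (s : seq R) k :
  hsym [seq z * c | c <- s] k = z ^+ k * hsym s k.
Proof.
elim: s k => [|c s IH] k; first by rewrite /hsym; case: k => [|k]; rewrite ?mulr1 ?mulr0.
elim: k => [|k IHk]; first by rewrite !hsym0 mulr1.
by rewrite !hsym_consS IH IHk exprS; ring.
Qed.

Lemma power_sum_mkseq (R : realType) (b : nat -> R) n j :
  power_sum (mkseq b n) j = \sum_(i < n) b i ^+ j.
Proof. by rewrite /power_sum /mkseq big_map -{1}[n]subn0 -/(index_iota 0 n) big_mkord. Qed.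

Lemma exp_fact_le m k : (m.+1 ^ k * m`! <= (m + k)`!)%N.
Proof.
elim: k => [|k IH]; first by rewrite mul1n addn0.
by rewrite addnS factS expnS -mulnA leq_mul// ltnS leq_addr.
Qed.

Lemma cvg_factorial_ratio (R : realType) k :
  m.+1%:R ^+ k * m`!%:R / (m + k)`!%:R @[m --> \oo] --> (1 : R).
Proof.
elim: k => [|k IH].
  rewrite (_ : (fun m => _) = cst 1); first exact: cvg_cst.
  by apply/funext => m; rewrite expr0 mul1r addn0 divff// pnatr_eq0 -lt0n fact_gt0.
(* The induction step multiplies the ratio by (m + 1) / (m + k + 1), written as 1 - k / (m + k +
   1). *)
have h : 1 - k%:R * (m + k).+1%:R^-1 @[m --> \oo] --> (1 : R).
  rewrite -[X in _ --> X]subr0 -(mulr0 k%:R).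
  apply: cvgB; first exact: cvg_cst.
  apply: cvgM; first exact: cvg_cst.
  by rewrite (@cvg_shiftn k _ (fun m : nat => (m.+1%:R^-1 : R))); exact: cvg_harmonic.
rewrite -[X in _ --> X]mulr1.
rewrite (_ : (fun m => _) = (fun m => (m.+1%:R ^+ k * m`!%:R / (m + k)`!%:R) *
    (1 - k%:R * (m + k).+1%:R^-1))); first exact: cvgM.
apply/funext => m; rewrite addnS factS natrM exprS.
have h1 : (m + k).+1%:R != 0 :> R by rewrite pnatr_eq0.
have h2 : (m + k)`!%:R != 0 :> R by rewrite pnatr_eq0 -lt0n fact_gt0.
have -> : m.+1%:R = (m + k).+1%:R - k%:R :> R by rewrite -natrB ?leqW ?leq_addl// subSn ?leq_addl// addnK.
set N := (m + k).+1%:R in h1 *; set M := (m + k)`!%:R in h2 *; clearbody N M.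
by field; rewrite h1 h2.
Qed.

(** * Fourth moments and oscillation of the scaled path *)

Section simplex_path_moments.
Context {R : realType} d (T : measurableType d) (P : probability T R) (m : nat).
Variables (X : {RV P >-> m.+1.-tuple R}) (X' : T -> m.+1.-tuple R).
Hypothesis X_uniform : forall A, measurable A -> distribution P X A = uniform_simplex A.
Hypothesis X'X : forall w, simplex (X w) -> X' w = X w.
Hypothesis X'_simplex : forall w, simplex (X' w).
Hypothesis mX' : measurable_fun setT X'.

Lemma weighted_moment (b : nat -> R) k :
  P.-integrable setT (fun w =>
    ((Num.sqrt m.+1%:R * \sum_(i < m.+1) b i * tnth (X' w) i) ^+ k)%:E) /\
  \int[P]_w ((Num.sqrt m.+1%:R * \sum_(i < m.+1) b i * tnth (X' w) i) ^+ k) =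
  Num.sqrt m.+1%:R ^+ k * (k`!%:R * m`!%:R / (m + k)`!%:R) * hsym (mkseq b m.+1) k.
Proof.
have [] := simplex_moment X_uniform k (size_mkseq b m.+1) X'X X'_simplex mX'.
have bE w : \sum_(i < m.+1) (mkseq b m.+1)`_i * tnth (X' w) i = \sum_(i < m.+1) b i * tnth (X' w) i.
  by apply: eq_bigr => i _; rewrite nth_mkseq.
under eq_fun do rewrite bE.
under eq_Rintegral do rewrite bE.
move=> i1 e1.
under eq_fun do rewrite exprMn.
under eq_Rintegral do rewrite exprMn.
split; first by have := integrableZl measurableT (Num.sqrt m.+1%:R ^+ k) i1.
rewrite RintegralZl//.
by rewrite e1 mulrA.
Qed.

Lemma scaled_path_incrementE (s t : R) w : 0 <= s -> 0 <= t ->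
  scaled_path (X' w) t - scaled_path (X' w) s =
  Num.sqrt m.+1%:R * \sum_(i < m.+1) (increment_weight m.+1 s t i - (t - s)) * tnth (X' w) i.
Proof.
move=> s0 t0; rewrite !scaled_pathE// -sumrB mulr_sumr; apply: eq_bigr => i _.
by rewrite /increment_weight; ring.
Qed.

(** The weights lie in [0, 1] and sum to n (t - s), so their squares sum to no more, and centring
    only lowers this. The centred weights are at most 1 in absolute value, whence the fourth
    powers. *)
Lemma increment_power_sums (s t : R) : 0 <= s <= t -> t <= 1 ->
  let b := fun i => increment_weight m.+1 s t i - (t - s) in
  [/\ power_sum (mkseq b m.+1) 1 = 0,
      0 <= power_sum (mkseq b m.+1) 2 <= m.+1%:R * (t - s) &
      power_sum (mkseq b m.+1) 4 <= m.+1%:R * (t - s)].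
Proof.
move=> /andP[s0 st] t1 b.
have sw : \sum_(i < m.+1) increment_weight m.+1 s t i = m.+1%:R * (t - s).
  by apply: sum_increment_weight; rewrite ?s0 ?t1 ?(le_trans st)// ?(le_trans s0).
have b2 : \sum_(i < m.+1) b i ^+ 2 <= m.+1%:R * (t - s).
  rewrite (eq_bigr (fun i : 'I_m.+1 => increment_weight m.+1 s t i ^+ 2 -
    2 * (t - s) * increment_weight m.+1 s t i + (t - s) ^+ 2)); last first.
    by move=> i _; rewrite /b; ring.
  rewrite big_split sumrB/= -mulr_sumr sw sumr_const card_ord -[(t - s) ^+ 2 *+ m.+1]mulr_natl.
  apply: le_trans (_ : \sum_(i < m.+1) increment_weight m.+1 s t i ^+ 2 <= _).
    have : 0 <= m.+1%:R * (t - s) ^+ 2 :> R by rewrite mulr_ge0// sqr_ge0.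
    by rewrite -(lerD2l (\sum_(i < m.+1) increment_weight m.+1 s t i ^+ 2)) addr0; lra.
  rewrite -sw ler_sum// => i _; have /andP[w0 w1] := increment_weight_itv m.+1 i st.
  by rewrite expr2 ler_piMr.
rewrite !power_sum_mkseq; split.
- under eq_bigr do rewrite expr1.
  by rewrite sumrB sw sumr_const card_ord -[(t - s) *+ m.+1]mulr_natl subrr.
- by rewrite b2 andbT sumr_ge0// => i _; exact: sqr_ge0.
- apply: le_trans b2; apply: ler_sum => i _.
  have /andP[w0 w1] := increment_weight_itv m.+1 i st.
  have b1 : b i ^+ 2 <= 1.
    by rewrite -(@real_normK R) ?num_real// expr_le1// /b ler_norml; apply/andP; split; lra.
  by rewrite -[4%N]/(2 + 2)%N exprD ler_piMr// sqr_ge0.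
Qed.

(** With D = n (t - s), Newton's identities bound h_4 by (D ^ 2 / 2 + D) / 4, and D >= 1 absorbs the
    linear term: this is where a length of at least 1 / n enters. The constant 9 is 24 times 3 /
    8. *)
Lemma fourth_moment_increment (s t : R) : 0 <= s <= t -> t <= 1 -> m.+1%:R^-1 <= t - s ->
  P.-integrable setT (fun w => ((scaled_path (X' w) t - scaled_path (X' w) s) ^+ 4)%:E) /\
  \int[P]_w ((scaled_path (X' w) t - scaled_path (X' w) s) ^+ 4) <= 9 * (t - s) ^+ 2.
Proof.
move=> st t1 nst; have /andP[s0 st'] := st.
have t0 := le_trans s0 st'.
under eq_fun do rewrite scaled_path_incrementE//.
under eq_Rintegral do rewrite scaled_path_incrementE//.
have [i4 ->] := weighted_moment (fun i => increment_weight m.+1 s t i - (t - s)) 4.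
split => //; have [p1 /andP[p20 p2] p4] := increment_power_sums st t1.
rewrite hsym4//.
set q2 := power_sum _ 2 in p20 p2 *; set q4 := power_sum _ 4 in p4 *.
clearbody q2 q4.
have n0 : 0 < m.+1%:R :> R by [].
have dn : 1 <= m.+1%:R * (t - s) by rewrite -ler_pdivrMl ?mulr1.
have s4 : Num.sqrt m.+1%:R ^+ 4 = m.+1%:R ^+ 2 :> R.
  by rewrite -[4%N]/(2 * 2)%N exprM sqr_sqrtr.
rewrite s4.
have f4 : (4`!%:R * m`!%:R / (m + 4)`!%:R) <= 24 / m.+1%:R ^+ 4 :> R.
  rewrite ler_pdivrMr ?ltr0n ?fact_gt0// mulrAC ler_pdivlMr ?exprn_gt0//.
  rewrite -!natrX -!natrM ler_nat -[4`!]/24%N -mulnA leq_mul2l/= mulnC.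
  exact: exp_fact_le.
have q24 : (q2 ^+ 2 / 2 + q4) / 4 <= (3 / 8) * (m.+1%:R * (t - s)) ^+ 2.
  set D := m.+1%:R * (t - s) in p2 p4 dn *.
  have : q2 ^+ 2 <= D ^+ 2 by rewrite lerXn2r ?nnegrE// (le_trans p20).
  have : D <= D ^+ 2 by rewrite expr2 ler_peMr// (le_trans _ dn).
  by lra.
have hp : 0 <= 4`!%:R * m`!%:R / (m + 4)`!%:R :> R by rewrite divr_ge0// mulr_ge0.
rewrite -mulrA; apply: le_trans (ler_wpM2l _ (ler_wpM2l hp q24)) _; first exact: sqr_ge0.
apply: le_trans (ler_wpM2l _ (ler_wpM2r _ f4)) _; first exact: sqr_ge0.
  by rewrite mulr_ge0// sqr_ge0.
have n1 : m.+1%:R != 0 :> R by rewrite pnatr_eq0.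
move: n1; set n := m.+1%:R; move: n => n n1.
by rewrite le_eqVlt; apply/orP; left; apply/eqP; field.
Qed.

(** There are 2 ^ q increments, each with fourth moment at most 9 / 4 ^ q. *)
Lemma expectation_chain_bound (theta : R) q : 0 < theta -> (2 ^ q <= m.+1)%N ->
  P.-integrable setT (fun w => (chain_bound theta (scaled_path (X' w)) q)%:E) /\
  \int[P]_w chain_bound theta (scaled_path (X' w)) q <=
    theta ^+ q + 9 * ((2 ^ q)%:R * theta ^+ (3 * q))^-1.
Proof.
move=> th0 qm; have p0 := @pow2_gt0 R q.
have D j : (j < 2 ^ q)%N ->
    P.-integrable setT (fun w => (dyadic_increment (scaled_path (X' w)) q j ^+ 4)%:E) /\
    \int[P]_w (dyadic_increment (scaled_path (X' w)) q j ^+ 4) <= 9 * ((2 ^ q)%:R^-1) ^+ 2.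
  move=> jq; have /andP[s0 _] := @dyadic_itv R q j (ltnW jq).
  have /andP[_ t1] := @dyadic_itv R q j.+1 jq.
  have dE : dyadic q j.+1 - dyadic q j = (2 ^ q)%:R^-1 :> R.
    by rewrite /dyadic -mulrBl -natr1 addrAC subrr add0r mul1r.
  rewrite -dE; apply: fourth_moment_increment => //.
    by rewrite s0 -subr_ge0 dE invr_ge0 ltW.
  by rewrite dE lef_pV2 ?posrE// ler_nat.
pose f (j : 'I_(2 ^ q)) w := dyadic_increment (scaled_path (X' w)) q j ^+ 4 / theta ^+ (3 * q).
have fi j : P.-integrable setT (fun w => (f j w)%:E).
  by have := integrableZr measurableT (theta ^+ (3 * q))^-1 (D j (ltn_ord j)).1.
have cE w : chain_bound theta (scaled_path (X' w)) q = theta ^+ q + \sum_j f j w by [].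
have sfi := integrable_sum_EFin (index_enum 'I_(2 ^ q)) fi.
have ci : P.-integrable setT (fun w => (theta ^+ q)%:E).
  by apply: (@bounded_RV_integrable _ _ _ _ (cst (theta ^+ q)) `|theta ^+ q|).
split.
  under eq_fun do rewrite cE EFinD.
  exact: integrableD.
under eq_Rintegral do rewrite cE.
rewrite (RintegralD measurableT ci sfi) lerD//.
  by rewrite /Rintegral integral_cst_prob.
rewrite (Rintegral_sum _ fi).
apply: le_trans (_ : \sum_(j < 2 ^ q) 9 * ((2 ^ q)%:R^-1) ^+ 2 / theta ^+ (3 * q) <= _).
  apply: ler_sum => j _; have [ij lj] := D j (ltn_ord j).
  rewrite /f (RintegralZr _ measurableT ij).
  by apply: ler_wpM2r => //; rewrite invr_ge0 exprn_ge0// ltW.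
rewrite sumr_const card_ord -[_ *+ _]mulr_natl.
have n1 : (2 ^ q)%:R != 0 :> R by rewrite gt_eqF.
have n2 : theta ^+ (3 * q) != 0 by rewrite gt_eqF// exprn_gt0.
move: n1 n2; set N := (2 ^ q)%:R; set M := theta ^+ _; move: N M => N M n1 n2.
by rewrite le_eqVlt; apply/orP; left; apply/eqP; field; rewrite n1 n2.
Qed.

(** [K] is an integrable majorant valid for all [t] at once, which spares the measurability of a
    supremum. *)
Lemma oscillation_bound r : (2 ^ r <= m.+1)%N -> exists K : T -> R,
  [/\ P.-integrable setT (fun w => (K w)%:E),
      forall w (t : R), 0 <= t <= 1 ->
        `|scaled_path (X' w) t - scaled_path (X' w) (dyadic_floor r t)| <= K w &
      \int[P]_w K w <= 100 * (9 / 10) ^+ r + 2 / Num.sqrt m.+1%:R].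
Proof.
(* The ratio must satisfy th < 1, for the generations to be summable, and 2 th ^ 4 >= 1, for the
   second term of [expectation_chain_bound] to be at most 9 th ^ q. *)
move=> rm; pose th : R := 9 / 10; have th0 : 0 < th by rewrite /th; lra.
(* The finest generation whose cells have length at least 1 / n, as the fourth moments require; 2 ^
   q > n / 2 then keeps sqrt n / 2 ^ q at most 2 / sqrt n. *)
pose q := trunc_log 2 m.+1.
have qm : (2 ^ q <= m.+1)%N by exact: trunc_logP.
have mq : (m.+1 < 2 ^ q.+1)%N by exact: trunc_log_ltn.
have rq : (r <= q)%N.
  by rewrite -ltnS -(ltn_exp2l _ _ (ltnSn 1)) (leq_ltn_trans rm).
have C j : (j <= q)%N -> P.-integrable setT (fun w => (chain_bound th (scaled_path (X' w)) j)%:E) /\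
    \int[P]_w chain_bound th (scaled_path (X' w)) j <= 10 * th ^+ j.
  move=> jq; have jm : (2 ^ j <= m.+1)%N by rewrite (leq_trans _ qm)// leq_exp2l.
  have [ci cl] := expectation_chain_bound th0 jm; split => //.
  apply: le_trans cl _.
  have h0 : 0 < th ^+ j by exact: exprn_gt0.
  suff : ((2 ^ j)%:R * th ^+ (3 * j))^-1 <= th ^+ j by lra.
  have p : 0 < (2 ^ j)%:R * th ^+ (3 * j) by rewrite mulr_gt0 ?pow2_gt0// exprn_gt0.
  rewrite -[leLHS]mul1r ler_pdivrMr// mulrCA -exprD natrX.
  rewrite (_ : (j + 3 * j = 4 * j)%N); last by rewrite -mulSn.
  rewrite exprM -exprMn exprn_ege1//.
  by rewrite /th; lra.
pose s : R := Num.sqrt m.+1%:R.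
have s0 : 0 < s by rewrite sqrtr_gt0.
pose f (j : 'I_(q - r)) w := chain_bound th (scaled_path (X' w)) (j + r).+1.
have jE (j : 'I_(q - r)) : ((j + r).+1 <= q)%N by rewrite addnC -ltn_subRL.
have fi j : P.-integrable setT (fun w => (f j w)%:E) := (C _ (jE j)).1.
have sfi := integrable_sum_EFin (index_enum 'I_(q - r)) fi.
have [gi gl] := C q (leqnn q).
have ci : P.-integrable setT (fun w => (s / (2 ^ q)%:R)%:E).
  by apply: (@bounded_RV_integrable _ _ _ _ (cst (s / (2 ^ q)%:R)) `|s / (2 ^ q)%:R|).
have gci : P.-integrable setT (fun w => (chain_bound th (scaled_path (X' w)) q + s / (2 ^ q)%:R)%:E).
  by under eq_fun do rewrite EFinD; exact: integrableD.
exists (fun w => \sum_j f j w + (chain_bound th (scaled_path (X' w)) q + s / (2 ^ q)%:R)); split.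
- by under eq_fun do rewrite EFinD; exact: integrableD.
- move=> w t t01; have := scaled_path_chaining (X'_simplex w) th0 t01 rq.
  by rewrite -{2}[r]add0n big_addn big_mkord.
- rewrite (RintegralD measurableT sfi gci) (Rintegral_sum _ fi).
  rewrite (RintegralD measurableT gi ci) [X in _ + (_ + X)](_ : _ = s / (2 ^ q)%:R); last first.
    by rewrite /Rintegral integral_cst_prob.
  have thrq : th ^+ q <= th ^+ r.
    by apply: ler_wiXn2l => //; [exact: ltW|rewrite /th; lra].
  (* 10 th ^ (j + 1) = 90 (th ^ j - th ^ (j + 1)) makes the sum telescope; with 10 th ^ q for the
     last cell, the total is at most 100 th ^ r. *)
  have e1 : \sum_j \int[P]_w f j w <= 90 * (th ^+ r - th ^+ q).
    apply: le_trans (_ : \sum_(j < q - r) 10 * th ^+ (j + r).+1 <= _).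
      by apply: ler_sum => j _; exact: (C _ (jE j)).2.
    have := @telescope_sumr R r q (fun j => - th ^+ j) rq.
    rewrite -{1}[r]add0n big_addn big_mkord opprK addrC => <-.
    rewrite mulr_sumr; apply: ler_sum => j _; rewrite opprK addrC exprS.
    set z := th ^+ (j + r); have -> : th * z = 9 / 10 * z by [].
    by lra.
  have sq : s / (2 ^ q)%:R <= 2 / s.
    rewrite ler_pdivrMr ?pow2_gt0// mulrAC ler_pdivlMr//.
    rewrite -expr2 sqr_sqrtr// -natrM ler_nat -expnS.
    exact: ltnW.
  have q0 : 0 <= th ^+ q by rewrite exprn_ge0// ltW.
  rewrite -/th -/s; lra.
Qed.

End simplex_path_moments.

Lemma power_sumZ (R : realType) (z : R) (s : seq R) j :
  power_sum [seq z * c | c <- s] j = z ^+ j * power_sum s j.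
Proof.
by rewrite /power_sum big_map mulr_sumr; apply: eq_bigr => c _; rewrite exprMn.
Qed.

Lemma cvg_sqrt_harmonic (R : realType) :
  (Num.sqrt m.+1%:R)^-1 @[m --> \oo] --> (0 : R).
Proof.
rewrite -(sqrtr0 R).
rewrite (_ : (fun m => _) = (fun m => Num.sqrt (m.+1%:R^-1 : R))); last first.
  by apply/funext => m; rewrite sqrtrV.
apply: (@cvg_comp _ _ _ (fun m : nat => (m.+1%:R^-1 : R)) Num.sqrt _ (nbhs (0 : R))).
  exact: cvg_harmonic.
exact: (@sqrt_continuous R 0).
Qed.

(** * Limits of the moments of finite-dimensional forms *)

Section path_moment_convergence.
Context {R : realType} (d : nat -> measure_display) (T : forall m, measurableType (d m))
  (P : forall m, probability (T m) R).
Variables (X : forall m, {RV (P m) >-> m.+1.-tuple R}) (X' : forall m, T m -> m.+1.-tuple R).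
Hypothesis X_uniform : forall m A, measurable A -> distribution (P m) (X m) A = uniform_simplex A.
Hypothesis X'X : forall m w, simplex (X m w) -> X' w = X m w.
Hypothesis X'_simplex : forall m (w : T m), simplex (X' w).
Hypothesis mX' : forall m, measurable_fun setT (@X' m).

Variables (N : nat) (t : 'I_N -> R).
Hypothesis t01 : forall j, 0 <= t j <= 1.

Let b (a : 'I_N -> R) m i := \sum_j a j * (clamp (m.+1%:R * t j - i%:R) - t j).

Let path_formE a m (w : T m) : linear_form a (fun j => scaled_path (X' w) (t j)) =
  Num.sqrt m.+1%:R * \sum_(i < m.+1) b a m i * tnth (X' w) i.
Proof.
rewrite /linear_form.
under eq_bigr => j _.
  have /andP[tj0 _] := t01 j.
  rewrite scaled_pathE// mulr_sumr.
  over.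
rewrite exchange_big mulr_sumr; apply: eq_bigr => i _ /=.
rewrite /b mulr_suml mulr_sumr; apply: eq_bigr => j _.
by ring.
Qed.

Lemma integrable_path_form a m k : (P m).-integrable setT
  (fun w => (linear_form a (fun j => scaled_path (X' w) (t j)) ^+ k)%:E).
Proof.
under eq_fun do rewrite path_formE.
exact: (weighted_moment (@X_uniform m) (@X'X m) (@X'_simplex m) (@mX' m) (b a m) k).1.
Qed.

Let nt01 m j : 0 <= m.+1%:R * t j <= m.+1%:R.
Proof. by have /andP[h1 h2] := t01 j; rewrite mulr_ge0//= ler_piMr. Qed.

Let cvg_sum_clamp_mul j l :
  (\sum_(i < m.+1) clamp (m.+1%:R * t j - i%:R) * clamp (m.+1%:R * t l - i%:R)) / m.+1%:R
    @[m --> \oo] --> Num.min (t j) (t l).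
Proof.
have le1 m : `|\sum_(i < m.+1) clamp (m.+1%:R * t j - i%:R) * clamp (m.+1%:R * t l - i%:R) -
    m.+1%:R * Num.min (t j) (t l)| <= 1.
  have /andP[h1 h2] := t01 j; have /andP[h3 h4] := t01 l.
  have [jl|lj] := leP (t j) (t l).
    by apply: sum_clamp_mul; rewrite ?h1.
  under eq_bigr do rewrite mulrC.
  by apply: sum_clamp_mul => //; rewrite h3 ltW.
apply/cvgrPdist_le => e e0; near=> m.
rewrite distrC -[Num.min _ _](mulfK (x := m.+1%:R)) ?pnatr_eq0// -mulrBl normrM.
rewrite [Num.min _ _ * _]mulrC [`|_^-1|]ger0_norm ?invr_ge0//.
apply: le_trans (ler_wpM2r _ (le1 m)) _; first by rewrite invr_ge0.
by near: m; exact: near_div_le.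
Unshelve. all: by end_near. Qed.

Lemma cvg_path_moment a k :
  \int[P m]_w (linear_form a (fun j => scaled_path (X' w) (t j)) ^+ k) @[m --> \oo] -->
  k`!%:R * gauss_coef (\sum_j \sum_l a j * a l * (Num.min (t j) (t l) - t j * t l)) k.
Proof.
pose s m : R := Num.sqrt m.+1%:R.
have s0 m : 0 < s m by rewrite sqrtr_gt0.
(* Dividing the coefficients by sqrt n makes the sum of their squares converge, and turns the factor
   (sqrt n) ^ k into the n ^ k of [cvg_factorial_ratio]. *)
pose dd m := [seq (s m)^-1 * c | c <- mkseq (b a m) m.+1].
have E m : \int[P m]_w (linear_form a (fun j => scaled_path (X' w) (t j)) ^+ k) =
    k`!%:R * (m.+1%:R ^+ k * m`!%:R / (m + k)`!%:R) * hsym (dd m) k.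
  under eq_Rintegral do rewrite path_formE.
  rewrite (weighted_moment (@X_uniform m) (@X'X m) (@X'_simplex m) (@mX' m) (b a m) k).2.
  rewrite /dd hsymZ -/(s m).
  have sm : m.+1%:R ^+ k = s m ^+ k * s m ^+ k by rewrite -exprMn -expr2 sqr_sqrtr.
  rewrite sm exprVn; have sk : s m ^+ k != 0 by rewrite expf_neq0// gt_eqF.
  have f0 : (m + k)`!%:R != 0 :> R by rewrite pnatr_eq0 -lt0n fact_gt0.
  move: sk f0; set z := s m ^+ k; set y := (m + k)`!%:R; move: z y => z y z0 y0.
  by field; rewrite z0 y0.
rewrite (_ : (fun m => _) = (fun m => k`!%:R * (m.+1%:R ^+ k * m`!%:R / (m + k)`!%:R) * hsym (dd m) k));
  last by apply/funext => m; exact: E.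
have bsum m : \sum_(i < m.+1) b a m i = 0.
  rewrite exchange_big/= big1// => j _.
  rewrite -mulr_sumr sumrB sum_clamp// sumr_const card_ord -[t j *+ m.+1]mulr_natl.
  by rewrite subrr mulr0.
have b2sum m : \sum_(i < m.+1) b a m i ^+ 2 = \sum_j \sum_l a j * a l *
    (\sum_(i < m.+1) clamp (m.+1%:R * t j - i%:R) * clamp (m.+1%:R * t l - i%:R)
     - m.+1%:R * (t j * t l)).
  transitivity (\sum_(i < m.+1) \sum_j \sum_l a j * a l *
    ((clamp (m.+1%:R * t j - i%:R) - t j) * (clamp (m.+1%:R * t l - i%:R) - t l))).
    apply: eq_bigr => i _; rewrite expr2 {1}/b mulr_suml; apply: eq_bigr => j _.
    rewrite /b mulr_sumr; apply: eq_bigr => l _; ring.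
  rewrite exchange_big; apply: eq_bigr => j _.
  rewrite exchange_big; apply: eq_bigr => l _.
  rewrite -mulr_sumr; congr (_ * _).
  under eq_bigr => i _ do rewrite mulrBl !mulrBr.
  rewrite sumrB sumrB sumrB -!mulr_suml -!mulr_sumr !sum_clamp//.
  rewrite sumr_const card_ord -[t j *+ m.+1]mulr_natl.
  by ring.
set v := \sum_j _; rewrite -[X in X * gauss_coef v k]mulr1.
apply: cvgM; first by apply: cvgM; [exact: cvg_cst|exact: cvg_factorial_ratio].
(* Uniform smallness: |clamp - t| <= 1 bounds each coefficient by the sum of |a j| divided by sqrt
   n. *)
apply: (@cvg_hsym _ dd (fun m => (s m)^-1 * \sum_j `|a j|)).
- by move=> m; rewrite power_sumZ power_sum_mkseq; under eq_bigr do rewrite expr1; rewrite bsum mulr0.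
- rewrite (_ : (fun m => _) = (fun m => \sum_j \sum_l a j * a l *
    ((\sum_(i < m.+1) clamp (m.+1%:R * t j - i%:R) * clamp (m.+1%:R * t l - i%:R)) / m.+1%:R
     - t j * t l))).
    apply: cvg_sumr => j; apply: cvg_sumr => l; apply: cvgM; first exact: cvg_cst.
    by apply: cvgB; [exact: cvg_sum_clamp_mul|exact: cvg_cst].
  apply/funext => m; rewrite power_sumZ power_sum_mkseq b2sum exprVn sqr_sqrtr//.
  rewrite mulr_sumr; apply: eq_bigr => j _; rewrite mulr_sumr; apply: eq_bigr => l _.
  set S := \sum_(i < _) _; have n0 : m.+1%:R != 0 :> R by rewrite pnatr_eq0.
  by move: n0; set n := m.+1%:R; move: S n => S n n0; field.
- move=> m c /mapP[_ /mapP[i _ ->] ->].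
  rewrite normrM gtr0_norm ?invr_gt0//; apply: ler_wpM2l; first by rewrite invr_ge0 ltW.
  apply: le_trans (ler_norm_sum _ _ _) _; apply: ler_sum => j _.
  rewrite normrM ler_piMr// ler_norml.
  have := clamp_ge0 (m.+1%:R * t j - i%:R); have := clamp_le1 (m.+1%:R * t j - i%:R).
  have /andP[? ?] := t01 j => ? ?; apply/andP; split; lra.
- rewrite -[X in _ --> X](mul0r (\sum_j `|a j|)).
  by apply: cvgM; [exact: cvg_sqrt_harmonic|exact: cvg_cst].
Qed.

End path_moment_convergence.

(** * Lipschitz functionals and weak convergence *)

Section continuous_paths_theory.
Context {R : realType}.
Implicit Types (x y : R -> R) (t e : R).

Definition bounded01 x := exists C : R, forall t, 0 <= t <= 1 -> `|x t| <= C.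

Lemma continuous_C01P x : C01 x -> forall t, 0 <= t <= 1 -> forall e, 0 < e ->
  exists2 dl, 0 < dl & forall s, 0 <= s <= 1 -> `|s - t| <= dl -> `|x s - x t| <= e.
Proof.
move=> /subspace_continuousP xc t t01 e e0.
have tI : `[0, 1]%classic t by rewrite /= in_itv.
have /cvgrPdist_le/(_ _ e0) := xc t tI.
rewrite near_withinE => /nbhs_ballP[dl/= dl0 H].
exists (dl / 2) => [|s s01 st]; first by rewrite divr_gt0.
rewrite distrC; apply: H; last by rewrite /= in_itv.
rewrite /ball/= distrC (le_lt_trans st)// ltr_pdivrMr// ltr_pMr// ltr1n.
by [].
Qed.

Lemma C01_bounded x : C01 x -> bounded01 x.
Proof.
move=> xc.
have [c1 _ M1] := EVT_max (@ler01 R) xc.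
have [c2 _ M2] := EVT_min (@ler01 R) xc.
exists (`|x c1| + `|x c2|) => t t01.
have t01' : t \in `[0, 1] by rewrite in_itv.
have := M1 t t01'; have := M2 t t01'.
have := ler_norm (x c1); have := ler_norm (- x c2); rewrite normrN.
have := normr_ge0 (x c1); have := normr_ge0 (x c2).
by rewrite ler_norml => *; apply/andP; split; lra.
Qed.

Lemma bounded01B x y : bounded01 x -> bounded01 y -> bounded01 (fun t => x t - y t).
Proof.
move=> [C xC] [D yD]; exists (C + D) => t t01.
by rewrite (le_trans (ler_normB _ _))// lerD ?xC ?yD.
Qed.

Lemma sup_norm01_le x e : (forall t, 0 <= t <= 1 -> `|x t| <= e) -> sup_norm01 x <= e.
Proof.
move=> xe; apply: ge_sup; first by exists `|x 0|; exists 0 => //=; rewrite in_itv/= lexx ler01.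
by move=> _ [t /= t01 <-]; apply: xe; rewrite in_itv in t01.
Qed.

Lemma norm_le_sup_norm01 x t : bounded01 x -> 0 <= t <= 1 -> `|x t| <= sup_norm01 x.
Proof.
move=> [C xC] t01; apply: ub_le_sup; last by exists t => //=; rewrite in_itv.
by exists C => _ [s /= s01 <-]; apply: xC; rewrite in_itv in s01.
Qed.

Lemma sup_norm01_ge0 x : 0 <= sup_norm01 x.
Proof.
have x0 : [set `|x t| | t in `[0, 1]] `|x 0|.
  by exists 0 => //=; rewrite in_itv/= lexx ler01.
have [[] |h] := pselect (has_sup [set `|x t| | t in `[0, 1]]).
  by move=> _ hs; apply: le_trans (ub_le_sup hs x0).
(* For an unbounded [x] the supremum takes its default value 0. *)
by rewrite /sup_norm01 sup_out.
Qed.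

Definition step_path r x : R -> R := fun t => x (dyadic_floor r t).

Lemma step_path_bounded r x : bounded01 x -> bounded01 (step_path r x).
Proof. by move=> [C xC]; exists C => t t01; apply/xC/dyadic_floor_itv. Qed.

Lemma near_pow2_le e : 0 < e -> \forall r \near \oo, (2 ^ r)%:R^-1 <= e.
Proof.
move=> e0; near=> r.
have h : 1 / r.+1%:R <= e by near: r; exact: near_div_le.
apply: le_trans h; rewrite div1r lef_pV2 ?posrE ?pow2_gt0// ler_nat.
exact: ltn_expl.
Unshelve. all: by end_near. Qed.

(** The estimate holds jointly for [t'] near [t] and large [r], since the floor of [t'] is within 2
    ^ -r of it; compactness of [0, 1] makes it uniform. *)
Lemma cvg_step_path x e : C01 x -> 0 < e ->
  \forall r \near \oo, forall t, 0 <= t <= 1 -> `|x t - step_path r x t| <= e.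
Proof.
move=> xc e0.
have /compact_near_coveringP := @segment_compact R 0 1.
move=> /(_ nat \oo (fun r t => 0 <= t <= 1 -> `|x t - step_path r x t| <= e) _) H.
suff /H h : forall t : R, `[0, 1]%classic t -> \forall t' \near t & r \near \oo,
    0 <= t' <= 1 -> `|x t' - step_path r x t'| <= e.
  apply: filterS h => r h t t01; exact: h.
move=> t t01'; have {t01'} t01 : 0 <= t <= 1 by move: t01'; rewrite /= ?in_itv.
have e2 : 0 < e / 2 by rewrite divr_gt0.
have [dl dl0 xd] := continuous_C01P xc t01 e2.
have dl2 : 0 < dl / 2 by rewrite divr_gt0.
near=> t' r => /=.
have h1 : `|t - t'| <= dl / 2.
  by near: t'; apply: cvgr_dist_le dl2; exact: cvg_id.
have h2 : (2 ^ r)%:R^-1 <= dl / 2 by near: r; exact: near_pow2_le.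
move=> t'01.
have k1 : `|x t' - x t| <= e / 2.
  by apply: xd => //; rewrite distrC (le_trans h1)// ler_pdivrMr// ler_peMr ?ler1n// ltW.
have k2 : `|x (dyadic_floor r t') - x t| <= e / 2.
  apply: xd; first exact: dyadic_floor_itv.
  have /andP[t'0 _] := t'01; have /andP[f1 f2] := dyadic_floor_le r t'0.
  by move: h1 h2; rewrite !ler_norml => /andP[? ?] ?; apply/andP; split; lra.
rewrite /step_path; move: k1 k2; rewrite !ler_norml => /andP[? ?] /andP[? ?].
by apply/andP; split; lra.
Unshelve. all: by end_near. Qed.

End continuous_paths_theory.

Section lipschitz_functional.
Context {R : realType}.
Implicit Types (x y : R -> R) (t e K : R) (Phi : (R -> R) -> R).

Definition lipschitz01 K Phi := forall x y e, bounded01 x -> bounded01 y ->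
  (forall t, 0 <= t <= 1 -> `|x t - y t| <= e) -> `|Phi x - Phi y| <= K * e.

(** There are 2 ^ r + 1 values, because the floor of t = 1 has index 2 ^ r. *)
Definition step_of_values r (v : 'I_(2 ^ r).+1 -> R) : R -> R :=
  fun t => v (inord (Num.truncn ((2 ^ r)%:R * t))).

Lemma step_of_values_bounded r (v : 'I_(2 ^ r).+1 -> R) : bounded01 (step_of_values v).
Proof.
exists (\sum_j `|v j|) => t _; rewrite /step_of_values.
by rewrite (bigD1 (inord (Num.truncn ((2 ^ r)%:R * t))))//= lerDl sumr_ge0.
Qed.

Lemma lipschitz01_step_of_values K Phi r (v u : 'I_(2 ^ r).+1 -> R) : lipschitz01 K Phi ->
  `|Phi (step_of_values v) - Phi (step_of_values u)| <= K * \sum_j `|v j - u j|.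
Proof.
move=> lip; apply: lip; [exact: step_of_values_bounded..|] => t _.
rewrite /step_of_values; set j := inord _.
by rewrite (bigD1 j)//= lerDl sumr_ge0.
Qed.

Lemma step_of_values_path K Phi r x : lipschitz01 K Phi -> bounded01 x ->
  Phi (step_path r x) = Phi (step_of_values (fun j : 'I_(2 ^ r).+1 => x (dyadic r j))).
Proof.
move=> lip xb; apply/eqP; rewrite -subr_eq0 -normr_le0 -(mulr0 K).
apply: lip; [exact: step_path_bounded|exact: step_of_values_bounded|] => t t01.
rewrite /step_path /step_of_values /dyadic_floor inordK ?subrr ?normr0//.
by rewrite ltnS truncn_pow2_le.
Qed.

Lemma cvg_lipschitz01_step K Phi x : lipschitz01 K Phi -> C01 x ->
  Phi (step_path r x) @[r --> \oo] --> Phi x.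
Proof.
move=> lip xc; have xb := C01_bounded xc.
apply/cvgrPdist_le => e e0.
have k0 : 0 < `|K| + 1 by rewrite ltr_wpDl.
near=> r.
have h : forall t, 0 <= t <= 1 -> `|x t - step_path r x t| <= e / (`|K| + 1).
  by near: r; apply: cvg_step_path => //; exact: divr_gt0.
apply: le_trans (lip _ _ _ xb (step_path_bounded r xb) h) _.
rewrite mulrCA ger_pMr// ler_pdivrMr// mul1r (le_trans (ler_norm _))// lerDl.
by [].
Unshelve. all: by end_near. Qed.

End lipschitz_functional.

(** * Lipschitz minorants of a bounded continuous functional *)

Section regularization.
Context {R : realType} (F : {uniform` `[0 : R, 1]%classic -> R} -> R) (M : R).
Hypothesis F_cont : {within C01, continuous F}.
Hypothesis F_bound : forall f, C01 f -> `|F f| <= M.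
Implicit Types (x y : R -> R) (t e : R) (k : nat).

Let candidates k x : set R :=
  [set Num.min M (F y + k%:R * sup_norm01 (fun t => x t - y t)) | y in (C01 : set (R -> R))].

(* The infimum is over continuous paths only, but the regularization is evaluated
   at step paths too. *)
Definition regularization k x : R := inf (candidates k x).

Let C01_cst0 : @C01 R (fun=> 0).
Proof. by apply: continuous_subspaceT => t; exact: cvg_cst. Qed.

Let M0 : 0 <= M.
Proof. by apply: le_trans (F_bound C01_cst0); exact: normr_ge0. Qed.

Let candidate_ge k x y : C01 y ->
  - M <= Num.min M (F y + k%:R * sup_norm01 (fun t => x t - y t)).
Proof.
move=> yc; rewrite le_min ge0_cp// /=.
have := F_bound yc; rewrite ler_norml => /andP[h _].
by rewrite (le_trans h)// lerDl mulr_ge0// sup_norm01_ge0.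
Qed.

Let candidates_lb k x : has_lbound (candidates k x).
Proof. by exists (- M) => _ [y yc <-]; exact: candidate_ge. Qed.

Let candidates_neq0 k x : candidates k x !=set0.
Proof. by eexists; exists (fun=> 0). Qed.

Lemma regularization_bound k x : `|regularization k x| <= M.
Proof.
rewrite ler_norml; apply/andP; split.
  by apply: lb_le_inf => // _ [y yc <-]; exact: candidate_ge.
apply: le_trans (ge_inf (candidates_lb k x) _) _; first by exists (fun=> 0).
by rewrite ge_min lexx.
Qed.

Lemma regularization_le k x : C01 x -> regularization k x <= F x.
Proof.
move=> xc; apply: le_trans (ge_inf (candidates_lb k x) _) _; first by exists x.
rewrite ge_min; apply/orP; right.
rewrite gerDl mulr_ge0_le0// sup_norm01_le// => t _.
by rewrite subrr normr0.
Qed.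

Lemma regularization_lipschitz k : lipschitz01 k%:R (regularization k).
Proof.
suff H x y e : bounded01 x -> bounded01 y ->
    (forall t, 0 <= t <= 1 -> `|x t - y t| <= e) ->
    regularization k x <= regularization k y + k%:R * e.
  move=> x y e xb yb xy; rewrite ler_distlC lerBlDr H//= H// => t t01.
  by rewrite distrC xy.
move=> xb yb xy; rewrite -lerBlDr; apply: lb_le_inf => // _ [z zc <-].
rewrite lerBlDr; apply: le_trans (ge_inf (candidates_lb k x) _) _; first by exists z.
have zb := C01_bounded zc.
have e0 : 0 <= e by apply: le_trans (xy 0 _); rewrite ?lexx ?ler01.
have xz : sup_norm01 (fun t => x t - z t) <= sup_norm01 (fun t => y t - z t) + e.
  apply: sup_norm01_le => t t01.
  have -> : x t - z t = (y t - z t) + (x t - y t) by ring.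
  rewrite (le_trans (ler_normD _ _))// lerD ?xy//.
  exact: (@norm_le_sup_norm01 _ (fun t => y t - z t)) (bounded01B yb zb) t01.
have ke : 0 <= k%:R * e by rewrite mulr_ge0.
have {}xz := ler_wpM2l (ler0n R k) xz; rewrite mulrDr in xz.
rewrite -lerBlDr le_min; apply/andP; split; rewrite lerBlDr ge_min.
  by rewrite lerDl ke.
by apply/orP; right; rewrite -addrA lerD2l.
Qed.

Lemma cvg_regularization x : C01 x -> regularization k x @[k --> \oo] --> F x.
Proof.
move=> xc; apply/cvgrPdist_le => e e0.
have [dl dl0 Fd] : exists2 dl : R, 0 < dl & forall y, C01 y ->
    (forall t, 0 <= t <= 1 -> `|x t - y t| < dl) -> `|F x - F y| <= e.
  move/subspace_continuousP : F_cont => /(_ x xc)/cvgrPdist_le/(_ _ e0).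
  rewrite near_withinE => /uniform_nbhs[E [/= [dl dl0 dE] H]].
  exists dl => // y yc xy; apply: H => // t; rewrite /= in_itv/= => t01.
  by apply: dE => /=; apply: xy.
near=> k.
(* Paths closer than [dl] to [x] have values of [F] close to [F x]; for the others the penalty, at
   least 2 M, outweighs any possible gap between values of [F]. *)
have kd : 2 * M <= k%:R * dl.
  by rewrite -ler_pdivrMr//; near: k; exact: nbhs_infty_ger.
rewrite ger0_norm ?subr_ge0 ?regularization_le// lerBlDr -lerBlDl.
apply: lb_le_inf => // _ [y yc <-].
have := F_bound xc; rewrite ler_norml => /andP[h1 h2].
have := F_bound yc; rewrite ler_norml => /andP[h3 h4].
rewrite le_min; apply/andP; split; first by rewrite lerBlDr (le_trans h2)// lerDl ltW.
have yb := bounded01B (C01_bounded xc) (C01_bounded yc).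
have [small|big] := ltP (sup_norm01 (fun t => x t - y t)) dl.
  have : `|F x - F y| <= e.
    apply: Fd => // t t01; apply: le_lt_trans small.
    exact: (@norm_le_sup_norm01 _ (fun t => x t - y t)).
  rewrite ler_norml => /andP[_ h].
  have : 0 <= k%:R * sup_norm01 (fun t => x t - y t) by rewrite mulr_ge0// sup_norm01_ge0.
  lra.
have := ler_wpM2l (ler0n R k) big; lra.
Unshelve. all: by end_near. Qed.

End regularization.

Lemma sup_norm01_lipschitz (R : realType) : lipschitz01 1 (@sup_norm01 R).
Proof.
move=> x y e xb yb xy; rewrite mul1r.
have H (u v : R -> R) : bounded01 v -> (forall t, 0 <= t <= 1 -> `|u t - v t| <= e) ->
    sup_norm01 u <= sup_norm01 v + e.
  move=> vb uv; apply: sup_norm01_le => t t01.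
  rewrite -[u t](subrK (v t)) addrC (le_trans (ler_normD _ _))// lerD ?uv//.
  exact: norm_le_sup_norm01.
rewrite ler_distlC lerBlDr !H// => t t01.
by rewrite distrC xy.
Qed.

Lemma bounded_convergence (R : realType) d (S : measurableType d) (Q : probability S R)
    (f : nat -> S -> R) (g : S -> R) (C : R) :
  (forall n, measurable_fun setT (f n)) -> (forall n w, `|f n w| <= C) ->
  (forall w, f n w @[n --> \oo] --> g w) ->
  \int[Q]_w f n w @[n --> \oo] --> \int[Q]_w g w.
Proof.
move=> mf fC fg.
have mg : measurable_fun setT g by apply: (measurable_fun_cvg mf) => w _; exact: fg.
have Ci : Q.-integrable setT (cst C%:E).
  by apply: (@bounded_RV_integrable _ _ _ _ (cst C) `|C|).
have mfE n : measurable_fun setT (fun w => (f n w)%:E) by exact/measurable_EFinP.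
have mgE : measurable_fun setT (fun w => (g w)%:E) by exact/measurable_EFinP.
have ae1 : {ae Q, forall w, [set: S] w -> (f n w)%:E @[n --> \oo] --> (g w)%:E}.
  by apply: aeW => w _; apply: cvg_EFin; [near=> n|exact: fg].
have ae2 : {ae Q, forall w n, [set: S] w -> (`|(f n w)%:E| <= cst C%:E w)%E}.
  by apply: aeW => w n _; rewrite lee_fin.
have [gi _ cE] := @dominated_convergence _ S R Q setT measurableT _ _ _ mfE mgE ae1 Ci ae2.
have gfin : (\int[Q]_w (g w)%:E)%E \is a fin_num by exact: integrable_fin_num.
by rewrite -(fineK gfin) in cE; exact: (fine_cvg cE).
Unshelve. all: by end_near. Qed.

Section random_path.
Context {R : realType} d (S : measurableType d) (Q : probability S R) (X : S -> R -> R).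
Hypothesis XC : forall w, C01 (X w).
Hypothesis mX : forall t, 0 <= t <= 1 -> measurable_fun setT (fun w => X w t).
Variables (K : R) (Phi : (R -> R) -> R).
Hypothesis K0 : 0 <= K.
Hypothesis Phi_lip : lipschitz01 K Phi.

Lemma measurable_lipschitz01_step r : measurable_fun setT (fun w => Phi (step_path r (X w))).
Proof.
rewrite (_ : (fun w => _) =
    (fun w => Phi (step_of_values (fun j : 'I_(2 ^ r).+1 => X w (dyadic r j))))); last first.
  by apply/funext => w; rewrite (step_of_values_path r Phi_lip (C01_bounded (@XC w))).
apply: (@measurable_lipschitz_comp _ (2 ^ r).+1 _ S Q (fun w (j : 'I_(2 ^ r).+1) => X w (dyadic r j)) _
  (fun v => Phi (step_of_values v)) K K0).
  move=> a; apply: measurable_sum => j; apply: measurable_funM => //.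
  by apply: mX; apply: dyadic_itv; rewrite -ltnS.
by move=> v u; exact: lipschitz01_step_of_values.
Qed.

Lemma measurable_lipschitz01 : measurable_fun setT (fun w => Phi (X w)).
Proof.
apply: (measurable_fun_cvg measurable_lipschitz01_step) => w _.
exact: (@cvg_lipschitz01_step _ _ _ _ Phi_lip (@XC w)).
Qed.

Lemma cvg_expectation_step M : (forall x, `|Phi x| <= M) ->
  \int[Q]_w Phi (step_path r (X w)) @[r --> \oo] --> \int[Q]_w Phi (X w).
Proof.
move=> PhiM; apply: (@bounded_convergence _ _ _ _ _ _ M) => [|r w|].
- exact: measurable_lipschitz01_step.
- exact: PhiM.
by move=> w; exact: (@cvg_lipschitz01_step _ _ _ _ Phi_lip (@XC w)).
Qed.

End random_path.

Section random_path_functional.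
Context {R : realType} d (S : measurableType d) (Q : probability S R) (X : S -> R -> R).
Hypothesis XC : forall w, C01 (X w).
Hypothesis mX : forall t, 0 <= t <= 1 -> measurable_fun setT (fun w => X w t).
Variables (F : {uniform` `[0 : R, 1]%classic -> R} -> R) (M : R).
Hypothesis F_cont : {within C01, continuous F}.
Hypothesis F_bound : forall f, C01 f -> `|F f| <= M.

Lemma measurable_regularization k : measurable_fun setT (fun w => regularization F M k (X w)).
Proof.
apply: (@measurable_lipschitz01 _ _ _ Q _ XC mX k%:R) => //.
exact: regularization_lipschitz.
Qed.

Lemma measurable_continuous_functional : measurable_fun setT (fun w => F (X w)).
Proof.
apply: (measurable_fun_cvg measurable_regularization) => w _.
exact: (@cvg_regularization _ _ _ F_cont F_bound _ (@XC w)).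
Qed.

Lemma cvg_expectation_regularization :
  \int[Q]_w regularization F M k (X w) @[k --> \oo] --> \int[Q]_w F (X w).
Proof.
apply: (@bounded_convergence _ _ _ _ _ _ M) => [k|k w|w].
- exact: measurable_regularization.
- exact: regularization_bound.
- exact: (@cvg_regularization _ _ _ F_cont F_bound _ (@XC w)).
Qed.

End random_path_functional.

(** * Weak convergence from finite-dimensional limits and oscillation bounds *)

Section weak_convergence.
Context {R : realType} (d : nat -> measure_display) (T : forall n, measurableType (d n))
  (P : forall n, probability (T n) R) (X : forall n, T n -> R -> R).
Context d' (T' : measurableType d') (P' : probability T' R) (B : T' -> R -> R).
Hypothesis XC : forall n (w : T n), C01 (X w).
Hypothesis mX : forall n t, 0 <= t <= 1 -> measurable_fun setT (fun w : T n => X w t).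
Hypothesis BC : forall w, C01 (B w).
Hypothesis mB : forall t, 0 <= t <= 1 -> measurable_fun setT (fun w => B w t).

Hypothesis fdd : forall N (t : 'I_N -> R), (forall j, 0 <= t j <= 1) ->
  forall (G : ('I_N -> R) -> R) (K : R), 0 <= K ->
  (forall v u, `|G v - G u| <= K * \sum_i `|v i - u i|) ->
  \int[P n]_w G (fun j => X w (t j)) @[n --> \oo] --> \int[P']_w G (fun j => B w (t j)).

Hypothesis oscillation : forall e, 0 < e -> \forall r \near \oo, \forall n \near \oo,
  exists K : T n -> R, [/\ (P n).-integrable setT (fun w => (K w)%:E),
    forall w t, 0 <= t <= 1 -> `|X w t - step_path r (X w) t| <= K w &
    \int[P n]_w K w <= e].

Lemma cvg_expectation_lipschitz01 (K M : R) Phi : 0 <= K -> lipschitz01 K Phi ->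
  (forall x, `|Phi x| <= M) ->
  \int[P n]_w Phi (X w) @[n --> \oo] --> \int[P']_w Phi (B w).
Proof.
move=> K0 lip PhiM; apply/cvgrPdist_le => e e0.
have e3 : 0 < e / 3 by rewrite divr_gt0.
(* K + 1 rather than K, which may be 0. *)
have eK : 0 < e / 3 / (K + 1) by rewrite divr_gt0// ltr_wpDl.
have /cvgrPdist_le/(_ _ e3) hB := @cvg_expectation_step _ _ _ P' _ (@BC) mB _ _ K0 lip M PhiM.
have [r [hr hosc]] : exists r : nat,
    `|\int[P']_w Phi (B w) - \int[P']_w Phi (step_path r (B w))| <= e / 3 /\
    \forall n \near \oo, exists K' : T n -> R,
      [/\ (P n).-integrable setT (fun w => (K' w)%:E),
      forall w t, 0 <= t <= 1 -> `|X w t - step_path r (X w) t| <= K' w &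
      \int[P n]_w K' w <= e / 3 / (K + 1)].
  near \oo => r; exists r; split; near: r; first exact: hB.
  exact: oscillation.
have hf := @fdd _ (fun j : 'I_(2 ^ r).+1 => dyadic r j) _ (fun v => Phi (step_of_values v)) K K0
  (fun v u => lipschitz01_step_of_values v u lip).
have {hf} hf : \int[P n]_w Phi (step_path r (X w)) @[n --> \oo] -->
    \int[P']_w Phi (step_path r (B w)).
  under [X in _ --> X]eq_Rintegral do rewrite (step_of_values_path r lip (C01_bounded (@BC _))).
  rewrite (_ : (fun n => _) = (fun n => \int[P n]_w
      Phi (step_of_values (fun j : 'I_(2 ^ r).+1 => X w (dyadic r j))))); last first.
    by apply/funext => n; apply: eq_Rintegral => w _;
      rewrite (step_of_values_path r lip (C01_bounded (@XC n w))).
  by apply: hf => j; apply: dyadic_itv; rewrite -ltnS.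
near=> n.
have h1 : `|\int[P']_w Phi (step_path r (B w)) - \int[P n]_w Phi (step_path r (X w))| <= e / 3.
  by near: n; exact: cvgr_dist_le hf _ e3.
have [K' [iK' K'b K'l]] : exists K' : T n -> R,
    [/\ (P n).-integrable setT (fun w => (K' w)%:E),
    forall w t, 0 <= t <= 1 -> `|X w t - step_path r (X w) t| <= K' w &
    \int[P n]_w K' w <= e / 3 / (K + 1)] by near: n.
have i1 : (P n).-integrable setT (fun w => (Phi (X w))%:E).
  apply: (@bounded_RV_integrable _ _ _ _ (fun w => Phi (X w)) M) => //.
  exact: (@measurable_lipschitz01 _ _ _ (P n) _ (@XC n) (@mX n) _ _ K0 lip).
have i2 : (P n).-integrable setT (fun w => (Phi (step_path r (X w)))%:E).
  apply: (@bounded_RV_integrable _ _ _ _ (fun w => Phi (step_path r (X w))) M) => //.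
  exact: (@measurable_lipschitz01_step _ _ _ (P n) _ (@XC n) (@mX n) _ _ K0 lip).
have h2 : `|\int[P n]_w Phi (X w) - \int[P n]_w Phi (step_path r (X w))| <= e / 3.
  have i12 : (P n).-integrable setT (fun w => (Phi (X w) - Phi (step_path r (X w)))%:E).
    by have := integrableB measurableT i1 i2.
  rewrite -RintegralB//; apply: le_trans (le_normr_Rintegral _ i12) _ => //.
  apply: le_trans (_ : \int[P n]_w (K * K' w) <= _).
    apply: le_Rintegral => //.
    - exact: integrable_norm.
    - by have := integrableZl measurableT K iK'.
    - move=> w _; apply: lip => [||t t01]; last exact: K'b.
        exact: C01_bounded.
      exact/step_path_bounded/C01_bounded.
  rewrite RintegralZl//; apply: le_trans (ler_wpM2l K0 K'l) _.
  rewrite mulrCA ger_pMr// ler_pdivrMr ?ltr_wpDl// mul1r lerDl.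
  by [].
move: h1 h2 hr; rewrite !ler_norml => /andP[? ?] /andP[? ?] /andP[? ?].
by apply/andP; split; lra.
Unshelve. all: by end_near. Qed.

Section functional.
Variables (F : {uniform` `[0 : R, 1]%classic -> R} -> R) (M : R).
Hypothesis F_cont : {within C01, continuous F}.
Hypothesis F_bound : forall f, C01 f -> `|F f| <= M.

Lemma liminf_expectation e : 0 < e ->
  \forall n \near \oo, \int[P']_w F (B w) - e <= \int[P n]_w F (X w).
Proof.
move=> e0; have e2 : 0 < e / 2 by rewrite divr_gt0.
(* [k] is chosen under the limit law alone; along the sequence only the inequality between the
   regularization and [F] is used, so the choice is independent of [n]. *)
have [k hk] : exists k,
    `|\int[P']_w F (B w) - \int[P']_w regularization F M k (B w)| <= e / 2.
  have /cvgrPdist_le/(_ _ e2) h :=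
    @cvg_expectation_regularization _ _ _ P' _ (@BC) mB _ _ F_cont F_bound.
  by near \oo => k; exists k; near: k.
have hc := cvg_expectation_lipschitz01 (ler0n R k)
  (regularization_lipschitz F_bound k) (regularization_bound F_bound k).
near=> n.
have h1 : `|\int[P']_w regularization F M k (B w) -
    \int[P n]_w regularization F M k (X w)| <= e / 2.
  by near: n; exact: cvgr_dist_le hc _ e2.
have h2 : \int[P n]_w regularization F M k (X w) <= \int[P n]_w F (X w).
  apply: le_Rintegral => //.
  - apply: (@bounded_RV_integrable _ _ _ _ (fun w => regularization F M k (X w)) M).
      exact: (@measurable_regularization _ _ _ (P n) _ (@XC n) (@mX n) _ _ F_bound).
    by move=> w; exact: regularization_bound.
  - apply: (@bounded_RV_integrable _ _ _ _ (fun w => F (X w)) M).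
      exact: (@measurable_continuous_functional _ _ _ (P n) _ (@XC n) (@mX n) _ _ F_cont F_bound).
    by move=> w; exact: F_bound.
  - by move=> w _; exact: regularization_le.
move: h1 hk; rewrite !ler_norml => /andP[? ?] /andP[? ?].
by lra.
Unshelve. all: by end_near. Qed.

End functional.

Lemma weak_convergence (F : {uniform` `[0 : R, 1]%classic -> R} -> R) (M : R) :
  {within C01, continuous F} -> (forall f, C01 f -> `|F f| <= M) ->
  \int[P n]_w F (X w) @[n --> \oo] --> \int[P']_w F (B w).
Proof.
move=> Fc FM; apply/cvgrPdist_le => e e0.
have lo := liminf_expectation Fc FM e0.
have FNc : {within C01, continuous (fun f => - F f)}.
  by move=> f; apply: cvgN; exact: Fc.
have FNM : forall f, C01 f -> `|- F f| <= M by move=> f /FM; rewrite normrN.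
have hi := liminf_expectation FNc FNM e0.
have N dd (S : measurableType dd) (Q : probability S R) (Z : S -> R -> R) :
    (forall w, C01 (Z w)) -> (forall t, 0 <= t <= 1 -> measurable_fun setT (fun w => Z w t)) ->
    \int[Q]_w (- F (Z w)) = - \int[Q]_w F (Z w).
  move=> ZC mZ.
  have iF : Q.-integrable setT (fun w => (F (Z w))%:E).
    apply: (@bounded_RV_integrable _ _ _ _ (fun w => F (Z w)) M).
      exact: (@measurable_continuous_functional _ _ _ Q _ (@ZC) mZ _ _ Fc FM).
    by move=> w; exact: FM.
  under eq_Rintegral do rewrite -mulN1r.
  by rewrite RintegralZl// mulN1r.
near=> n.
have h1 : \int[P']_w F (B w) - e <= \int[P n]_w F (X w) by near: n.
have : \int[P']_w (- F (B w)) - e <= \int[P n]_w (- F (X w)) by near: n.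
rewrite !N// => [h2|t]; last exact: mX.
by rewrite ler_norml; apply/andP; split; lra.
Unshelve. all: by end_near. Qed.

End weak_convergence.

(** * Convergence to the Brownian bridge *)

Lemma gauss_coef2 (R : realType) (v : R) : 2`!%:R * gauss_coef v 2 = v.
Proof. by rewrite -[2%N]/(1.*2) gauss_coef_even expr1 divr1 mulrC divfK. Qed.

Section brownian_bridge_moments.
Context {R : realType} d (T : measurableType d) (P : probability T R) (B : T -> R -> R).
Hypothesis B_bridge : brownian_bridge P B.

Lemma brownian_bridge_C01 w : C01 (B w).
Proof. by have [BC _ _ _ _] := B_bridge; exact: BC. Qed.

Lemma measurable_brownian_bridge t : 0 <= t <= 1 -> measurable_fun setT (fun w => B w t).
Proof. by move=> t01; have [_ mB _ _ _] := B_bridge; apply: mB; rewrite in_itv. Qed.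

Lemma brownian_bridge_mean t : 0 <= t <= 1 -> (\int[P]_w (B w t)%:E = 0)%E.
Proof.
move=> t01; have [_ _ _ E0 _] := B_bridge.
by rewrite -(E0 t) ?in_itv// unlock.
Qed.

Lemma integrable_brownian_bridge t k : 0 <= t <= 1 ->
  P.-integrable setT (fun w => (B w t ^+ k)%:E).
Proof.
move=> t01; have [_ _ BG _ _] := B_bridge.
have := BG 1%N (fun=> 1) (fun=> t) (fun=> _); under eq_fun do rewrite big_ord1 mul1r.
move=> /(_ _)/gaussian_moments[].
- by rewrite in_itv.
- exact: measurable_brownian_bridge.
- exact: brownian_bridge_mean.
- by move=> v _ /(_ k)[].
Qed.

Lemma brownian_bridge_covariance s t : 0 <= s <= 1 -> 0 <= t <= 1 ->
  P.-integrable setT (fun w => (B w s * B w t)%:E) /\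
  \int[P]_w (B w s * B w t) = Num.min s t - s * t.
Proof.
move=> s01 t01; have [_ _ _ E0 cov] := B_bridge.
have sI : s \in `[0, 1] by rewrite in_itv.
have tI : t \in `[0, 1] by rewrite in_itv.
split; last first.
  have := cov s t sI tI; rewrite [in LHS]unlock/= !E0//= unlock => covE.
  rewrite /Rintegral (_ : (\int[P]_w (B w s * B w t)%:E)%E = (Num.min s t - s * t)%:E)//.
  rewrite -covE; apply: eq_integral => w _.
  by change ((B w s * B w t)%:E = ((B w s - 0) * (B w t - 0))%:E); rewrite !subr0.
have i2 : P.-integrable setT (fun w => (B w s ^+ 2 + B w t ^+ 2)%:E).
  under eq_fun do rewrite EFinD.
  by apply: integrableD => //; exact: integrable_brownian_bridge.
apply: (le_integrable measurableT _ _ i2).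
  by apply/measurable_EFinP/measurable_funM; exact: measurable_brownian_bridge.
move=> w _; rewrite /= lee_fin normrM [leRHS]ger0_norm ?addr_ge0 ?sqr_ge0//.
rewrite -(real_normK (num_real (B w s))) -(real_normK (num_real (B w t))).
have := sqr_ge0 (`|B w s| - `|B w t|); have := normr_ge0 (B w s); have := normr_ge0 (B w t).
by set a := `|B w s|; set b := `|B w t|; move: a b => a b a0 b0; nra.
Qed.

Variables (N : nat) (t : 'I_N -> R).
Hypothesis t01 : forall j, 0 <= t j <= 1.

(** The Gaussian law yields all moments in terms of an unknown variance [v]; the second moment,
    expanded with the covariances, identifies it. *)
Lemma brownian_bridge_form_moment a k :
  P.-integrable setT (fun w => (linear_form a (fun j => B w (t j)) ^+ k)%:E) /\
  \int[P]_w (linear_form a (fun j => B w (t j)) ^+ k) =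
  k`!%:R * gauss_coef (\sum_j \sum_l a j * a l * (Num.min (t j) (t l) - t j * t l)) k.
Proof.
have [_ _ BG _ _] := B_bridge.
have Bi j : P.-integrable setT (fun w => (a j * B w (t j))%:E).
  have := integrable_brownian_bridge 1 (t01 j); under eq_fun do rewrite expr1.
  by move=> h; have := integrableZl measurableT (a j) h.
have mean0 : (\int[P]_w (linear_form a (fun j => B w (t j)))%:E = 0)%E.
  under eq_integral do rewrite -sumEFin.
  rewrite (integral_sum measurableT Bi) big1// => j _.
  under eq_integral do rewrite EFinM.
  rewrite integralZl//; last first.
    by have := integrable_brownian_bridge 1 (t01 j); under eq_fun do rewrite expr1.
  by rewrite brownian_bridge_mean// mule0.
have [||v v0 vE] := gaussian_moments (X := fun w => linear_form a (fun j => B w (t j))) _ _ mean0.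
- by apply: BG => j; rewrite in_itv; exact: t01.
- apply: measurable_sum => j; apply: measurable_funM => //.
  exact: measurable_brownian_bridge.
suff <- : v = \sum_j \sum_l a j * a l * (Num.min (t j) (t l) - t j * t l) by exact: vE.
have [_] := vE 2; rewrite gauss_coef2 => <-.
pose f j l w := a j * a l * (B w (t j) * B w (t l)).
have fi j l : P.-integrable setT (fun w => (f j l w)%:E).
  by have := integrableZl measurableT (a j * a l) (brownian_bridge_covariance (t01 j) (t01 l)).1.
have E w : linear_form a (fun j => B w (t j)) ^+ 2 = \sum_j \sum_l f j l w.
  rewrite expr2 /linear_form mulr_suml; apply: eq_bigr => j _.
  by rewrite mulr_sumr; apply: eq_bigr => l _; rewrite /f mulrACA.
under eq_Rintegral do rewrite E.
rewrite (Rintegral_sum _ (fun j => integrable_sum_EFin (index_enum 'I_N) (fi j))).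
apply: eq_bigr => j _; rewrite (Rintegral_sum _ (fi j)); apply: eq_bigr => l _.
have [i12 e12] := brownian_bridge_covariance (t01 j) (t01 l).
by rewrite /f RintegralZl// e12.
Qed.

End brownian_bridge_moments.

(** * A version with all its values in the simplex *)

Section simplex_modification.
Context {R : realType} d (T : measurableType d) (P : probability T R) (m : nat).
Variable X : {RV P >-> m.+1.-tuple R}.
Hypothesis X_uniform : forall A, measurable A -> distribution P X A = uniform_simplex A.

(** The uniform law constrains [X] only almost surely. The fallback value is the vertex (0, ..., 0,
    1). *)
Definition simplex_modification (w : T) : m.+1.-tuple R :=
  if `[< simplex (X w) >] then X w else simplex_chart (nseq_tuple m 0).

Lemma simplex_modificationE w : simplex (X w) -> simplex_modification w = X w.
Proof. by move=> Xs; rewrite /simplex_modification; case: asboolP. Qed.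

Lemma simplex_modification_simplex w : simplex (simplex_modification w).
Proof.
rewrite /simplex_modification; case: asboolP => // _.
apply/simplex_chartP; split => [i|]; first by rewrite tnth_nseq.
by rewrite big1// => i _; rewrite tnth_nseq.
Qed.

Let mXS : measurable (X @^-1` (simplex (n := m.+1))).
Proof. by rewrite -[_ @^-1` _]setTI; apply: measurable_funPT => //; exact: measurable_simplex. Qed.

Lemma measurable_simplex_modification : measurable_fun setT simplex_modification.
Proof.
apply: measurable_fun_ifT; last exact: measurable_cst.
- apply: (measurable_fun_bool true); rewrite setTI.
  rewrite (_ : _ @^-1` _ = X @^-1` (simplex (n := m.+1)))//.
  by apply/seteqP; split => w /=; case: asboolP.
- exact: measurable_funPT.
Qed.

Lemma simplex_modification_null : P (~` (X @^-1` (simplex (n := m.+1)))) = 0%E.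
Proof. by rewrite probability_setC// uniform_simplex_as// subee. Qed.

Lemma simplex_modification_ae : {ae P, forall w, simplex_modification w = X w}.
Proof.
exists (~` (X @^-1` (simplex (n := m.+1)))); split.
- exact: measurableC.
- exact: simplex_modification_null.
- by move=> w /= h Xs; apply: h; exact: simplex_modificationE.
Qed.

End simplex_modification.

Lemma measurable_scaled_path (R : realType) d (T : measurableType d) m
    (X : T -> m.+1.-tuple R) t : measurable_fun setT X -> 0 <= t ->
  measurable_fun setT (fun w => scaled_path (X w) t).
Proof.
move=> mX t0; under eq_fun do rewrite /scaled_path increment_pathE//.
apply: measurable_funM => //; apply: measurable_funB => //.
apply: measurable_sum => i; apply: measurable_funM => //.
exact: (measurableT_comp (measurable_tnth i) mX).
Qed.

Lemma increment_path0 (R : realType) n (x : n.-tuple R) : increment_path x 0 = 0.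
Proof. by rewrite /increment_path mulr0 truncn0 big_ord0 subr0 mul0r addr0. Qed.

Lemma increment_path1 (R : realType) n (x : n.-tuple R) : simplex x -> increment_path x 1 = 1.
Proof.
move=> [_ x1]; rewrite -[RHS]x1 increment_pathE//; apply: eq_bigr => i _.
by rewrite clamp_large ?mul1r// mulr1 lerBrDr addrC natr1 ler_nat.
Qed.

(** [dyadic_floor 0 t] is 0, or 1 when t = 1, and the path is pinned at both. *)
Lemma increment_path_dyadic_floor0 (R : realType) n (x : n.-tuple R) t :
  simplex x -> 0 <= t <= 1 -> increment_path x (dyadic_floor 0 t) = dyadic_floor 0 t.
Proof.
move=> xs t01; have := truncn_pow2_le 0 t01; rewrite /dyadic_floor /dyadic expn0 divr1.
by case: (Num.truncn _) => [|[|//]] _; [exact: increment_path0|exact: increment_path1].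
Qed.

Section uniform_simplex_paths.
Context {R : realType} (d : nat -> measure_display) (T : forall m, measurableType (d m))
  (P : forall m, probability (T m) R).
Variables (X : forall m, {RV (P m) >-> m.+1.-tuple R}).
Hypothesis X_uniform : forall m A, measurable A -> distribution (P m) (X m) A = uniform_simplex A.

Let X' m := simplex_modification (X m).
Let X'X m w : simplex (X m w) -> X' w = X m w := @simplex_modificationE _ _ _ _ _ (X m) w.
Let X'_simplex m (w : T m) : simplex (X' w) := simplex_modification_simplex (X m) w.
Let mX' m : measurable_fun setT (@X' m) := measurable_simplex_modification (X m).

Let path_osc m r := @oscillation_bound _ _ _ _ m _ _ (@X_uniform m) (@X'X m) (@X'_simplex m) (@mX' m) r.

(** The deviation vanishes on the grid of generation 0, so [oscillation_bound] with [r = 0] controls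
    the whole scaled deviation, in mean by 100 + 2 = 102; Markov's inequality gives the bound 102 /
    (e sqrt n). *)
Lemma increment_path_cvg_in_probability e : 0 < e ->
  (fun m => P m [set w | e <= sup_norm01 (fun t => increment_path (X m w) t - t)]) @ \oo --> 0%E.
Proof.
move=> e0; pose s m : R := Num.sqrt m.+1%:R.
have s0 m : 0 < s m by rewrite sqrtr_gt0.
have s1 m : 1 <= s m by rewrite -sqrtr1 ler_sqrt// ler1n.
have xE m (w : T m) : (fun t => increment_path (X m w) t - t) = (fun t => (s m)^-1 * scaled_path (X m w) t).
  by apply/funext => t; rewrite /scaled_path mulKf// gt_eqF// s0.
have xC m (w : T m) : C01 (fun t => increment_path (X m w) t - t).
  rewrite xE => t; apply: cvgM; first exact: cvg_cst.
  exact: scaled_path_C01.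
have mD m : measurable_fun setT (fun w : T m => sup_norm01 (fun t => increment_path (X m w) t - t)).
  apply: (@measurable_lipschitz01 _ _ _ (P m) (fun w t => increment_path (X m w) t - t)
    (xC m) _ 1 (@sup_norm01 R)) => // [t t01|].
    under eq_fun do rewrite (congr1 (fun f => f t) (xE m _)).
    apply: measurable_funM => //; apply: measurable_scaled_path; first exact: measurable_funPT.
    by have /andP[] := t01.
  exact: sup_norm01_lipschitz.
pose A m := [set w | e <= sup_norm01 (fun t => increment_path (X m w) t - t)].
have mA m : measurable (A m).
  rewrite (_ : A m = (fun w => sup_norm01 (fun t => increment_path (X m w) t - t)) @^-1` `[e, +oo[%classic).
    by rewrite -[_ @^-1` _]setTI; apply: mD.
  by apply/seteqP; split => w /=; rewrite in_itv/= andbT.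
have bound m : (P m (A m) <= (102 / e * (s m)^-1)%:E)%E.
  have [K [iK Kb Kl]] := @path_osc m 0 isT.
  have Ks w : s m * sup_norm01 (fun t => increment_path (X' w) t - t) <= K w.
    rewrite -ler_pdivlMl//; apply: sup_norm01_le => t t01.
    rewrite ler_pdivlMl// -[s m]gtr0_norm// -normrM.
    apply: le_trans (Kb w t t01); rewrite /scaled_path -/(s m).
    suff -> : increment_path (X' w) (dyadic_floor 0 t) = dyadic_floor 0 t.
      by rewrite subrr mulr0 subr0.
    exact: increment_path_dyadic_floor0.
  have K0 w : 0 <= K w by apply: le_trans (Ks w); rewrite mulr_ge0 ?sup_norm01_ge0// ltW.
  pose S := X m @^-1` (simplex (n := m.+1)).
  have mS : measurable S.
    by rewrite -[S]setTI; apply: measurable_funPT => //; exact: measurable_simplex.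
  have es0 : 0 < e * s m by rewrite mulr_gt0.
  have mK : measurable_fun setT (fun w => (K w)%:E) by exact: measurable_int iK.
  have mKe : measurable [set w | ((e * s m)%:E <= `|(K w)%:E|)%E].
    rewrite (_ : mkset _ = K @^-1` `[e * s m, +oo[%classic).
      by rewrite -[_ @^-1` _]setTI; move/measurable_EFinP : mK; exact.
    by apply/seteqP; split => w /=; rewrite in_itv/= andbT lee_fin ger0_norm.
  (* The majorant concerns the modification; the event on which [X] leaves the simplex is null. *)
  have sub : A m `<=` [set w | ((e * s m)%:E <= `|(K w)%:E|)%E] `|` ~` S.
    move=> w Aw; have [Sw|] := pselect (S w); [left|by right].
    rewrite /= lee_fin ger0_norm//; apply: le_trans (Ks w); rewrite mulrC.
    by rewrite ler_pM2l// X'X.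
  have PS : P m (~` S) = 0%E by exact: simplex_modification_null (@X_uniform m).
  have le1 : (P m (A m) <= P m [set w | ((e * s m)%:E <= `|(K w)%:E|)%E])%E.
    rewrite -[leRHS]adde0 -PS; apply: le_trans (measureU2 _ _ _) => //; last exact: measurableC.
    by apply: le_measure => //; rewrite inE//; apply: measurableU => //; exact: measurableC.
  apply: le_trans le1 _.
  have mk := @le_integral_abse _ _ _ (P m) setT measurableT _ _ mK es0.
  rewrite setTI in mk.
  have IK : (\int[P m]_w `|(K w)%:E|)%E = (\int[P m]_w K w)%:E.
    rewrite /Rintegral fineK; last exact: integrable_fin_num.
    by apply: eq_integral => w _; rewrite gee0_abs// lee_fin.
  rewrite IK in mk.
  rewrite -(@lee_pmul2l _ (e * s m)%:E)//; apply: le_trans mk _.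
  rewrite -EFinM lee_fin; apply: le_trans Kl _.
  have -> : e * s m * (102 / e * (s m)^-1) = 102.
    by field; rewrite !gt_eqF.
  rewrite expr0 mulr1; suff : 2 / s m <= 2 by rewrite -/(s m); lra.
  by rewrite ler_pdivrMr// ler_peMr.
apply: (@squeeze_cvge _ _ _ _ (cst 0%E) _ (fun m => (102 / e * (s m)^-1)%:E)).
- by near=> m; rewrite measure_ge0 bound.
- exact: cvg_cst.
- apply: cvg_EFin; first by near=> m.
  rewrite -[X in _ --> X](mulr0 (102 / e)).
  by apply: cvgM; [exact: cvg_cst|exact: cvg_sqrt_harmonic].
Unshelve. all: by end_near. Qed.

Context d' (T' : measurableType d') (P' : probability T' R) (B : T' -> R -> R).
Hypothesis B_bridge : brownian_bridge P' B.

Lemma scaled_path_oscillation e : 0 < e -> \forall r \near \oo, \forall m \near \oo,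
  exists K : T m -> R, [/\ (P m).-integrable setT (fun w => (K w)%:E),
    forall w t, 0 <= t <= 1 ->
      `|scaled_path (X' w) t - step_path r (scaled_path (X' w)) t| <= K w &
    \int[P m]_w K w <= e].
Proof.
move=> e0.
have th : 100 * (9 / 10) ^+ r @[r --> \oo] --> (0 : R).
  rewrite -[X in _ --> X](mulr0 100); apply: cvgM; first exact: cvg_cst.
  by apply: cvg_expr; rewrite ger0_norm; lra.
have sq : 2 / Num.sqrt m.+1%:R @[m --> \oo] --> (0 : R).
  by rewrite -[X in _ --> X](mulr0 2); apply: cvgM; [exact: cvg_cst|exact: cvg_sqrt_harmonic].
have e2 : 0 < e / 2 by rewrite divr_gt0.
near=> r; near=> m.
have rm : (2 ^ r <= m.+1)%N by apply: leqW; near: m; exact: nbhs_infty_ge.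
have [K [iK Kb Kl]] := @path_osc m r rm.
exists K; split => //; apply: le_trans Kl _.
have h1 : 100 * (9 / 10) ^+ r <= e / 2.
  apply: le_trans (ler_norm _) _.
  by near: r; exact: cvgr0_norm_le th _ e2.
have h2 : 2 / Num.sqrt m.+1%:R <= e / 2.
  apply: le_trans (ler_norm _) _.
  by near: m; exact: cvgr0_norm_le sq _ e2.
lra.
Unshelve. all: by end_near. Qed.

Lemma scaled_path_fdd N (t : 'I_N -> R) : (forall j, 0 <= t j <= 1) ->
  forall (G : ('I_N -> R) -> R) (K : R), 0 <= K ->
  (forall v u, `|G v - G u| <= K * \sum_i `|v i - u i|) ->
  \int[P m]_w G (fun j => scaled_path (X' w) (t j)) @[m --> \oo] -->
  \int[P']_w G (fun j => B w (t j)).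
Proof.
move=> t01 G K K0 GK.
pose v (a : 'I_N -> R) := \sum_j \sum_l a j * a l * (Num.min (t j) (t l) - t j * t l).
have Bm := brownian_bridge_form_moment B_bridge t01.
apply: (@cvg_expectation_lipschitz R N _ _ P (fun m w j => scaled_path (X' w) (t j))
  _ _ P' (fun w j => B w (t j)) _ _ _ _ G K K0 GK).
- by move=> m a k; exact: (@integrable_path_form _ _ _ P X X' X_uniform X'X X'_simplex mX' _ _ t01).
- by move=> a k; exact: (Bm a k).1.
- move=> a; exists (v a); last by move=> k; exact: (Bm a k).2.
  (* [v a] is non-negative because it is a second moment. *)
  rewrite -(gauss_coef2 (v a)) -(Bm a 2).2.
  by apply: Rintegral_ge0 => w _; exact: sqr_ge0.
- move=> a k; rewrite (Bm a k).2.
  exact: (@cvg_path_moment _ _ _ P X X' X_uniform X'X X'_simplex mX' _ _ t01).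
Qed.

Lemma scaled_path_cvg_in_distribution :
  cvg_in_distribution P (fun m (w : T m) => scaled_path (X m w)) P' B.
Proof.
move=> F Fc [M FM].
have mX m : measurable_fun setT (X m) by exact: measurable_funPT.
have wc := @weak_convergence R _ _ P (fun m w => scaled_path (X' w)) _ _ P' B
  (fun m w => @scaled_path_C01 _ _ (X' w))
  (fun m t t01 => measurable_scaled_path (@mX' m) (proj1 (andP t01)))
  (@brownian_bridge_C01 _ _ _ _ _ B_bridge)
  (@measurable_brownian_bridge _ _ _ _ _ B_bridge) scaled_path_fdd scaled_path_oscillation
  F M Fc FM.
have iB : P'.-integrable setT (fun w => (F (B w))%:E).
  apply: (@bounded_RV_integrable _ _ _ _ (fun w => F (B w)) M).
    exact: (@measurable_continuous_functional _ _ _ P' _ (@brownian_bridge_C01 _ _ _ _ _ B_bridge)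
      (@measurable_brownian_bridge _ _ _ _ _ B_bridge) _ _ Fc FM).
  by move=> w; apply: FM; exact: brownian_bridge_C01 B_bridge _.
have mF m (Z : T m -> m.+1.-tuple R) : measurable_fun setT Z ->
    measurable_fun setT (fun w => F (scaled_path (Z w))).
  move=> mZ; exact: (@measurable_continuous_functional _ _ _ (P m) (fun w => scaled_path (Z w))
    (fun w => @scaled_path_C01 _ _ (Z w))
    (fun t t01 => measurable_scaled_path mZ (proj1 (andP t01))) _ _ Fc FM).
have iX m : (P m).-integrable setT (fun w => (F (scaled_path (X' w)))%:E).
  apply: (@bounded_RV_integrable _ _ _ _ (fun w => F (scaled_path (X' w))) M); first exact: mF.
  by move=> w; apply: FM; exact: scaled_path_C01.
(* Passing from [X] to its modification changes no expectation, as the two agree almost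
   everywhere. *)
have EX m : ('E_(P m)[fun w => F (scaled_path (X m w))] =
    (\int[P m]_w F (scaled_path (X' w)))%:E)%E.
  rewrite unlock /Rintegral fineK; last exact: integrable_fin_num.
  apply: ae_eq_integral => //; [exact/measurable_EFinP/mF|exact/measurable_EFinP/mF|].
  have := simplex_modification_ae (@X_uniform m).
  by apply: filterS => w E _; rewrite /X' E.
have EB : ('E_P'[fun w => F (B w)] = (\int[P']_w F (B w))%:E)%E.
  by rewrite unlock /Rintegral fineK//; exact: integrable_fin_num.
rewrite EB (_ : (fun m => _) = (fun m => (\int[P m]_w F (scaled_path (X' w)))%:E)); last first.
  by apply/funext => m; exact: EX.
by apply: cvg_EFin => //; near=> m.
Unshelve. all: by end_near. Qed.

End uniform_simplex_paths.

Theorem theorem1 (R : realType) (d : nat -> measure_display)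
    (T : forall n, measurableType (d n)) (P : forall n, probability (T n) R)
    (p : forall n, {RV (P n) >-> n.-tuple R})
    (p_uniform : forall n, (0 < n)%N -> forall A : set (n.-tuple R),
       measurable A -> distribution (P n) (p n) A = uniform_simplex A) :
  let Y n (w : T n) : R -> R := increment_path (p n w) in
  cvg_in_probability P Y (fun t => t) /\
  (forall (d' : measure_display) (T' : measurableType d')
          (P' : probability T' R) (B : T' -> R -> R),
     brownian_bridge P' B ->
     cvg_in_distribution P
       (fun n (w : T n) t => Num.sqrt n%:R * (Y n w t - t)) P' B).
Proof.
(* Nothing is assumed of [p 0], the simplex being empty for [n = 0]; limits are unaffected by the
   shift to n = m + 1. *)
pose X m : {RV (P m.+1) >-> m.+1.-tuple R} := p m.+1.
have X_uniform m := p_uniform m.+1 isT.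
split=> [e e0|d' T' P' B B_bridge F Fc FM]; rewrite -cvg_shiftS.
  exact: (@increment_path_cvg_in_probability _ _ _ (fun m => P m.+1) X X_uniform).
exact: (@scaled_path_cvg_in_distribution _ _ _ (fun m => P m.+1) X X_uniform _ _ _ _ B_bridge F Fc FM).
Qed.
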